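(* Suppose Assumptions A2, A4(iii) and A5(i) hold, and that the score function $J:B\to\mathbb R^p$ is $\nu$-a.e. continuous. Then, under $\mathrm H_0$, $\mathbf W_n\overset d\to N(\mathbf 0_p,\Sigma_{\mathrm{ERD}})$ as $n\to\infty$.
   Context: $\mathcal G$ is a compact subgroup of $\mathrm O(p)$ with normalized Haar measure $\mathrm{Uniform}(\mathcal G)$. Data $\mathbf X_1,\dots,\mathbf X_n$ i.i.d. from $\mu$ with a Lebesgue density; $\mathrm H_0$: $\mathbf X_1\overset d=Q\mathbf X_1$ for all $Q\in\mathcal G$. For each $n$, fixed reference points $\mathbf h_1,\dots,\mathbf h_n\in B$ with $\nu_n=\frac1n\sum_i\delta_{\mathbf h_i}$; $\nu$ is a Borel probability measure concentrated on $B\subset\mathbb R^p$. Let $(\{\hat Q_i\},\hat\sigma)$ minimize $\sum_{i=1}^n\|Q_i^\top\mathbf X_{\sigma(i)}-\mathbf h_i\|^2$ over $Q_i\in\mathcal G$ and permutations $\sigma$; $S_n(\mathbf X_i)=\hat Q_{\hat\sigma^{-1}(i)}$, $R_n(\mathbf X_i)=\mathbf h_{\hat\sigma^{-1}(i)}$ (ties broken uniformly at random: first among optimal permutations, then $\hat Q_i$ from $\mathrm{Uniform}(\mathcal G)$ conditioned on the minimizing set, independently). For a score function $J$, $\mathbf W_n=\frac1{\sqrt n}\sum_{i=1}^nS_n(\mathbf X_i)J(R_n(\mathbf X_i))$. The effective reference distribution (ERD) is the law of $SJ(\mathbf H)$ with $S\sim\mathrm{Uniform}(\mathcal G)$ independent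 of $\mathbf H\sim\nu$; $\Sigma_{\mathrm{ERD}}$ is its covariance matrix. A2: $\nu_n\to\nu$ weakly. A4(iii): with $\mathbf H_n\sim\nu_n$, $\mathbb E|J(\mathbf H_n)_iJ(\mathbf H_n)_j|\to\mathbb E|J(\mathbf H)_iJ(\mathbf H)_j|<\infty$ for all $i,j\in\{1,\dots,p\}$. A5(i): $\mathbb E[S]=\mathbf 0_{p\times p}$ for $S\sim\mathrm{Uniform}(\mathcal G)$. *)

(* Defs.v *)
From HB Require Import structures.
From mathcomp Require Import all_boot all_order all_algebra all_fingroup.
From mathcomp Require Import all_classical all_reals all_analysis.
From mathcomp Require Import measurable_realfun.

Set Implicit Arguments.
Unset Strict Implicit.
Unset Printing Implicit Defensive.

Import Order.TTheory GRing.Theory Num.Theory.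
Import numFieldNormedType.Exports.

Local Open Scope classical_set_scope.
Local Open Scope ring_scope.

Definition Bor (T : ptopologicalType) := g_sigma_algebraType (@open T).

Section Defs.
Variable R : realType.
Variable p : nat.

Notation vec := 'cV[R]_p.
Notation mat := 'M[R]_p.

Definition sqnorm (v : vec) : R := \sum_(k < p) (v k 0) ^+ 2.
Definition dotv (u v : vec) : R := (u^T *m v) 0 0.

Definition compact_subgroup_O (G : set mat) : Prop :=
  [/\ compact G, G 1%:M,
      (forall Q1 Q2, G Q1 -> G Q2 -> G (Q1 *m Q2)),
      (forall Q, G Q -> G (invmx Q)) &
      (forall Q, G Q -> Q^T *m Q = 1%:M)].

Definition is_haar (G : set mat) (haar : probability (Bor mat) R) : Prop :=
  haar G = 1%E /\
  forall Q, G Q -> forall C : set (Bor mat), measurable C ->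
    haar ((fun M : Bor mat => (Q *m M : Bor mat)) @^-1` C) = haar C.

Definition MinSet (G : set mat) (x h : vec) : set mat :=
  [set Q | G Q /\ forall Q', G Q' -> sqnorm (Q^T *m x - h) <= sqnorm (Q'^T *m x - h)].

Definition unif_cond (G : set mat) (haar : probability (Bor mat) R) (M : set mat)
    (kappa : probability (Bor mat) R) : Prop :=
  if `[< (0 < haar M)%E >] then
    forall C : set (Bor mat), measurable C ->
      kappa C = (fine (haar (C `&` M)) / fine (haar M))%:E
  else
    kappa M = 1%E /\
    forall g, G g -> (fun Q => Q *m g) @` M = M ->
      forall C : set (Bor mat), measurable C ->
        kappa ((fun Q : Bor mat => (Q *m g : Bor mat)) @^-1` C) = kappa C.

Definition assign_cost n (x h : 'I_n -> vec)
    (s : {perm 'I_n}) (Q : 'I_n -> mat) : R :=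
  \sum_(i < n) sqnorm ((Q i)^T *m x (s i) - h i).

Definition joint_opt (G : set mat) n (x h : 'I_n -> vec)
    (s : {perm 'I_n}) (Q : 'I_n -> mat) : Prop :=
  (forall i, G (Q i)) /\
  forall s' Q', (forall i, G (Q' i)) ->
    assign_cost x h s Q <= assign_cost x h s' Q'.

Definition opt_perm (G : set mat) n (x h : 'I_n -> vec) (s : {perm 'I_n}) : Prop :=
  exists Q, joint_opt G x h s Q.

Definition n_opt (G : set mat) n (x h : 'I_n -> vec) : nat :=
  #|[set s : {perm 'I_n} | `[< opt_perm G x h s >]]|.

Definition box (a b : vec) : set vec := [set x | forall k, a k 0 <= x k 0 <= b k 0].
Definition box_vol (a b : vec) : R := \prod_(k < p) (b k 0 - a k 0).

Definition is_lebesgue (lam : {measure set (Bor vec) -> \bar R}) : Prop :=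
  forall a b : vec, (forall k, a k 0 <= b k 0) -> lam (box a b) = (box_vol a b)%:E.

Definition has_lebesgue_density (mu : probability (Bor vec) R) : Prop :=
  forall lam : {measure set (Bor vec) -> \bar R}, is_lebesgue lam ->
  exists f : Bor vec -> R, [/\ measurable_fun setT f, (forall x, 0 <= f x) &
    forall A : set (Bor vec), measurable A -> mu A = (\int[lam]_(x in A) (f x)%:E)%E].

Definition bounded_continuous (f : vec -> R) : Prop :=
  continuous f /\ exists M : R, forall x, `|f x| <= M.

(* E[F(S,H)] with S ~ haar, H ~ nu independent *)
Definition E_ERD (haar : probability (Bor mat) R) (nu : probability (Bor vec) R)
    (F : mat -> vec -> R) : \bar R :=
  (\int[nu]_h (\int[haar]_Q (F Q h)%:E))%E.

(* covariance matrix of the effective reference distribution, law of S J(H) *)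
Definition Sigma_ERD (haar : probability (Bor mat) R) (nu : probability (Bor vec) R)
    (J : vec -> vec) : mat :=
  \matrix_(a < p, b < p)
    (fine (E_ERD haar nu (fun Q h => (Q *m J h) a 0 * (Q *m J h) b 0))
     - fine (E_ERD haar nu (fun Q h => (Q *m J h) a 0))
       * fine (E_ERD haar nu (fun Q h => (Q *m J h) b 0))).

(* gamma is the Gaussian law N(0, Sigma), defined by its characteristic function *)
Definition is_normal0 (Sigma : mat) (gamma : probability (Bor vec) R) : Prop :=
  forall t : vec,
    (\int[gamma]_x (cos (dotv t x))%:E)%E = (expR (- ((t^T *m Sigma *m t) 0 0) / 2))%:E
    /\ (\int[gamma]_x (sin (dotv t x))%:E)%E = 0%E.

Definition cont_within (B : set vec) (J : vec -> vec) (h : vec) : Prop :=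
  J x @[x --> within B (nbhs h)] --> J h.

End Defs.

(* Main.v *)
Require Import Defs.
From HB Require Import structures.
From mathcomp Require Import all_boot all_order all_algebra all_fingroup.
From mathcomp Require Import all_classical all_reals all_analysis.
From mathcomp Require Import measurable_realfun.
From mathcomp Require Import ring lra.

Set Implicit Arguments.
Unset Strict Implicit.
Unset Printing Implicit Defensive.

Import Order.TTheory GRing.Theory Num.Theory.
Import numFieldNormedType.Exports.

Local Open Scope classical_set_scope.
Local Open Scope ring_scope.


(** The cost of an assignment depends on the data only through the support
function [x |-> max_(Q in G) <x, Q h>], which is G-invariant, and [Q] is a
minimizer exactly when it attains this maximum. Since the support function is
convex, for Lebesgue-almost every [x] all the maximizers [Q] have the same
image [Q h], so they form a coset of the stabilizer of [h]; the tie-breaking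
law is then the unique law on that coset invariant under the stabilizer, and it
is equivariant in [x]. Under H0 the tie-breaking law averaged against any
G-invariant weight of one observation is therefore left invariant, hence a
multiple of the Haar measure. Replacing the rotations one at a time shows that
Q-hat_1, ..., Q-hat_n are i.i.d. Uniform(G), whatever the optimal assignment.

After reindexing by sigma-hat, W_n is a normalized sum of independent centered
vectors Q-hat_i J(h_i). Convergence of the absolute second moments, together
with the almost sure continuity of J, gives convergence of the covariances and
asymptotic negligibility of the largest summand, so that a Lindeberg argument
gives the limit of the characteristic functions. These determine the limits of
E f(W_n) because a bounded continuous function is approximated on cubes by
uniformly bounded trigonometric polynomials. *)

(** When the minimizing set is Haar-null, [unif_cond] describes the tie-breaking law only through
    its invariance under right multiplications preserving that set. Invariance under the stabilizer
    determines a law only if it lives on a single coset, and this is where the density of [mu]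
    matters: it discards the points at which the support function has a kink. Since
    [has_lebesgue_density] yields a density with respect to any measure with the right values on
    boxes, such a measure has to be constructed.

    The analytic obstacle is that weak convergence tests functions continuous on the whole space,
    while [J] is continuous only relatively to [B], and only almost everywhere. Continuous minorants
    then give one-sided limits, and the convergence of the averages of absolute products makes them
    two-sided.

    In the passage from characteristic functions to laws, the approximants of [f] must keep its
    bound on the whole space, because they are compared with [f] outside the cube too. Bernstein
    averages do so since their weights form a probability. *)

Lemma ler_coord_norm {R : realType} m n (M : 'M[R]_(m, n)) i j :
  `|M i j| <= `|M|.
Proof.
by rewrite [leRHS]/Num.norm/= mx_normrE; apply/bigmax_geP; right; exists (i, j).
Qed.

(** * Borel sets of matrices and Lebesgue measure *)

Section borel_matrix.
Context {R : realType} {m n : nat}.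
Implicit Types (M c : 'M[R]_(m, n)) (r : R).

Definition cbox c r : set 'M[R]_(m, n) :=
  [set M | forall i j, `|M i j - c i j| <= r].

(** Second countability by rational boxes: a rational radius below [e / 2] and a rational centre
    within that radius of [x] keep the box inside the ball of radius [e] around [x]. *)
Lemma open_bigcup_cbox (U : set 'M[R]_(m, n)) : open U ->
  U = \bigcup_(q in [set q : 'M[rat]_(m, n) * rat |
        cbox (map_mx ratr q.1) (ratr q.2) `<=` U])
        cbox (map_mx ratr q.1) (ratr q.2).
Proof.
move=> oU; apply/seteqP; split=> [x Ux|x [q qU qx]]; last exact: qU.
have /nbhs_ballP[e /= e0 xeU] : nbhs x U by exact: open_nbhs_nbhs.
have /rat_in_itvoo[r] : 0 < e / 2 :> R by rewrite divr_gt0.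
rewrite in_itv/= => /andP[r0 re].
have cP i j : exists c : rat, `|x i j - ratr c| < ratr r :> R.
  have /rat_in_itvoo[c] : x i j - ratr r < x i j + ratr r.
    by rewrite ltrBlDr -addrA ltrDl addr_gt0.
  rewrite in_itv/= => /andP[c1 c2]; exists c.
  by rewrite distrC ltr_distl c1 c2.
have [c cx] := choice (fun ij => cP ij.1 ij.2).
exists (\matrix_(i, j) c (i, j), r) => /=; last first.
  by move=> i j; rewrite !mxE ltW// (cx (i, j)).
move=> y /= yP; apply: xeU; split=> // i j; rewrite /ball/=.
have := yP i j; have := cx (i, j); rewrite !mxE/= => h1 h2.
rewrite (le_lt_trans (ler_distD (ratr (c (i, j))) _ _))//.
rewrite (splitr e) ltrD// ?(lt_trans h1)//.
by rewrite distrC (le_lt_trans h2).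
Qed.

(** Open sets generate, each is a countable union of boxes, and the preimage of a box is a finite
    intersection of coordinate conditions. *)
Lemma measurable_fun_mx d (T : measurableType d) (f : T -> Bor 'M[R]_(m, n)) :
  (forall i j, measurable_fun setT (fun w => (f w : 'M[R]_(m, n)) i j)) ->
  measurable_fun setT f.
Proof.
move=> mf; apply: (@measurability _ _ _ (Bor 'M[R]_(m, n)) _ _
  (@open 'M[R]_(m, n) : set (set (Bor 'M[R]_(m, n)))) erefl).
move=> _ [U oU <-].
rewrite setTI (open_bigcup_cbox oU) preimage_bigcup bigcup_mkcond.
apply: countable_bigcupT_measurable => // q.
case: ifPn => // _; rewrite [X in measurable X](_ : _ = \bigcap_(ij in setT)
    (fun w => (f w : 'M[R]_(m, n)) ij.1 ij.2) @^-1`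
      [set x | `|x - (map_mx ratr q.1) ij.1 ij.2| <= ratr q.2]); last first.
  apply/seteqP; split=> [w + [i j] _|w + i j]; first exact.
  by move/(_ (i, j)); exact.
apply: fin_bigcap_measurable => // -[i j] _ /=; rewrite -[X in measurable X]setTI.
apply: mf => //; rewrite [X in measurable X](_ : _ =
    `[map_mx ratr q.1 i j - ratr q.2, map_mx ratr q.1 i j + ratr q.2]%classic).
  exact: measurable_itv.
by apply/seteqP; split=> x /=; rewrite in_itv/= ler_distl.
Qed.

Lemma open_measurable_mx (U : set (Bor 'M[R]_(m, n))) :
  @open 'M[R]_(m, n) U -> measurable U.
Proof. exact: sub_sigma_algebra. Qed.

Lemma closed_measurable_mx (U : set (Bor 'M[R]_(m, n))) :
  @closed 'M[R]_(m, n) U -> measurable U.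
Proof.
move=> cU; rewrite -(setCK U); apply: measurableC.
by apply: open_measurable_mx; exact: closed_openC.
Qed.

Lemma continuous_measurable_mx (f : 'M[R]_(m, n) -> R) :
  continuous f -> measurable_fun setT (f : Bor 'M[R]_(m, n) -> R).
Proof.
move=> /continuousP cf; apply: (measurability _ (RGenOpens.measurableE R)).
move=> _ [_ [a [b ->] <-]]; rewrite setTI; apply: open_measurable_mx.
exact/cf/interval_open.
Qed.

Lemma measurable_coord i j :
  measurable_fun setT (fun M : Bor 'M[R]_(m, n) => (M : 'M[R]_(m, n)) i j).
Proof. by apply: continuous_measurable_mx; exact: coord_continuous. Qed.

Lemma measurable_fun_coord d (T : measurableType d)
    (f : T -> Bor 'M[R]_(m, n)) i j : measurable_fun setT f ->
  measurable_fun setT (fun w => (f w : 'M[R]_(m, n)) i j).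
Proof. by move=> mf; exact: measurableT_comp (measurable_coord i j) mf. Qed.

End borel_matrix.

Section borel_matrix_operations.
Context {R : realType} d (T : measurableType d).

Lemma measurable_fun_mulmx m n k (f : T -> Bor 'M[R]_(m, n))
    (g : T -> Bor 'M[R]_(n, k)) :
  measurable_fun setT f -> measurable_fun setT g ->
  measurable_fun setT (fun w => (f w : 'M[R]_(m, n)) *m g w : Bor 'M[R]_(m, k)).
Proof.
move=> mf mg; apply: measurable_fun_mx => i j; under eq_fun do rewrite mxE.
by apply: measurable_sum => l; apply: measurable_funM; exact: measurable_fun_coord.
Qed.

Lemma measurable_fun_trmx m n (f : T -> Bor 'M[R]_(m, n)) :
  measurable_fun setT f ->
  measurable_fun setT (fun w => (f w : 'M[R]_(m, n))^T : Bor 'M[R]_(n, m)).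
Proof.
move=> mf; apply: measurable_fun_mx => i j; under eq_fun do rewrite mxE.
exact: measurable_fun_coord.
Qed.

End borel_matrix_operations.

Section pushfwd.
Context {R : realType} d1 d2 (T1 : measurableType d1) (T2 : measurableType d2).
Variables (m : {measure set T1 -> \bar R}) (f : T1 -> T2).
Hypothesis mf : measurable_fun setT f.

Definition pushfwd : {measure set T2 -> \bar R} :=
  measure_function_pushforward__canonical__measure_function_Measure m mf.

Lemma pushfwdE A : pushfwd A = m (f @^-1` A). Proof. by []. Qed.

Lemma ge0_integral_pushfwd (g : T2 -> \bar R) : measurable_fun setT g ->
  (forall y, 0 <= g y)%E -> (\int[pushfwd]_y g y = \int[m]_x g (f x))%E.
Proof. by move=> mg g0; exact: ge0_integral_pushforward. Qed.

End pushfwd.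

Section sigma_finite_pack.
Context {R : realType} d (T : measurableType d).
Variables (m : {measure set T -> \bar R}) (fm : sigma_finite setT m).

Let m' : set T -> \bar R := m.
HB.instance Definition _ := Measure.on m'.
HB.instance Definition _ := Measure_isSigmaFinite.Build _ _ _ m' fm.

(** Tonelli's theorem reads sigma-finiteness from the structure of the measure, whereas here it is a
    proved property; [m'] is a copy of [m] that carries both. *)
Definition sigma_finite_pack : {sigma_finite_measure set T -> \bar R} := m'.

End sigma_finite_pack.

(** * Lebesgue measure on column vectors: uniqueness, existence, null sets *)

Section lebesgue.
Context {R : realType}.

Section dim.
Context {p : nat}.
Implicit Types (a b v : 'cV[R]_p) (lam : {measure set (Bor 'cV[R]_p) -> \bar R}).

Lemma measurable_box a b : measurable (box a b : set (Bor 'cV[R]_p)).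
Proof.
rewrite [X in measurable X](_ : _ = \bigcap_(k in [set: 'I_p])
    (fun x : Bor 'cV[R]_p => (x : 'cV[R]_p) k 0) @^-1` `[a k 0, b k 0]%classic).
  apply: fin_bigcap_measurable => // k _; rewrite -[X in measurable X]setTI.
  by apply: measurable_coord => //; exact: measurable_itv.
by apply/seteqP; split=> [x bx k _|x bx k]; [|have := bx k I]; rewrite /= in_itv/=.
Qed.

Lemma box_sub_empty a b k : b k 0 < a k 0 -> box a b = set0.
Proof.
move=> ba; apply/seteqP; split=> // x /(_ k) /andP[ax xb].
by have := le_lt_trans (le_trans ax xb) ba; rewrite ltxx.
Qed.

Lemma bigcup_box : \bigcup_n box (const_mx (- n%:R)) (const_mx n%:R) =
  [set: 'cV[R]_p].
Proof.
apply/seteqP; split=> // x _.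
exists (Num.truncn `|x|).+1 => // k; rewrite !mxE -ler_norml.
exact: le_trans (ler_coord_norm _ _ _) (ltW (truncnS_gt _)).
Qed.

Lemma measurable_g_box (A : set (Bor 'cV[R]_p)) : measurable A ->
  <<s [set B | exists a b, B = box a b] >> A.
Proof.
move: A; apply: smallest_sub; first exact: smallest_sigma_algebra.
move=> U /= oU; rewrite (open_bigcup_cbox oU) bigcup_mkcond.
apply: (@countable_bigcupT_measurable _
  (g_sigma_algebraType [set B | exists a b, B = box a b])) => // q.
case: ifPn => // _; apply: sub_sigma_algebra.
set c := map_mx _ _; set r := ratr _.
exists (c - const_mx r), (c + const_mx r); apply/seteqP; split=> x /= xP.
  by move=> k; have := xP k 0; rewrite !mxE ler_distl.
by move=> k j; rewrite ord1; have := xP k; rewrite !mxE ler_distl.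
Qed.

Lemma lebesgue_box lam a b : is_lebesgue lam ->
  lam (box a b) = if [forall k, a k 0 <= b k 0] then (box_vol a b)%:E else 0%E.
Proof.
move=> Llam; case: ifPn => [/forallP ab|]; first exact: Llam.
rewrite negb_forall => /existsP[k]; rewrite -ltNge => /box_sub_empty ->.
exact: measure0.
Qed.

(** Boxes generate, are stable under intersection, and those of size [n] around 0 exhaust the space
    with finite measure. A box with reversed corners is empty, so its value is forced too. *)
Lemma lebesgue_unique lam1 lam2 : is_lebesgue lam1 -> is_lebesgue lam2 ->
  forall A, measurable A -> lam1 A = lam2 A.
Proof.
move=> L1 L2 A mA.
pose g n : set (Bor 'cV[R]_p) := box (const_mx (- n%:R)) (const_mx n%:R).
pose G : set (set (Bor 'cV[R]_p)) := [set B | exists a b, B = box a b].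
have GA : <<s G >> A by exact: measurable_g_box.
apply: (@g_sigma_algebra_measure_unique _ R _ G _ g) GA => //.
- by move=> _ [a [b ->]]; exact: measurable_box.
- by move=> n; exists (const_mx (- n%:R)), (const_mx n%:R).
- exact: bigcup_box.
- move=> _ _ [a [b ->]] [a' [b' ->]].
  exists (\col_k Num.max (a k 0) (a' k 0)), (\col_k Num.min (b k 0) (b' k 0)).
  apply/seteqP; split=> [x [xP xP'] k|x xP].
    have /andP[ax xb] := xP k; have /andP[ax' xb'] := xP' k.
    by rewrite !mxE ge_max le_min ax xb ax' xb'.
  by split=> k; have := xP k; rewrite !mxE ge_max le_min => /andP[/andP[? ?] /andP[? ?]]; exact/andP.
- by move=> _ [a [b ->]]; rewrite !lebesgue_box.
- by move=> k; rewrite lebesgue_box//; case: ifP; rewrite ltry.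
Qed.

Lemma measurable_fun_addmx v :
  measurable_fun setT (fun x : Bor 'cV[R]_p => (x : 'cV[R]_p) + v : Bor 'cV[R]_p).
Proof.
apply: measurable_fun_mx => i j; under eq_fun do rewrite mxE.
by apply: measurable_funD; [exact: measurable_coord|exact: measurable_cst].
Qed.

(** The translated measure has the same values on boxes, so uniqueness identifies it with [lam]. *)
Lemma lebesgue_translation lam v (A : set (Bor 'cV[R]_p)) :
  is_lebesgue lam -> measurable A ->
  lam ((fun x : 'cV[R]_p => x + v) @^-1` A) = lam A.
Proof.
move=> Llam mA; rewrite -(pushfwdE _ (measurable_fun_addmx v)).
apply: lebesgue_unique => // a b ab; rewrite pushfwdE.
rewrite (_ : _ @^-1` _ = box (a - v) (b - v)).
  rewrite Llam; first by congr EFin; apply: eq_bigr => k _; rewrite !mxE; ring.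
  by move=> k; rewrite !mxE lerD2r.
by apply/seteqP; split=> x xP k; have := xP k; rewrite !mxE lerBlDr lerBrDr.
Qed.

Lemma sigma_finite_lebesgue lam : is_lebesgue lam -> sigma_finite setT lam.
Proof.
move=> Llam; exists (fun n => box (const_mx (- n%:R)) (const_mx n%:R)).
  by rewrite bigcup_box.
move=> n; split; first exact: measurable_box.
by rewrite lebesgue_box//; case: ifP; rewrite ltry.
Qed.

End dim.

(** Induction on the dimension: the product of the one-dimensional measure with [lam], transported
    by putting the real coordinate on top of the column. In dimension 0 the only box is the
    one-point space and the empty product is 1, whence the Dirac mass. *)
Lemma lebesgue_exists p :
  exists lam : {measure set (Bor 'cV[R]_p) -> \bar R}, is_lebesgue lam.
Proof.
elim: p => [|p [lam Llam]].
  exists (dirac (0 : Bor 'cV[R]_0)) => a b _.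
  by rewrite /box_vol big_ord0 /= diracE mem_set//; case.
pose slam := sigma_finite_pack (sigma_finite_lebesgue Llam).
pose f (z : R * Bor 'cV[R]_p) : Bor 'cV[R]_p.+1 :=
  \col_i oapp (fun j => (z.2 : 'cV[R]_p) j 0) z.1 (unlift ord0 i).
have mf : measurable_fun setT f.
  apply: measurable_fun_mx => i j; under eq_fun do rewrite mxE.
  case: unliftP => [k _|_]/=; last exact: measurable_fst.
  exact: (@measurable_fun_coord _ _ _ _ _ (@snd R (Bor 'cV[R]_p))).
exists (pushfwd (product_measure1 (@lebesgue_measure R) slam) mf) => a b ab.
rewrite pushfwdE (_ : _ @^-1` _ = `[a 0 0, b 0 0]%classic `*`
  box (\col_k a (lift ord0 k) 0) (\col_k b (lift ord0 k) 0)); last first.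
  apply/seteqP; split=> [z zP|z [z1 z2] k].
    split=> [|k]; last by have := zP (lift ord0 k); rewrite !mxE liftK.
    by have := zP ord0; rewrite !mxE unlift_none/= in_itv.
  rewrite mxE; case: unliftP => [j ->|->]/=; last by move: z1; rewrite /= in_itv.
  by have := z2 j; rewrite !mxE.
rewrite [LHS]product_measure1E//; last exact: measurable_box.
rewrite /= lebesgue_measure_itv/= lte_fin Llam; last by move=> k; rewrite !mxE.
rewrite /box_vol big_ord_recl/= EFinM.
congr (_ * _)%E; last by congr EFin; apply: eq_bigr => k _; rewrite !mxE.
case: ltP => // ba; congr EFin; apply/esym/eqP.
by rewrite subr_eq0 eq_le ba ab.
Qed.

(* If A meets every line parallel to v at most once then its translates along
   v are pairwise disjoint, and a bounded part of A has infinitely many of them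
   in a fixed box. *)
Lemma lebesgue_transversal_null p (lam : {measure set (Bor 'cV[R]_p) -> \bar R})
    (A : set (Bor 'cV[R]_p)) (v : 'cV[R]_p) :
  is_lebesgue lam -> measurable A ->
  (forall (x : 'cV[R]_p) (t : R), A x -> A (x + t *: v) -> t = 0) -> lam A = 0%E.
Proof.
move=> Llam mA Av.
pose bx (r : R) : set (Bor 'cV[R]_p) := box (const_mx (- r)) (const_mx r).
have mbx r : measurable (bx r) by exact: measurable_box.
suff An n : lam (A `&` bx n%:R) = 0%E.
  rewrite (_ : A = \bigcup_n (A `&` bx n%:R)).
    have/= h := @measure_sigma_subadditive _ _ _ lam.
    apply/eqP; rewrite eq_le measure_ge0 andbT.
    apply: le_trans (h _ _ _ _ _) _; [| | exact: subset_refl|].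
    - by move=> n; exact: measurableI.
    - by apply: bigcupT_measurable => n; exact: measurableI.
    - by rewrite eseries0.
  by rewrite -setI_bigcupr (bigcup_box : \bigcup_n bx n%:R = _) setIT.
(* The shifts [1 / (k + 1)] are distinct, which makes the translates disjoint, and at most 1, which
   keeps them all inside [bx N]. *)
pose B k := (fun x : 'cV[R]_p => x + (- (k.+1%:R)^-1) *: v) @^-1` (A `&` bx n%:R).
have mB k : measurable (B k : set (Bor 'cV[R]_p)).
  rewrite -[X in measurable X]setTI.
  by apply: measurable_fun_addmx => //; exact: measurableI.
have lB k : lam (B k) = lam (A `&` bx n%:R).
  by apply: lebesgue_translation => //; exact: measurableI.
have tB : trivIset setT B.
  move=> i j _ _ [x [[Ai _] [Aj _]]].
  have := Av _ ((i.+1%:R)^-1 - (j.+1%:R)^-1) Ai.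
  rewrite -addrA -scalerDl addrA addNr add0r => /(_ Aj)/eqP.
  by rewrite subr_eq0 => /eqP/invr_inj/eqP; rewrite eqr_nat => /eqP[].
pose N := n%:R + `|v|.
have BN : \bigcup_k B k `<=` bx N.
  move=> x [k _ [_ xk]] i; rewrite !mxE -ler_norml.
  have := xk i; rewrite !mxE -ler_norml => xn.
  rewrite -[x i 0](subrK (k.+1%:R^-1 * v i 0)).
  rewrite (le_trans (ler_normD _ _))// normrM lerD//.
    by rewrite -mulNr.
  rewrite -[leRHS]mul1r ler_pM ?ler_coord_norm//.
  by rewrite ger0_norm// invf_le1// ler1n.
have : (lam (\bigcup_k B k) <= lam (bx N))%E.
  by apply: le_measure; rewrite ?inE//; exact: bigcupT_measurable.
rewrite measure_bigcup// => le_lam.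
have fbx r : (lam (bx r) < +oo)%E.
  by rewrite lebesgue_box//; case: ifP; rewrite ltry.
have Afin : lam (A `&` bx n%:R) \is a fin_num.
  rewrite ge0_fin_numE//; apply: le_lt_trans (fbx n%:R).
  by apply: le_measure; rewrite ?inE//; exact: measurableI.
have Nfin : lam (bx N) \is a fin_num by rewrite ge0_fin_numE.
(* For every [k], [k] disjoint translates of equal measure fit into [bx N]; this forces the common
   value to be 0. *)
have kle k : k%:R * fine (lam (A `&` bx n%:R)) <= fine (lam (bx N)).
  rewrite -lee_fin EFinM !fineK//; apply: le_trans le_lam.
  apply: le_trans (nneseries_lim_ge k _) => //.
  rewrite big_mkord (eq_bigl xpredT) => [|i]; last exact: mem_set.
  by under eq_bigr do rewrite lB; rewrite sumr_const card_ord mule_natl.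
apply/eqP; rewrite eq_le measure_ge0 andbT leNgt -(fineK Afin) lte_fin.
apply/negP => c0; set c := fine _ in c0 kle; set V := fine _ in kle.
have := kle (Num.truncn (V / c)).+1; rewrite -ler_pdivlMr//.
by rewrite leNgt truncnS_gt.
Qed.

End lebesgue.

(** * Integration over independent coordinates *)

Section bounded_integral.
Context {R : realType} d (T : measurableType d) (P : probability T R).

Lemma bounded_integrable (f : T -> R) (M : R) : measurable_fun setT f ->
  (forall x, `|f x| <= M) -> P.-integrable setT (EFin \o f).
Proof.
move=> mf fM; apply: measurable_bounded_integrable => //.
  by apply: le_lt_trans (ltry 1); exact: probability_le1.
exists M; split; first exact: num_real.
by move=> N MN x _; apply: le_trans (fM x) (ltW MN).
Qed.

Lemma integral_probability_cst (r : R) : (\int[P]_x r%:E = r%:E)%E.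
Proof. by rewrite integral_cst// [X in (_ * X)%E]probability_setT mule1. Qed.

Lemma Rintegral_probability_cst (r : R) : \int[P]_x r = r.
Proof. by rewrite /Rintegral integral_probability_cst. Qed.

Lemma EFin_bounded_integral (f : T -> R) (M : R) : measurable_fun setT f ->
  (forall x, `|f x| <= M) -> (\int[P]_x f x)%:E = (\int[P]_x (f x)%:E)%E.
Proof.
by move=> mf fM; rewrite fineK//; apply: integrable_fin_num => //;
  exact: bounded_integrable mf fM.
Qed.

Lemma le_norm_bounded_Rintegral (f : T -> R) (M : R) : measurable_fun setT f ->
  (forall x, `|f x| <= M) -> `|\int[P]_x f x| <= M.
Proof.
move=> mf fM; have fi := bounded_integrable mf fM.
apply: le_trans (le_normr_Rintegral _ fi) _ => //.
rewrite -[leRHS]Rintegral_probability_cst; apply: le_Rintegral => //.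
- by apply: (@bounded_integrable _ M) => [|x]; [exact: measurableT_comp|rewrite normr_id].
- by apply: (@bounded_integrable _ `|M|) => [|x].
Qed.

(** Adding a constant makes a bounded function nonnegative; this carries Tonelli identities over to
    bounded functions of either sign. *)
Lemma bounded_integralDr (f : T -> R) (M c : R) : measurable_fun setT f ->
  (forall x, `|f x| <= M) ->
  (\int[P]_x (f x + c)%:E)%E = (\int[P]_x f x + c)%:E.
Proof.
move=> mf fM; under eq_integral do rewrite EFinD.
rewrite integralD//; last 2 first.
- exact: bounded_integrable mf fM.
- exact: (@bounded_integrable (cst c) `|c|).
by rewrite integral_probability_cst -(EFin_bounded_integral mf fM).
Qed.

End bounded_integral.

Section independent_pair.
Local Open Scope ereal_scope.
Context {R : realType} d d1 d2 (Omega : measurableType d)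
  (T1 : measurableType d1) (T2 : measurableType d2).
Variables (P : probability Omega R) (m : probability T1 R).
Variables (Y : Omega -> T1) (Z : Omega -> T2).
Hypotheses (mY : measurable_fun setT Y) (mZ : measurable_fun setT Z).
Hypothesis indYZ : forall A B, measurable A -> measurable B ->
  P (Y @^-1` A `&` Z @^-1` B) = m A * P (Z @^-1` B).

Let mYZ : measurable_fun setT (fun w => (Y w, Z w)).
Proof. exact: measurable_fun_pair. Qed.

Let finZ : sigma_finite setT (pushfwd P mZ).
Proof.
apply: fin_num_fun_sigma_finite; first by rewrite measure0.
move=> A mA; rewrite pushfwdE; apply: fin_num_measure.
by rewrite -[X in measurable X]setTI; exact: mZ.
Qed.

(** On rectangles the pair has the product of [m] with the law of [Z]; uniqueness of product
    measures and Tonelli do the rest. *)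
Lemma ge0_integral_indep (F : T1 * T2 -> \bar R) :
  measurable_fun setT F -> (forall z, 0 <= F z) ->
  \int[P]_w F (Y w, Z w) = \int[P]_w \int[m]_y F (y, Z w).
Proof.
move=> mF F0; pose L := sigma_finite_pack finZ.
rewrite -(ge0_integral_pushfwd P mYZ)//.
transitivity (\int[m \x L]_z F z).
  apply: eq_measure_integral => A mA _; apply/esym.
  apply: (@product_measure_unique _ _ _ _ _ m L (pushfwd P mYZ)) => //.
rewrite fubini_tonelli2//.
rewrite -[RHS](ge0_integral_pushfwd P mZ (g := fun z => \int[m]_y F (y, z)))//.
  exact: measurable_fun_fubini_tonelli_G.
by move=> z; apply: integral_ge0.
Qed.

End independent_pair.

Section tuple_rect.
Context {R : realType} d (T : measurableType d) (n : nat).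

Definition rect (A : 'I_n -> set T) : set (n.-tuple T) :=
  [set t | forall i, A i (tnth t i)].

Lemma measurable_rect A : (forall i, measurable (A i)) -> measurable (rect A).
Proof.
move=> mA; rewrite [X in measurable X](_ : _ = \bigcap_(i in [set: 'I_n])
    (fun t : n.-tuple T => tnth t i) @^-1` (A i)).
  apply: fin_bigcap_measurable => // i _; rewrite -[X in measurable X]setTI.
  by apply: measurable_tnth => //.
by apply/seteqP; split=> [t At i _|t At i]; [exact: At|exact: At].
Qed.

Definition rects : set (set (n.-tuple T)) :=
  [set B | exists2 A, (forall i, measurable (A i)) & B = rect A].

(** A generator constrains a single coordinate, hence is a rectangle whose other sides are full. *)
Lemma measurable_tuple_rects (D : set (n.-tuple T)) :
  measurable D -> <<s rects >> D.
Proof.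
move: D; apply: smallest_sub; first exact: smallest_sigma_algebra.
move=> D; rewrite -bigcup_seq => -[i _ [A mA <-]]; apply: sub_sigma_algebra.
exists (fun j => if j == i then A else setT) => [j|]; first by case: ifP.
rewrite setTI; apply/seteqP; split=> [t At j|t /(_ i)]; last by rewrite eqxx.
by have [->|] := eqVneq j i.
Qed.

Lemma tuple_measure_unique (m1 m2 : {measure set (n.-tuple T) -> \bar R}) :
  (m1 setT < +oo)%E ->
  (forall A, (forall i, measurable (A i)) -> m1 (rect A) = m2 (rect A)) ->
  forall D, measurable D -> m1 D = m2 D.
Proof.
move=> m1oo m12 D /measurable_tuple_rects sD.
have rT : rects setT by exists (fun=> setT) => //; apply/seteqP; split.
apply: (@g_sigma_algebra_measure_unique _ R _ rects _ (fun=> setT)) sD => //.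
- by move=> _ [A mA ->]; exact: measurable_rect.
- by rewrite bigcup_const//; exists 0%N.
- move=> _ _ [A mA ->] [B mB ->]; exists (fun i => A i `&` B i).
    by move=> i; exact: measurableI.
  apply/seteqP; split=> [t [At Bt] i|t ABt]; first by split; [exact: At|exact: Bt].
  by split=> i; have [] := ABt i.
- by move=> _ [A mA ->]; exact: m12.
Qed.

End tuple_rect.

Section independent_tuple.
Local Open Scope ereal_scope.
Context {R : realType} d d1 (Omega : measurableType d) (T : measurableType d1)
  (n : nat).
Variables (P : probability Omega R) (m : 'I_n -> probability T R).
Variables (Y : 'I_n -> Omega -> T) (y0 : T).
Hypothesis mY : forall i, measurable_fun setT (Y i).
Hypothesis indY : forall A : 'I_n -> set T, (forall i, measurable (A i)) ->
  P [set w | forall i, A i (Y i w)] = \prod_(i < n) m i (A i).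

Definition upd (k : 'I_n) (y : T) (t : 'I_n -> T) : n.-tuple T :=
  [tuple if i == k then y else t i | i < n].

Lemma measurable_upd k : measurable_fun setT
  (fun z : T * n.-tuple T => upd k z.1 (tnth z.2)).
Proof.
apply/measurable_fun_tnthP => i /=.
rewrite (_ : _ \o _ = fun z => if i == k then z.1 else tnth z.2 i).
  case: eqP => _; first exact: measurable_fst.
  exact: (measurableT_comp (measurable_tnth i) measurable_snd).
by apply/funext => z /=; rewrite tnth_mktuple.
Qed.

Lemma measurable_upd1 k (t : 'I_n -> T) : measurable_fun setT (fun y => upd k y t).
Proof.
apply/measurable_fun_tnthP => i /=.
rewrite (_ : _ \o _ = fun y => if i == k then y else t i).
  by case: eqP => _; [exact: measurable_id|exact: measurable_cst].
by apply/funext => y /=; rewrite tnth_mktuple.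
Qed.

Lemma measurable_mktuple : measurable_fun setT (fun w => [tuple Y i w | i < n]).
Proof.
apply/measurable_fun_tnthP => i /=.
by rewrite (_ : _ \o _ = Y i)//; apply/funext => w /=; rewrite tnth_mktuple.
Qed.

Lemma measurable_updY k : measurable_fun setT (fun w => upd k y0 (Y ^~ w)).
Proof.
apply/measurable_fun_tnthP => i /=.
rewrite (_ : _ \o _ = fun w => if i == k then y0 else Y i w).
  by case: eqP => _//.
by apply/funext => z /=; rewrite tnth_mktuple.
Qed.

Let mpre k A : measurable A -> measurable (Y k @^-1` A).
Proof. by move=> mA; rewrite -[X in measurable X]setTI; exact: mY. Qed.

(** Overwriting coordinate [k] by the dummy [y0] retains exactly the other variables without leaving
    the type of [n]-tuples. For fixed [A] both sides are finite measures in [D], so rectangles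
    suffice. *)
Lemma independent_upd k (A : set T) (D : set (n.-tuple T)) :
  measurable A -> measurable D ->
  P (Y k @^-1` A `&` (fun w => upd k y0 (Y ^~ w)) @^-1` D) =
  m k A * P ((fun w => upd k y0 (Y ^~ w)) @^-1` D).
Proof.
move=> mA mD; pose mU := measurable_updY k.
have mYA := mpre k mA.
have mAfin : m k A \is a fin_num by exact: fin_num_measure.
have mA0 : (0 <= fine (m k A))%R by rewrite fine_ge0.
transitivity (pushfwd (mrestr P mYA) mU D).
  by rewrite pushfwdE /mrestr setIC.
transitivity (mscale (NngNum mA0) (pushfwd P mU) D); last first.
  by rewrite /mscale/= fineK.
apply: tuple_measure_unique D mD => [|B mB].
  rewrite pushfwdE; apply: le_lt_trans (ltry 1).
  by rewrite -(probability_setT P); apply: le_measure; rewrite ?inE//; apply: measurableI => //;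
    rewrite -[X in measurable X]setTI; exact: mU.
set U := fun w => upd k y0 (Y ^~ w).
transitivity (m k A * P (U @^-1` rect B)); last by rewrite /= /mscale/= fineK.
transitivity (P (U @^-1` rect B `&` Y k @^-1` A)); first by [].
(* If the [k]-th side misses [y0], both events are empty; otherwise that side imposes nothing. *)
have [By0|By0] := pselect (B k y0); last first.
  rewrite [X in X `&` _](_ : _ = set0); last first.
    by apply/seteqP; split=> // w /(_ k); rewrite tnth_mktuple eqxx.
  rewrite [X in _ * _ X](_ : _ = set0); last first.
    by apply/seteqP; split=> // w /(_ k); rewrite tnth_mktuple eqxx.
  by rewrite set0I !measure0 mule0.
(* [B' A] describes the joint event, [B' setT] the event on the other coordinates alone. *)
pose B' C i := if i == k then C else B i.
have mB' C i : measurable C -> measurable (B' C i) by rewrite /B'; case: ifP.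
transitivity (P [set w | forall i, B' A i (Y i w)]).
  congr (P _); apply/seteqP; split=> [w [Bw Aw] i|w Bw].
    have := Bw i; rewrite tnth_mktuple /B'.
    by have [->|] := eqVneq i k.
  split=> [i|]; last by have := Bw k; rewrite /B' eqxx.
  by have := Bw i; rewrite tnth_mktuple /B'; have [->|] := eqVneq i k.
rewrite indY; last by move=> i; exact: mB'.
rewrite (bigD1 k)//= {1}/B' eqxx; congr (_ * _).
transitivity (P [set w | forall i, B' setT i (Y i w)]).
  rewrite indY; last by move=> i; exact: mB'.
  rewrite [RHS](bigD1 k)//= {2}/B' eqxx probability_setT mul1e.
  by apply: eq_bigr => i /negbTE ik; rewrite /B' ik.
congr (P _); apply/seteqP; split=> w Bw i; have := Bw i;
  by rewrite tnth_mktuple /B'; have [->|] := eqVneq i k.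
Qed.

(** Tonelli for coordinate [k] against all the others: a fresh overwrite erases the dummy [y0], so
    the integrand is a function of [Y k] and of the overwritten tuple. *)
Lemma ge0_integral_upd k (F : n.-tuple T -> \bar R) :
  measurable_fun setT F -> (forall t, 0 <= F t) ->
  \int[P]_w F [tuple Y i w | i < n] = \int[P]_w \int[m k]_y F (upd k y (Y ^~ w)).
Proof.
move=> mF F0.
have updK w y : upd k y (tnth (upd k y0 (Y ^~ w))) = upd k y (Y ^~ w).
  by apply: eq_from_tnth => i; rewrite !tnth_mktuple; case: (i == k).
transitivity (\int[P]_w (fun z : T * n.-tuple T => F (upd k z.1 (tnth z.2)))
    (Y k w, upd k y0 (Y ^~ w))).
  apply: eq_integral => w _ /=; rewrite updK; congr (F _).
  by apply: eq_from_tnth => i; rewrite !tnth_mktuple; have [->|] := eqVneq i k.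
etransitivity.
  apply: (@ge0_integral_indep _ _ _ _ _ _ _ P (m k) (Y k)
    (fun w => upd k y0 (Y ^~ w)) _ _ _
    (fun z : T * n.-tuple T => F (upd k z.1 (tnth z.2)))) => //.
  - exact: measurable_updY.
  - by move=> A D mA mD; exact: independent_upd.
  - exact: measurableT_comp mF (measurable_upd k).
by apply: eq_integral => w _; apply: eq_integral => y _ /=; rewrite updK.
Qed.

Lemma Rintegral_upd k (F : n.-tuple T -> R) (M : R) :
  measurable_fun setT F -> (forall t, `|F t| <= M)%R ->
  (\int[P]_w F [tuple Y i w | i < n] =
   \int[P]_w \int[m k]_y F (upd k y (Y ^~ w)))%R.
Proof.
move=> mF FM; pose G w := (\int[m k]_y F (upd k y (Y ^~ w)))%R.
have updK w y : upd k y (tnth (upd k y0 (Y ^~ w))) = upd k y (Y ^~ w).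
  by apply: eq_from_tnth => i; rewrite !tnth_mktuple; case: (i == k).
have FM0 t : (0 <= F t + M)%R by have := FM t; rewrite ler_norml => /andP[? _]; lra.
have mFM : measurable_fun setT (fun t => (F t + M)%:E).
  by apply/measurable_EFinP; exact: measurable_funD.
have mFu w : measurable_fun setT (fun y => F (upd k y (Y ^~ w))).
  exact: measurableT_comp mF (measurable_upd1 k _).
have GE w : \int[m k]_y (F (upd k y (Y ^~ w)) + M)%:E = (G w + M)%:E.
  exact: bounded_integralDr (mFu w) _.
(* Measurability is read off the Tonelli integral of the nonnegative function [F + M], from which
   [G] differs by a constant. *)
have mG : measurable_fun setT G.
  rewrite (_ : G = (fun w => fine (\int[m k]_y (F (upd k y (Y ^~ w)) + M)%:E) - M)%R).
    apply: measurable_funB => //; apply: measurableT_comp => //.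
    have h := @measurable_fun_fubini_tonelli_G _ _ _ _ _ (m k)
      (fun z : T * n.-tuple T => (F (upd k z.1 (tnth z.2)) + M)%:E)
      (measurableT_comp mFM (measurable_upd k)) (fun z => FM0 _).
    rewrite (_ : (fun w => _) = fubini_G (m k)
        (fun z : T * n.-tuple T => (F (upd k z.1 (tnth z.2)) + M)%:E) \o
        (fun w => upd k y0 (Y ^~ w))).
      exact: measurableT_comp h (measurable_updY k).
    apply/funext => w /=; rewrite /fubini_G.
    by apply: eq_integral => y _ /=; rewrite updK.
  by apply/funext => w; rewrite GE/= addrK.
have := ge0_integral_upd k mFM (fun t => FM0 t).
under [X in _ = X -> _]eq_integral do rewrite GE.
have mFt : measurable_fun setT (fun w => F [tuple Y i w | i < n]).
  exact: measurableT_comp mF measurable_mktuple.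
have GM w : (`|G w| <= M)%R by exact: le_norm_bounded_Rintegral.
rewrite (@bounded_integralDr _ _ _ P _ M M mFt)//.
by rewrite (@bounded_integralDr _ _ _ P _ M M mG)// => -[/addIr].
Qed.

End independent_tuple.

(** * Uniqueness of invariant measures *)

Section haar.
Context {R : realType} {p : nat}.
Local Notation mat := 'M[R]_p.
Implicit Types (m rho h : {measure set (Bor mat) -> \bar R}) (K : set mat).

Definition left_inv K m := forall Q, K Q -> forall C : set (Bor mat),
  measurable C -> m ((fun M : mat => Q *m M) @^-1` C) = m C.

Definition right_inv K m := forall Q, K Q -> forall C : set (Bor mat),
  measurable C -> m ((fun M : mat => M *m Q) @^-1` C) = m C.

Definition subgroup_O K := [/\ measurable (K : set (Bor mat)),
  (forall Q, K Q -> K Q^T) & (forall Q, K Q -> Q^T *m Q = 1%:M)].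

Lemma measurable_mulmxl (Q : mat) :
  measurable_fun setT (fun M : Bor mat => Q *m (M : mat) : Bor mat).
Proof. exact: (@measurable_fun_mulmx _ _ _ _ _ _ (cst (Q : Bor mat)) id). Qed.

Lemma measurable_mulmxr (Q : mat) :
  measurable_fun setT (fun M : Bor mat => (M : mat) *m Q : Bor mat).
Proof. exact: (@measurable_fun_mulmx _ _ _ _ _ _ id (cst (Q : Bor mat))). Qed.

Lemma measurable_trmx :
  measurable_fun setT (fun M : Bor mat => (M : mat)^T : Bor mat).
Proof. exact: (@measurable_fun_trmx _ _ _ _ _ id). Qed.

Lemma measurable_preimage_mx (f : Bor mat -> Bor mat) (C : set (Bor mat)) :
  measurable_fun setT f -> measurable C -> measurable (f @^-1` C).
Proof. by move=> mf mC; rewrite -[X in measurable X]setTI; exact: mf. Qed.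

Let finite_sigma m : (m setT < +oo)%E -> sigma_finite setT m.
Proof.
move=> moo; apply: fin_num_fun_sigma_finite; first by rewrite measure0.
move=> A mA; rewrite ge0_fin_numE//; apply: le_lt_trans moo.
by apply: le_measure; rewrite ?inE.
Qed.

(* Integrate the indicator of [g Q \in C] against [rho] in [g] and [m] in [Q],
   in both orders. *)
Lemma left_right_inv_unique K m rho : measurable (K : set (Bor mat)) ->
  (m setT < +oo)%E -> m (~` K) = 0%E -> left_inv K m ->
  rho setT = 1%E -> rho (~` K) = 0%E -> right_inv K rho ->
  forall C, measurable C -> m C = (m setT * rho C)%E.
Proof.
move=> mK moo mK0 lm rT rK0 rr C mC.
pose m' := sigma_finite_pack (finite_sigma moo).
have roo : (rho setT < +oo)%E by rewrite rT ltry.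
pose rho' := sigma_finite_pack (finite_sigma roo).
pose F (z : Bor mat * Bor mat) : \bar R :=
  (\1_C ((z.1 : mat) *m (z.2 : mat) : Bor mat))%:E.
have mF : measurable_fun setT F.
  have mprod : measurable_fun setT
      (fun z : Bor mat * Bor mat => (z.1 : mat) *m (z.2 : mat) : Bor mat).
    by apply: measurable_fun_mulmx; [exact: measurable_fst|exact: measurable_snd].
  apply/measurable_EFinP. exact: (measurableT_comp (measurable_indic mC) mprod).
have F0 z : (0 <= F z)%E by rewrite lee_fin.
have := @fubini_tonelli _ _ _ _ _ rho' m' F mF F0.
have L g : (\int[m']_Q F (g, Q) = m ((fun M : mat => (g : mat) *m M) @^-1` C))%E.
  rewrite -[X in _ = m X]setIT -integral_indic//.
  by apply: measurable_preimage_mx mC; exact: measurable_mulmxl.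
have Rr Q : (\int[rho']_g F (g, Q) = rho ((fun M : mat => M *m (Q : mat)) @^-1` C))%E.
  rewrite -[X in _ = rho X]setIT -integral_indic//.
  by apply: measurable_preimage_mx mC; exact: measurable_mulmxr.
have mL : measurable_fun setT (fun g => \int[m']_Q F (g, Q))%E.
  exact: measurable_fun_fubini_tonelli_F.
have mR : measurable_fun setT (fun Q => \int[rho']_g F (g, Q))%E.
  exact: measurable_fun_fubini_tonelli_G.
have aeK (mm : {measure set (Bor mat) -> \bar R}) (f g : Bor mat -> \bar R) : mm (~` K) = 0%E ->
    (forall Q, K Q -> f Q = g Q) -> ae_eq mm setT f g.
  move=> K0 fg; exists (~` K); split=> //; first exact: measurableC.
  by move=> Q /= Qfg KQ; apply: Qfg => _; exact: fg.
(* Almost every [g] lies in [K], where left invariance makes the inner integral the constant [m C];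
   in the other order it is [rho C]. *)
rewrite (ae_eq_integral (cst (m C))) //; last first.
  by apply: aeK => // Q KQ; rewrite L; exact: lm.
rewrite [X in _ = X](ae_eq_integral (cst (rho C))) //; last first.
  by apply: aeK => // Q KQ; rewrite Rr; exact: rr.
by rewrite !integral_cst// [X in (_ * X)%E = _]rT mule1 muleC.
Qed.

(** On orthogonal matrices transposition is inversion, which exchanges left and right
    translations. *)
Lemma right_inv_trmx K m : subgroup_O K -> left_inv K m ->
  right_inv K (pushfwd m measurable_trmx).
Proof.
move=> [_ KT _] lm Q /KT KQ C mC.
have mC' := measurable_preimage_mx measurable_trmx mC.
apply: etrans (lm _ KQ _ mC').
by congr (m _); apply/seteqP; split=> M /=; rewrite trmx_mul trmxK.
Qed.

Lemma left_inv_trmx K m : subgroup_O K -> right_inv K m ->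
  left_inv K (pushfwd m measurable_trmx).
Proof.
move=> [_ KT _] lm Q /KT KQ C mC.
have mC' := measurable_preimage_mx measurable_trmx mC.
apply: etrans (lm _ KQ _ mC').
by congr (m _); apply/seteqP; split=> M /=; rewrite trmx_mul trmxK.
Qed.

Lemma trmx_null K m : subgroup_O K -> m (~` K) = 0%E ->
  pushfwd m measurable_trmx (~` K) = 0%E.
Proof.
move=> [_ KT _] <-; congr (m _); apply/seteqP; split=> M /= KM; first by move=> /KT.
by move=> /KT; rewrite trmxK.
Qed.

(** Both measures are compared with the transpose of [h], which is right invariant; for [h] itself
    the comparison says that [h] equals its transpose. *)
Lemma haar_unique K m h : subgroup_O K ->
  (m setT < +oo)%E -> m (~` K) = 0%E -> left_inv K m ->
  h setT = 1%E -> h (~` K) = 0%E -> left_inv K h ->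
  forall C, measurable C -> m C = (m setT * h C)%E.
Proof.
move=> sK moo mK0 lm hT hK0 lh C mC; have [mK _ _] := sK.
pose rho := pushfwd h measurable_trmx.
have hoo : (h setT < +oo)%E by rewrite hT ltry.
have rP := right_inv_trmx sK lh; have r0 := trmx_null sK hK0.
rewrite (left_right_inv_unique mK moo mK0 lm _ r0 rP)//.
by rewrite (left_right_inv_unique mK hoo hK0 lh _ r0 rP)// hT mul1e.
Qed.

(** Left multiplication by [Q0^T] carries the coset [Q0 K] onto [K]. There the transposed copy of
    [m2] is left invariant, and both right invariant laws are compared with it. *)
Lemma coset_right_inv_unique K (Q0 : mat) m1 m2 : subgroup_O K ->
  Q0^T *m Q0 = 1%:M ->
  m1 setT = 1%E -> m2 setT = 1%E ->
  m1 [set Q | ~ K (Q0^T *m Q)] = 0%E -> m2 [set Q | ~ K (Q0^T *m Q)] = 0%E ->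
  right_inv K m1 -> right_inv K m2 ->
  forall C, measurable C -> m1 C = m2 C.
Proof.
move=> sK Q0Q m1T m2T m10 m20 r1 r2 C mC; have [mK KT KO] := sK.
have mQ0 := measurable_mulmxl Q0^T.
have rl m : right_inv K m -> right_inv K (pushfwd m mQ0).
  move=> rm Q KQ D mD; apply: etrans (rm _ KQ _ (measurable_preimage_mx mQ0 mD)).
  by congr (m _); apply/seteqP; split=> M /=; rewrite mulmxA.
have m1oo : (pushfwd (pushfwd m2 mQ0) measurable_trmx setT < +oo)%E.
  by rewrite [X in (X < _)%E](_ : _ = 1%E) ?ltry.
have lm := left_inv_trmx sK (rl _ r2).
have m0 := @trmx_null K (pushfwd m2 mQ0) sK m20.
have e1 D : measurable D -> _ := left_right_inv_unique mK m1oo m0 lm (m1T : pushfwd m1 mQ0 setT = 1%E) m10 (rl _ r1) (C := D).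
have e2 D : measurable D -> _ := left_right_inv_unique mK m1oo m0 lm (m2T : pushfwd m2 mQ0 setT = 1%E) m20 (rl _ r2) (C := D).
have mTE : pushfwd (pushfwd m2 mQ0) measurable_trmx setT = 1%E by [].
have Q0' : Q0 *m Q0^T = 1%:M by exact: mulmx1C.
have CE m : m C = pushfwd m mQ0 ((fun M : mat => Q0 *m M) @^-1` C).
  by congr (m _); apply/seteqP; split=> M /=; rewrite mulmxA Q0' mul1mx.
rewrite CE [RHS]CE.
have mD := measurable_preimage_mx (measurable_mulmxl Q0) mC.
have := e1 _ mD; rewrite (e2 _ mD) mTE !mul1e => ->.
by [].
Qed.

End haar.

Lemma lipschitz_continuous {R : realType} (V W : normedModType R)
    (f : V -> W) (C : R) :
  (forall x y, `|f x - f y| <= C * `|x - y|) -> continuous f.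
Proof.
move=> fC x; apply/cvgrPdist_le => e e0; near=> y.
apply: le_trans (fC _ _) _; apply: (@le_trans _ _ ((`|C| + 1) * `|x - y|)).
  by rewrite ler_wpM2r// (le_trans (ler_norm _))// lerDl.
rewrite -ler_pdivlMl ?ltr_wpDl//.
near: y; apply: cvgr_dist_le; first exact: cvg_id.
by rewrite mulr_gt0// invr_gt0 ltr_wpDl.
Unshelve. all: by end_near. Qed.

(** * The support function of an orbit *)

Section dotv.
Context {R : realType} {p : nat}.
Local Notation vec := 'cV[R]_p.
Local Notation mat := 'M[R]_p.
Implicit Types (x y u v h : vec) (Q : mat).

Lemma dotvE u v : dotv u v = \sum_k u k 0 * v k 0.
Proof. by rewrite /dotv mxE; apply: eq_bigr => k _; rewrite mxE. Qed.

Lemma dotvC u v : dotv u v = dotv v u.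
Proof. by rewrite !dotvE; apply: eq_bigr => k _; rewrite mulrC. Qed.

Lemma dotvDl u v w : dotv (u + v) w = dotv u w + dotv v w.
Proof. by rewrite /dotv raddfD mulmxDl mxE. Qed.

Lemma dotvBl u v w : dotv (u - v) w = dotv u w - dotv v w.
Proof. by rewrite /dotv raddfB mulmxBl !mxE. Qed.

Lemma dotvZl (c : R) u w : dotv (c *: u) w = c * dotv u w.
Proof. by rewrite /dotv linearZ -scalemxAl mxE. Qed.

Lemma dotvBr u v w : dotv w (u - v) = dotv w u - dotv w v.
Proof. by rewrite /dotv mulmxBr !mxE. Qed.

Lemma dotvZr (c : R) u w : dotv w (c *: u) = c * dotv w u.
Proof. by rewrite /dotv -scalemxAr mxE. Qed.

Lemma dotv_sumr (I : Type) (r : seq I) (F : I -> vec) w :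
  dotv w (\sum_(i <- r) F i) = \sum_(i <- r) dotv w (F i).
Proof. by rewrite /dotv mulmx_sumr summxE. Qed.

Lemma dotv_deltal k v : dotv (delta_mx k 0) v = v k 0.
Proof.
rewrite dotvE (bigD1 k)//= mxE !eqxx mul1r big1 ?addr0// => i /negbTE ik.
by rewrite mxE ik mul0r.
Qed.

Lemma dotv_mulmx Q u v : dotv (Q *m u) v = dotv u (Q^T *m v).
Proof. by rewrite /dotv trmx_mul mulmxA. Qed.

Lemma sqnormE v : sqnorm v = dotv v v.
Proof. by rewrite dotvE; apply: eq_bigr => k _; rewrite expr2. Qed.

Lemma dotv_mulmx_le u Q v :
  `|dotv u (Q *m v)| <= `|Q| * \sum_k \sum_l `|u k 0| * `|v l 0|.
Proof.
rewrite dotvE mulr_sumr (le_trans (ler_norm_sum _ _ _))//.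
apply: ler_sum => k _; rewrite mxE mulr_sumr mulr_sumr.
rewrite (le_trans (ler_norm_sum _ _ _))//; apply: ler_sum => l _.
rewrite !normrM mulrCA ler_wpM2r ?mulr_ge0//.
exact: ler_coord_norm.
Qed.

Lemma dotv_mulmx_continuous u v : continuous (fun Q : mat => dotv u (Q *m v)).
Proof.
apply: (@lipschitz_continuous _ _ _ _ (\sum_k \sum_l `|u k 0| * `|v l 0|)).
move=> Q Q'; rewrite -dotvBr -mulmxBl mulrC; exact: dotv_mulmx_le.
Qed.

End dotv.

Section support_function.
Context {R : realType} {p : nat}.
Local Notation vec := 'cV[R]_p.
Local Notation mat := 'M[R]_p.
Variable G : set mat.
Hypothesis GO : compact_subgroup_O G.
Implicit Types (A : set mat) (x y h : vec) (Q g : mat).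

Let G1 : G 1%:M. Proof. by have [] := GO. Qed.
Let GM Q1 Q2 : G Q1 -> G Q2 -> G (Q1 *m Q2). Proof. by have [_ _ + _ _] := GO; exact. Qed.
Let GTM Q : G Q -> Q^T *m Q = 1%:M. Proof. by have [_ _ _ _] := GO; exact. Qed.
Let GMT Q : G Q -> Q *m Q^T = 1%:M. Proof. by move=> /GTM /mulmx1C. Qed.

Lemma group_trmx Q : G Q -> G Q^T.
Proof.
move=> GQ; have [_ _ _ + _] := GO => /(_ _ GQ).
suff -> : invmx Q = Q^T by [].
have Qu : Q \in unitmx by have [] := mulmx1_unit (GMT GQ).
by rewrite -[RHS]mul1mx -(mulVmx Qu) -mulmxA GMT// mulmx1.
Qed.

Lemma group_closed : closed G.
Proof. by apply: compact_closed; [exact: norm_hausdorff|have [] := GO]. Qed.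

(** The norm is the largest absolute entry, and the columns of an orthogonal matrix are unit
    vectors. *)
Lemma group_norm Q : G Q -> `|Q| <= 1.
Proof.
move=> GQ; rewrite [leLHS]/Num.norm/= mx_normrE; apply/bigmax_leP; split=> // -[i j] _ /=.
have /matrixP/(_ j j) := GTM GQ; rewrite !mxE eqxx (bigD1 i)//= mxE => Qij.
rewrite -(@ler_pXn2r _ 2)// ?nnegrE// real_normK ?num_real// expr1n -[leRHS]Qij expr2 lerDl.
by apply: sumr_ge0 => k _; rewrite mxE -expr2 sqr_ge0.
Qed.

(** Support function of the part of the orbit of [h] reached by [A]; [A] is left free because kinks
    are detected by comparing suprema over subsets of [G]. *)
Definition supp A h x := sup [set dotv x (Q *m h) | Q in A].

Let C h := \sum_(k < p) \sum_(l < p) `|h l 0|.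

Lemma group_dotv_le Q h x : G Q -> `|dotv x (Q *m h)| <= C h * `|x|.
Proof.
move=> GQ; apply: le_trans (dotv_mulmx_le _ _ _) _.
apply: le_trans (ler_piMl _ (group_norm GQ)) _.
  by apply: sumr_ge0 => k _; apply: sumr_ge0 => l _; rewrite mulr_ge0.
rewrite mulr_suml; apply: ler_sum => k _; rewrite mulr_suml; apply: ler_sum => l _.
by rewrite mulrC ler_wpM2l// ler_coord_norm.
Qed.

Lemma le_supp A h x Q : A `<=` G -> A Q -> dotv x (Q *m h) <= supp A h x.
Proof.
move=> AG AQ; apply: ub_le_sup; last by exists Q.
exists (C h * `|x|) => _ [Q' AQ' <-].
exact: le_trans (ler_norm _) (group_dotv_le _ _ (AG _ AQ')).
Qed.

Lemma supp_le A h x c : A !=set0 -> (forall Q, A Q -> dotv x (Q *m h) <= c) ->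
  supp A h x <= c.
Proof.
move=> [Q AQ] Ac; apply: ge_sup; first by exists (dotv x (Q *m h)), Q.
by move=> _ [Q' AQ' <-]; exact: Ac.
Qed.

Lemma supp_lipschitz A h x y : A `<=` G -> A !=set0 ->
  `|supp A h x - supp A h y| <= C h * `|x - y|.
Proof.
move=> AG A0.
suff H x' y' : supp A h x' <= supp A h y' + C h * `|x' - y'|.
  have := H x y; have := H y x; rewrite (distrC y x) ler_norml.
  by move=> h1 h2; apply/andP; split; lra.
apply: supp_le => // Q AQ; rewrite -[x'](subrK y') dotvDl addrC lerD ?le_supp//.
rewrite subrK; exact: le_trans (ler_norm _) (group_dotv_le _ _ (AG _ AQ)).
Qed.

Lemma measurable_supp A h : A `<=` G -> A !=set0 ->
  measurable_fun setT (supp A h : Bor vec -> R).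
Proof.
move=> AG A0; apply: continuous_measurable_mx.
by apply: lipschitz_continuous => x y; exact: supp_lipschitz.
Qed.

Lemma supp_attained h x : exists2 Q, G Q & dotv x (Q *m h) = supp G h x.
Proof.
have [] := @compact_EVT_max _ _ (fun Q : mat => dotv x (Q *m h)) G.
- by exists 1%:M.
- by have [] := GO.
- by apply: continuous_subspaceT; exact: dotv_mulmx_continuous.
move=> Q; rewrite inE => GQ Qmax; exists Q => //.
apply/eqP; rewrite eq_le le_supp//=; apply: supp_le; first by exists Q.
by move=> Q' GQ'; apply: Qmax; rewrite inE.
Qed.

Lemma supp_group g h x : G g -> supp G h (g *m x) = supp G h x.
Proof.
suff H g' x' : G g' -> supp G h (g' *m x') <= supp G h x'.
  move=> Gg; apply/eqP; rewrite eq_le H//=.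
  by rewrite -{1}[x]mul1mx -(GTM Gg) -mulmxA H//; exact: group_trmx.
move=> Gg; apply: supp_le; first by exists 1%:M.
by move=> Q GQ; rewrite dotv_mulmx mulmxA; apply: le_supp => //; apply: GM => //; exact: group_trmx.
Qed.

Lemma sqnorm_group Q x h : G Q ->
  sqnorm (Q^T *m x - h) = sqnorm x + sqnorm h - 2 * dotv x (Q *m h).
Proof.
move=> GQ; rewrite !sqnormE dotvBl !dotvBr !dotv_mulmx !trmxK mulmxA GMT// mul1mx.
by rewrite (dotvC h) dotv_mulmx trmxK; ring.
Qed.

Lemma MinSetE x h : MinSet G x h = [set Q | G Q /\ dotv x (Q *m h) = supp G h x].
Proof.
apply/seteqP; split=> Q [GQ Qmin]; split=> //.
  apply/eqP; rewrite eq_le le_supp//=; apply: supp_le; first by exists Q.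
  move=> Q' GQ'; have := Qmin _ GQ'; rewrite !sqnorm_group//; lra.
move=> Q' GQ'; rewrite !sqnorm_group// Qmin.
by have := @le_supp G h x Q' (@subset_refl _ _) GQ'; lra.
Qed.

Lemma MinSet_group x h g : G g ->
  MinSet G (g *m x) h = (fun Q => g^T *m Q) @^-1` MinSet G x h.
Proof.
move=> Gg; rewrite !MinSetE; apply/seteqP; split=> Q /= [GQ].
  rewrite supp_group// dotv_mulmx mulmxA => ->; split=> //.
  by apply: GM => //; exact: group_trmx.
rewrite supp_group// dotv_mulmx mulmxA => ->; split=> //.
by rewrite -[Q]mul1mx -(GMT Gg) -mulmxA; apply: GM.
Qed.

Lemma MinSet_closed x h : closed (MinSet G x h).
Proof.
rewrite MinSetE (_ : mkset _ = G `&` (fun Q => dotv x (Q *m h)) @^-1` [set supp G h x]); last by apply/seteqP; split.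
apply: closedI; first exact: group_closed.
apply: closed_comp; first by move=> Q _; exact: dotv_mulmx_continuous.
exact: closed_eq.
Qed.

(** By orthogonality only the cross terms depend on the rotations, and each rotation is optimized
    separately; the squared norms add up to [c] for every permutation. *)
Lemma opt_permE n (x h : 'I_n -> vec) (s : {perm 'I_n}) :
  opt_perm G x h s <-> forall s' : {perm 'I_n},
    \sum_i supp G (h i) (x (s' i)) <= \sum_i supp G (h i) (x (s i)).
Proof.
pose c := \sum_i sqnorm (x i) + \sum_i sqnorm (h i).
have costE (s' : {perm 'I_n}) (Q : 'I_n -> mat) : (forall i, G (Q i)) ->
    assign_cost x h s' Q = c - 2 * \sum_i dotv (x (s' i)) (Q i *m h i).
  move=> GQ; rewrite /assign_cost (eq_bigr _ (fun i _ => sqnorm_group _ _ (GQ i))).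
  rewrite big_split/= big_split/= sumrN -mulr_sumr; congr (_ + _ - _).
  by rewrite /c [in RHS](reindex_inj (@perm_inj _ s')).
have attained (s' : {perm 'I_n}) : exists2 Q : 'I_n -> mat, (forall i, G (Q i)) &
    \sum_i dotv (x (s' i)) (Q i *m h i) = \sum_i supp G (h i) (x (s' i)).
  have /choice[Q QP] i : exists Q, G Q /\
      dotv (x (s' i)) (Q *m h i) = supp G (h i) (x (s' i)).
    by have [Q] := supp_attained (h i) (x (s' i)); exists Q.
  by exists Q => [i|]; [have [] := QP i|apply: eq_bigr => i _; have [] := QP i].
split=> [[Q [GQ Qmin]] s'|smax].
  have [Q' GQ' <-] := attained s'; have := Qmin s' Q' GQ'; rewrite !costE// => le1.
  apply: (@le_trans _ _ (\sum_i dotv (x (s i)) (Q i *m h i))); first lra.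
  by apply: ler_sum => i _; exact: le_supp.
have [Q GQ QE] := attained s; exists Q; split=> // s' Q' GQ'; rewrite !costE//.
have := smax s'; rewrite -QE.
have : \sum_i dotv (x (s' i)) (Q' i *m h i) <= \sum_i supp G (h i) (x (s' i)).
  by apply: ler_sum => i _; exact: le_supp.
lra.
Qed.

(** Equivalent to differentiability at [x] of the support function of the orbit of [h]. *)
Definition unique_image h x :=
  forall Q Q', MinSet G x h Q -> MinSet G x h Q' -> Q *m h = Q' *m h.

(* Points at which maximizers [Q] exist with the k-th coordinate of [Q h] both
   at most [r] and at least [s]; if [r < s], they violate [unique_image]. *)
Definition kink h (k : 'I_p) (r s : R) : set (Bor vec) :=
  if `[< (exists2 Q, G Q & (Q *m h) k 0 <= r) /\
         (exists2 Q, G Q & s <= (Q *m h) k 0) >] then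
    [set x | supp [set Q | G Q /\ (Q *m h) k 0 <= r] h x = supp G h x /\
             supp [set Q | G Q /\ s <= (Q *m h) k 0] h x = supp G h x]
  else set0.

Lemma measurable_kink h k r s : measurable (kink h k r s).
Proof.
(* The guard in [kink] keeps both restricted families nonempty, so that their suprema are genuine
   and Lipschitz. *)
rewrite /kink; case: asboolP => // -[[Q1 GQ1 Q1r] [Q2 GQ2 Q2s]].
have mG : measurable_fun setT (supp G h : Bor vec -> R).
  by apply: measurable_supp => //; exists 1%:M.
have m1 : measurable_fun setT
    (supp [set Q | G Q /\ (Q *m h) k 0 <= r] h : Bor vec -> R).
  by apply: measurable_supp => [Q []//|]; exists Q1.
have m2 : measurable_fun setT
    (supp [set Q | G Q /\ s <= (Q *m h) k 0] h : Bor vec -> R).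
  by apply: measurable_supp => [Q []//|]; exists Q2.
have mI := measurableI _ _ (measurable_fun_eqr m1 mG measurableT (Logic.I : measurable [set true]))
  (measurable_fun_eqr m2 mG measurableT (Logic.I : measurable [set true])).
move: mI; rewrite !setTI; set E1 := (X in measurable X -> _).
set E2 := (X in _ -> measurable X).
suff -> : E1 = E2 by [].
by apply/seteqP; split=> x /= [e1 e2]; split; exact/eqP.
Qed.

(* The support function is convex along the k-th axis; a point of the kink set
   is one where its one-sided slopes straddle [r, s]. *)
Lemma kink_transversal h k r s x (t : R) : r < s -> kink h k r s x ->
  kink h k r s (x + t *: delta_mx k 0) -> t = 0.
Proof.
suff pos y u : r < s -> kink h k r s y -> kink h k r s (y + u *: delta_mx k 0) ->
    u <= 0.
  move=> rs kx kxt; apply/eqP; rewrite eq_le (pos x t rs kx kxt)/= -oppr_le0.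
  by apply: (pos _ (- t) rs kxt); rewrite scaleNr addrK.
move=> rs; rewrite /kink; case: asboolP => // -[[Q1 GQ1 Q1r] [Q2 GQ2 Q2s]] [_ e2] [e1 _].
rewrite leNgt; apply/negP => u0.
have dE Q z v : dotv (z + v *: delta_mx k 0) (Q *m h) =
    dotv z (Q *m h) + v * (Q *m h) k 0.
  by rewrite dotvDl dotvZl dotv_deltal.
(* Moving from [y] by [u > 0] raises the support function by at least [u * s] and, judged from the
   far end, by at most [u * r]. *)
have h1 : supp G h y + u * s <= supp G h (y + u *: delta_mx k 0).
  rewrite -lerBrDr -e2; apply: supp_le; first by exists Q2.
  move=> Q [GQ Qs]; rewrite lerBrDr; apply: le_trans (le_supp _ _ _ GQ) => //.
  by rewrite dE lerD2l ler_pM2l.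
have h2 : supp G h (y + u *: delta_mx k 0) <= supp G h y + u * r.
  rewrite -e1; apply: supp_le; first by exists Q1.
  move=> Q [GQ Qr]; rewrite dE lerD ?ler_pM2l//; exact: le_supp.
have := le_trans h1 h2; rewrite lerD2l ler_pM2l// => sr.
by have := lt_le_trans rs sr; rewrite ltxx.
Qed.

(** Two distinct images differ in some coordinate; rational thresholds between the two values keep
    the family of kink sets countable. *)
Lemma not_unique_image_kink h x : ~ unique_image h x ->
  exists k (r s : rat), (r < s) /\ kink h k (ratr r) (ratr s) x.
Proof.
move=> nx.
have {nx} [Q [Q' [k [MQ MQ' lt]]]] : exists Q Q' k, [/\ MinSet G x h Q,
    MinSet G x h Q' & (Q *m h) k 0 < (Q' *m h) k 0].
  apply: contrapT => nex; apply: nx => Q Q' MQ MQ'.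
  apply/colP => k; apply/eqP; rewrite eq_le !leNgt.
  by apply/andP; split; apply/negP => lt; apply: nex; [exists Q', Q, k|exists Q, Q', k].
have [r] := rat_in_itvoo lt; rewrite in_itv/= => /andP[Qr rQ'].
have [s] := rat_in_itvoo rQ'; rewrite in_itv/= => /andP[rs sQ'].
exists k, r, s; split; first by rewrite -(ltr_rat R).
move: MQ MQ'; rewrite MinSetE => -[GQ QE] [GQ' Q'E].
rewrite /kink asboolT; last by split; [exists Q => //; exact: ltW|exists Q' => //; exact: ltW].
have sub (A : set mat) : A `<=` G -> A !=set0 -> supp A h x <= supp G h x.
  by move=> AG A0; apply: supp_le => // M AM; apply: le_supp => //; exact: AG.
split; apply/eqP; rewrite eq_le; apply/andP; split.
- by apply: sub => [M []//|]; exists Q; split=> //; exact: ltW.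
- by rewrite -QE; apply: le_supp => [M []//|]; split=> //; exact: ltW.
- by apply: sub => [M []//|]; exists Q'; split=> //; exact: ltW.
- by rewrite -Q'E; apply: le_supp => [M []//|]; split=> //; exact: ltW.
Qed.

Lemma ae_unique_image (mu : probability (Bor vec) R) h :
  has_lebesgue_density mu -> {ae mu, forall x, unique_image h x}.
Proof.
move=> dens; have [lam Llam] := @lebesgue_exists R p.
have [f [mf f0 muE]] := dens lam Llam.
have mu0 k (r s : rat) : r < s -> mu (kink h k (ratr r) (ratr s)) = 0%E.
  move=> rs; have mK := measurable_kink h k (ratr r) (ratr s).
  rewrite muE//; apply: null_set_integral => //.
    exact/measurable_EFinP/measurable_funTS.
  apply: (lebesgue_transversal_null Llam mK (v := delta_mx k 0)) => x t.
  by apply: kink_transversal; rewrite ltr_rat.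
pose N (q : 'I_p * rat * rat) : set (Bor vec) :=
  if q.1.2 < q.2 then kink h q.1.1 (ratr q.1.2) (ratr q.2) else set0.
have mN q : measurable (N q) by rewrite /N; case: ifP => // _; exact: measurable_kink.
have N0 q : mu (N q) = 0%E by rewrite /N; case: ifPn => [rs|_]; [exact: mu0|exact: measure0].
apply: (@negligibleS _ _ _ mu (\bigcup_j oapp N set0 (unpickle j))).
  move=> x /= /not_unique_image_kink[k [r [s [rs kx]]]].
  by exists (pickle (k, r, s)) => //; rewrite pickleK/= /N/= rs.
apply: negligible_bigcup => j; case: (unpickle j) => [q|]/=; last exact: negligible_set0.
by exists (N q); split.
Qed.

End support_function.

(** * The law of the optimal rotations *)

Section tie_breaking.
Context {R : realType} {p : nat}.
Local Notation vec := 'cV[R]_p.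
Local Notation mat := 'M[R]_p.
Variables (G : set mat) (haar : probability (Bor mat) R).
Hypotheses (GO : compact_subgroup_O G) (Ghaar : is_haar G haar).
Variables (mu : probability (Bor vec) R).
Hypothesis mu_inv : forall Q, G Q -> forall A : set (Bor vec), measurable A ->
  mu ((fun x : Bor vec => (Q *m x : Bor vec)) @^-1` A) = mu A.
Variables (kappa : vec -> vec -> probability (Bor mat) R).
Hypothesis kappaP : forall x h, unif_cond G haar (MinSet G x h) (kappa x h).
Hypothesis mkappa : forall h (C : set (Bor mat)), measurable C ->
  measurable_fun setT (fun x : Bor vec => kappa x h C).
Implicit Types (x h : vec) (g Q : mat) (C : set (Bor mat)).

Let GT Q : G Q -> G Q^T. Proof. exact: group_trmx. Qed.
Let GM Q1 Q2 : G Q1 -> G Q2 -> G (Q1 *m Q2). Proof. by have [_ _ + _ _] := GO; exact. Qed.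
Let GTM Q : G Q -> Q^T *m Q = 1%:M. Proof. by have [_ _ _ _] := GO; exact. Qed.
Let GMT Q : G Q -> Q *m Q^T = 1%:M. Proof. by move=> /GTM /mulmx1C. Qed.

Let mMin x h : measurable (MinSet G x h : set (Bor mat)).
Proof. by apply: closed_measurable_mx; exact: MinSet_closed. Qed.

Lemma measurable_group : measurable (G : set (Bor mat)).
Proof. by apply: closed_measurable_mx; exact: group_closed. Qed.

Lemma group_subgroup_O : subgroup_O G.
Proof. by split; [exact: measurable_group|exact: GT|exact: GTM]. Qed.

Let null_setC (m : probability (Bor mat) R) (A : set (Bor mat)) :
  measurable A -> m A = 1%E -> m (~` A) = 0%E.
Proof. by move=> mA A1; rewrite probability_setC// A1 subee. Qed.

Let sub_null (m : {measure set (Bor mat) -> \bar R}) (A B : set (Bor mat)) :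
  measurable A -> measurable B -> A `<=` B -> m B = 0%E -> m A = 0%E.
Proof.
move=> mA mB AB B0; apply/eqP; rewrite eq_le measure_ge0 andbT -B0.
by apply: le_measure; rewrite ?inE.
Qed.

Lemma haar_setC : haar (~` G) = 0%E.
Proof. by apply: null_setC; [exact: measurable_group|have [] := Ghaar]. Qed.

Lemma haar_left_inv : left_inv G haar.
Proof. by have [_ +] := Ghaar. Qed.

Lemma kappa_MinSet x h : kappa x h (~` MinSet G x h) = 0%E.
Proof.
have := kappaP x h; rewrite /unif_cond; case: asboolP => [M0 ->|_ [M1 _]].
- by rewrite setICl measure0 mul0r.
- exact: measurableC.
- exact: null_setC.
Qed.

Lemma kappa_setC x h : kappa x h (~` G) = 0%E.
Proof.
apply: sub_null (kappa_MinSet x h); [|exact: measurableC|].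
  by apply: measurableC; exact: measurable_group.
by apply: subsetC => Q [].
Qed.

Definition stabilizer h : set mat := [set Q | G Q /\ Q *m h = h].

Lemma stabilizer_subgroup_O h : subgroup_O (stabilizer h).
Proof.
split=> [|Q [GQ Qh]|Q [GQ _]]; last exact: GTM.
- rewrite [X in measurable X](_ : _ = (G : set (Bor mat)) `&` \bigcap_(k in [set: 'I_p])
      (fun Q : Bor mat => ((Q : mat) *m h) k 0) @^-1` [set h k 0]).
    apply: measurableI; first exact: measurable_group.
    apply: fin_bigcap_measurable => // k _; rewrite -[X in measurable X]setTI.
    suff mk : measurable_fun setT (fun Q : Bor mat => ((Q : mat) *m h) k 0).
      by apply: mk.
    under eq_fun do rewrite mxE; apply: measurable_sum => l.
    by apply: measurable_funM => //; exact: measurable_coord.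
  apply/seteqP; split=> [Q [GQ Qh]|Q [GQ Qh]]; split=> //.
    by move=> k _ /=; rewrite Qh.
  by apply/colP => k; exact: Qh.
- by split; [exact: GT|rewrite -{1}Qh mulmxA GTM// mul1mx].
Qed.

(** Right multiplication by the stabilizer does not move [Q *m h]; this provides the premise of the
    invariance clause in [unif_cond]. *)
Lemma MinSet_stabilizer x h k : stabilizer h k ->
  (fun Q => Q *m k) @` MinSet G x h = MinSet G x h.
Proof.
move=> [Gk kh]; rewrite MinSetE//; apply/seteqP; split=> [_ [Q [GQ QE] <-]|Q [GQ QE]].
  by split; [exact: GM|rewrite -mulmxA kh].
have kTh : k^T *m h = h by rewrite -{1}kh mulmxA GTM// mul1mx.
exists (Q *m k^T); last by rewrite -mulmxA GTM// mulmx1.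
by split; [apply: GM => //; exact: GT|rewrite -mulmxA kTh].
Qed.

(* Both sides live on the same coset of the stabilizer of [h], and are right
   invariant under it. *)
Lemma kappa_equivariant g x h C : G g -> unique_image G h x -> measurable C ->
  kappa (g *m x) h C = kappa x h ((fun M : mat => g *m M) @^-1` C).
Proof.
move=> Gg ux mC; have mgC := measurable_preimage_mx (measurable_mulmxl g) mC.
set M := MinSet G x h; set M' := MinSet G (g *m x) h.
have M'E : M' = (fun Q => g^T *m Q) @^-1` M by exact: MinSet_group.
have hM' : haar M' = haar M.
  by rewrite M'E; apply: haar_left_inv; [exact: GT|exact: mMin].
have := kappaP x h; have := kappaP (g *m x) h; rewrite /unif_cond -/M -/M' hM'.
case: asboolP => [_ k1 k2|_ [k1 k1r] [k2 k2r]].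
  (* Positive Haar mass: both laws are normalized restrictions of [haar], exchanged by left
     translation. *)
  rewrite k1// k2//; congr (fine _ / _)%:E.
  rewrite -[RHS](haar_left_inv (GT Gg) (measurableI _ _ mgC (mMin x h))).
  congr (haar _); rewrite M'E; apply/seteqP; split=> Q [] /=.
    by rewrite mulmxA GMT// mul1mx.
  by rewrite mulmxA GMT// mul1mx.
(* Haar-null case: one maximizer [Q0] is fixed. Uniqueness of the image puts both laws on the coset
   of [g *m Q0] modulo the stabilizer. *)
have [Q0 GQ0 Q0E] := supp_attained GO h x.
have MQ0 : M Q0 by rewrite /M MinSetE.
have GgQ0 := GM Gg GQ0.
have sK := stabilizer_subgroup_O h; have [mK _ _] := sK.
have mD : measurable [set Q : Bor mat | ~ stabilizer h ((g *m Q0)^T *m Q)].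
  exact: measurableC (measurable_preimage_mx (measurable_mulmxl _) mK).
apply: (coset_right_inv_unique sK (GTM GgQ0) _ _ _ _ _ _
  (m2 := pushfwd (kappa x h) (measurable_mulmxl g))) => //.
- exact: probability_setT.
- exact: (probability_setT (kappa x h)).
- apply: sub_null (kappa_MinSet (g *m x) h) => //; first exact: measurableC.
  apply: subsetC => Q; rewrite -/M' M'E /= => MQ; split.
    by case: MQ => + _; rewrite trmx_mul -mulmxA; apply: GM; exact: GT.
  by rewrite trmx_mul -!mulmxA (mulmxA g^T) (ux _ _ MQ MQ0) mulmxA GTM// mul1mx.
- rewrite pushfwdE; apply: sub_null (kappa_MinSet x h) => //.
  + exact: measurable_preimage_mx (measurable_mulmxl g) mD.
  + exact: measurableC.
  apply: subsetC => Q MQ /=; split.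
    case: (MQ) => GQ _; apply: GM; [exact: GT|exact: GM].
  by rewrite trmx_mul -!mulmxA (mulmxA g^T) GTM// mul1mx (ux _ _ MQ MQ0) mulmxA GTM// mul1mx.
- move=> k sk D mDD; apply: k1r => //; first by case: sk.
  exact: MinSet_stabilizer.
- move=> k sk D mDD; have [Gk _] := sk.
  have mgD := measurable_preimage_mx (measurable_mulmxl g) mDD.
  apply: etrans (k2r k Gk (MinSet_stabilizer x sk) _ mgD).
  by congr (kappa x h _); apply/seteqP; split=> Q /=; rewrite mulmxA.
Qed.

Section mixture.
Variables (h : vec) (u : Bor vec -> R).
Hypotheses (mu_ : measurable_fun setT u) (u0 : forall x, 0 <= u x)
  (u1 : forall x, u x <= 1).
Hypothesis uG : forall g x, G g -> u (g *m x) = u x.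
Hypothesis dens : has_lebesgue_density mu.

(** Unnormalized law of a rotation drawn from [kappa x h], with [x] weighted by [u]. In the
    application [u] collects the weight of a permutation and the factors of the other indices. *)
Definition mixture (C : set (Bor mat)) : \bar R :=
  (\int[mu]_x ((u x)%:E * kappa x h C))%E.

Let mixture0 : mixture set0 = 0%E.
Proof. by rewrite /mixture; under eq_integral do rewrite measure0 mule0; rewrite integral0. Qed.

Let mixture_ge0 C : (0 <= mixture C)%E.
Proof. by apply: integral_ge0 => x _; rewrite mule_ge0// lee_fin. Qed.

Let muk C : measurable C -> measurable_fun setT (fun x : Bor vec => (u x)%:E * kappa x h C)%E.
Proof.
move=> mC; apply: emeasurable_funM; first exact/measurable_EFinP.
exact: mkappa.
Qed.

Let mixture_sigma_additive : semi_sigma_additive mixture.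
Proof.
move=> F mF tF mUF.
rewrite [X in _ --> X](_ : _ =
  (\int[mu]_x (\sum_(n <oo) (u x)%:E * kappa x h (F n))))%E; last first.
  apply: eq_integral => x _; rewrite nneseriesZl//.
  congr (_ * _)%E; apply/esym/cvg_lim => //; exact: measure_semi_sigma_additive.
apply/cvg_closeP; split.
  by apply: is_cvg_nneseries => n _ _; exact: mixture_ge0.
rewrite closeE// integral_nneseries// => n.
  exact: muk.
by move=> x _; rewrite mule_ge0// lee_fin.
Qed.

HB.instance Definition _ := isMeasure.Build _ _ _ mixture
  mixture0 mixture_ge0 mixture_sigma_additive.

Lemma mixture_haar C : measurable C ->
  (\int[mu]_x ((u x)%:E * kappa x h C))%E = (\int[mu]_x (u x * fine (haar C))%:E)%E.
Proof.
move=> mC.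
have mT : mixture setT = (\int[mu]_x (u x)%:E)%E.
  by apply: eq_integral => x _; rewrite [X in (_ * X)%E]probability_setT mule1.
have u1' x : `|u x| <= 1 by rewrite ger0_norm.
transitivity (mixture setT * haar C)%E; last first.
  rewrite mT -[X in (_ * X)%E]fineK; last exact: fin_num_measure.
  under [RHS]eq_integral do rewrite EFinM.
  rewrite integralZr//.
  exact: bounded_integrable mu_ u1'.
apply: (@haar_unique _ _ G mixture haar) => //.
- exact: group_subgroup_O.
- suff : (mixture setT < +oo)%E by [].
  by rewrite mT -(EFin_bounded_integral mu mu_ u1') ltry.
- rewrite /= /mixture; under eq_integral do rewrite kappa_setC mule0.
  by rewrite integral0.
- move=> g Gg D mD; have mgD := measurable_preimage_mx (measurable_mulmxl g) mD.
  have mg : measurable_fun setT (fun x : Bor vec => g *m x : Bor vec).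
    exact: (@measurable_fun_mulmx _ _ _ _ _ _ (cst (g : Bor mat)) id).
  (* Equivariance off the null set of kinks moves [g] from the event to the observation, [u] being
     unchanged; the invariance of [mu] then removes it. *)
  transitivity (\int[mu]_x ((u (g *m x))%:E * kappa (g *m x) h D))%E.
    apply: ae_eq_integral => //.
    + exact: muk.
    + exact: (measurableT_comp (muk mD) mg).
    have [N [mN N0 Nsub]] := ae_unique_image GO h dens.
    exists N; split=> // x /= nx; apply: Nsub => /= ux; apply: nx => _.
    by rewrite uG// kappa_equivariant.
  rewrite -(ge0_integral_pushfwd mu mg (muk mD)); last first.
    by move=> x; rewrite mule_ge0// lee_fin.
  by apply: eq_measure_integral => A mA _; exact: mu_inv.
- exact: probability_setT.
- exact: haar_setC.
- exact: haar_left_inv.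
Qed.

End mixture.

End tie_breaking.

(** * Product form of the joint law *)

Section rotation_law.
Context {R : realType} {p : nat}.
Local Notation vec := 'cV[R]_p.
Local Notation mat := 'M[R]_p.
Variables (G : set mat) (haar : probability (Bor mat) R).
Hypotheses (GO : compact_subgroup_O G) (Ghaar : is_haar G haar).
Variables (mu : probability (Bor vec) R).
Hypothesis dens : has_lebesgue_density mu.
Hypothesis mu_inv : forall Q, G Q -> forall A : set (Bor vec), measurable A ->
  mu ((fun x : Bor vec => (Q *m x : Bor vec)) @^-1` A) = mu A.
Variables (kappa : vec -> vec -> probability (Bor mat) R).
Hypothesis kappaP : forall x h, unif_cond G haar (MinSet G x h) (kappa x h).
Hypothesis mkappa : forall h (C : set (Bor mat)), measurable C ->
  measurable_fun setT (fun x : Bor vec => kappa x h C).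
Variables (n : nat) (h : 'I_n -> vec).
Implicit Types (s : {perm 'I_n}) (t : n.-tuple (Bor vec)).

(** Conditional probability, given the data, that the uniform choice among optimal permutations
    selects [s]. *)
Definition opt_weight s (x : 'I_n -> vec) : R :=
  if `[< opt_perm G x h s >] then (n_opt G x h)%:R^-1 else 0.

Lemma opt_weight_ge0 s x : 0 <= opt_weight s x.
Proof. by rewrite /opt_weight; case: ifP => // _; rewrite invr_ge0. Qed.

Lemma opt_weight_le1 s x : opt_weight s x <= 1.
Proof.
rewrite /opt_weight; case: ifP => // _.
have [->|n0] := eqVneq (n_opt G x h) 0%N; first by rewrite invr0.
by rewrite invf_le1 ?ltr0n ?ler1n lt0n.
Qed.

(** By [opt_permE] the optimal permutations are determined by the table of support values, so moving
    a single observation by [G] does not affect the weight. *)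
Lemma opt_weight_supp s x x' :
  (forall i j, supp G (h i) (x j) = supp G (h i) (x' j)) ->
  opt_weight s x = opt_weight s x'.
Proof.
move=> xx'; have E : opt_perm G x h = opt_perm G x' h.
  apply/funext => s'; apply/propext; rewrite !opt_permE//.
  have e (s0 : {perm 'I_n}) :
      \sum_i supp G (h i) (x (s0 i)) = \sum_i supp G (h i) (x' (s0 i)).
    by apply: eq_bigr => i _; rewrite xx'.
  by split=> H s0; have := H s0; rewrite !e.
by rewrite /opt_weight /n_opt E.
Qed.

Lemma measurable_opt_perm s :
  measurable [set t : n.-tuple (Bor vec) | opt_perm G (tnth t) h s].
Proof.
rewrite [X in measurable X](_ : _ = \bigcap_(s' in [set: {perm 'I_n}])
   [set t : n.-tuple (Bor vec) | \sum_i supp G (h i) (tnth t (s' i)) <=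
      \sum_i supp G (h i) (tnth t (s i))]); last first.
  apply/seteqP; split=> t /=; rewrite opt_permE// => H; first by move=> s' _; exact: H.
  by move=> s'; exact: H.
have mS s0 : measurable_fun setT
    (fun t : n.-tuple (Bor vec) => \sum_i supp G (h i) (tnth t (s0 i))).
  apply: measurable_sum => i.
  have ms : measurable_fun setT (supp G (h i) : Bor vec -> R).
    apply: (measurable_supp GO) => //.
    by exists 1%:M; have [] := GO.
  exact: (measurableT_comp ms (measurable_tnth (s0 i))).
apply: fin_bigcap_measurable => [|s' _]; first exact: finite_finset.
by have := measurable_fun_ler (mS s') (mS s) measurableT (Logic.I : measurable [set true]);
  rewrite setTI.
Qed.

(** The set of optimal permutations takes finitely many values, and the weight is constant on each
    of the corresponding events. *)
Lemma measurable_opt_weight s :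
  measurable_fun setT (fun t : n.-tuple (Bor vec) => opt_weight s (tnth t)).
Proof.
pose S (t : n.-tuple (Bor vec)) : {set {perm 'I_n}} :=
  [set s' | `[< opt_perm G (tnth t) h s' >]]%SET.
have mS S0 : measurable [set t | S t = S0].
  rewrite [X in measurable X](_ : _ = \bigcap_(s' in [set: {perm 'I_n}])
     [set t : n.-tuple (Bor vec) | `[< opt_perm G (tnth t) h s' >] = (s' \in S0)]); last first.
    apply/seteqP; split=> t /=; first by move=> <- s' _ /=; rewrite inE.
    by move=> H; apply/setP => s'; rewrite inE; exact: H.
  apply: fin_bigcap_measurable => [|s' _]; first exact: finite_finset.
  have m := measurable_opt_perm s'.
  case: (s' \in S0).
    by rewrite [X in measurable X](_ : _ = [set t | opt_perm G (tnth t) h s'])//;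
      apply/seteqP; split=> t /=; move/asboolP.
  rewrite [X in measurable X](_ : _ = ~` [set t | opt_perm G (tnth t) h s']).
    exact: measurableC.
  apply/seteqP; split=> t /=; last exact: asboolF.
  by move=> tF /asboolP; rewrite tF.
rewrite (_ : (fun t => _) = fun t => \sum_(S0 : {set {perm 'I_n}})
    \1_[set t | S t = S0] t * (if s \in S0 then #|S0|%:R^-1 else 0)).
  by apply: measurable_sum => S0; apply: measurable_funM => //; exact: measurable_indic.
apply/funext => t; rewrite (bigD1 (S t))//= big1 ?addr0; last first.
  move=> S0 S0t; rewrite indicE memNset ?mul0r//=; apply/eqP.
  by rewrite eq_sym.
rewrite indicE mem_set//= mul1r /opt_weight /n_opt -/(S t).
rewrite /S inE; case: ifP => // _; congr (_%:R^-1); apply: eq_card => s0.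
rewrite [RHS]inE; exact: asboolb.
Qed.

Context d (Omega : measurableType d) (P : probability Omega R).
Variables (X : 'I_n -> Omega -> Bor vec) (C : 'I_n -> set (Bor mat)).
Hypothesis mX : forall j, measurable_fun setT (X j).
Hypothesis indX : forall A : 'I_n -> set (Bor vec), (forall j, measurable (A j)) ->
  P [set w | forall j, A j (X j w)] = (\prod_(j < n) mu (A j))%E.
Hypothesis mC : forall i, measurable (C i).

(* The first [k] conditional laws have been replaced by the Haar measure. *)
Let hybrid (k : nat) s (t : n.-tuple (Bor vec)) : R := opt_weight s (tnth t) *
  \prod_(i < n) (if (i < k)%N then fine (haar (C i))
                 else fine (kappa (tnth t (s i)) (h i) (C i))).

Let fine01 (m : probability (Bor mat) R) (A : set (Bor mat)) :
  measurable A -> 0 <= fine (m A) <= 1.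
Proof.
move=> mA; rewrite fine_ge0//= -lee_fin fineK ?probability_le1//.
exact: fin_num_measure.
Qed.

Let mfk i : measurable_fun setT (fun x : Bor vec => fine (kappa x (h i) (C i))).
Proof. exact: (measurableT_comp (@fine_measurable _ _ measurableT) (mkappa _ (mC i))). Qed.

Let hybrid_ge0 k s t : 0 <= hybrid k s t.
Proof.
rewrite mulr_ge0 ?opt_weight_ge0// prodr_ge0// => i _.
by case: ifP => _; rewrite fine_ge0.
Qed.

Let measurable_hybrid k s : measurable_fun setT (hybrid k s).
Proof.
apply: measurable_funM; first exact: measurable_opt_weight.
apply: measurable_prod => i _ /=; case: (i < k)%N => //.
exact: (measurableT_comp (mfk i) (measurable_tnth (s i))).
Qed.

(** As [s] is injective, observation [s k] enters only the weight and the [k]-th kernel. Integrating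
    it first, the others being frozen, gives an instance of [mixture_haar]. *)
Lemma hybrid_step (k : 'I_n) s :
  (\int[P]_w (hybrid k s [tuple X i w | i < n])%:E =
   \int[P]_w (hybrid k.+1 s [tuple X i w | i < n])%:E)%E.
Proof.
have E j := @ge0_integral_upd _ _ _ _ _ n P (fun=> mu) X point mX indX (s k)
  (EFin \o hybrid j s) (measurableT_comp (@EFin_measurable _ _) (measurable_hybrid j s))
  (fun t => hybrid_ge0 j s t).
rewrite (E k) (E k.+1); apply: eq_integral => w _.
pose rest := \prod_(i < n | i != k) (if (i < k)%N then fine (haar (C i))
                 else fine (kappa (X (s i) w) (h i) (C i))).
pose u (y : Bor vec) := opt_weight s (tnth (upd (s k) y (X ^~ w))) * rest.
(* For the other indices the tests [i < k] and [i < k.+1] agree, so both hybrids share [u] and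
   differ in the factor of index [k] alone. *)
have uE (j : nat) y : (j = k \/ j = k.+1 :> nat) -> hybrid j s (upd (s k) y (X ^~ w)) =
    u y * (if (k < j)%N then fine (haar (C k)) else fine (kappa y (h k) (C k))).
  move=> jk; rewrite /hybrid (bigD1 k)//= tnth_mktuple eqxx /u -!mulrA; congr (_ * _).
  rewrite mulrC; congr (_ * _); apply: eq_bigr => i ik.
  rewrite tnth_mktuple (inj_eq perm_inj) (negbTE ik).
  case: jk => ->//; rewrite ltnS leq_eqVlt.
  by rewrite (_ : (i == k :> nat) = false)//; apply/negbTE.
transitivity (\int[mu]_y ((u y)%:E * kappa y (h k) (C k)))%E.
  apply: eq_integral => y _; rewrite /= uE; last by left.
  by rewrite ltnn EFinM fineK//; exact: fin_num_measure.
have rest01 : 0 <= rest <= 1.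
  rewrite prodr_ge0/=; last by move=> i _; case: ifP => _; rewrite fine_ge0.
  by apply: prodr_ile1 => i _; case: ifP => _; exact: fine01.
have /andP[rest0 rest1] := rest01.
etransitivity.
  apply: (@mixture_haar _ _ G haar GO Ghaar mu mu_inv kappa kappaP mkappa (h k) u _ _ _ _ dens _ (mC k)).
  - apply: measurable_funM => //.
    exact: measurableT_comp (measurable_opt_weight s) (measurable_upd1 _ _).
  - by move=> y; rewrite mulr_ge0 ?opt_weight_ge0.
  - by move=> y; rewrite mulr_ile1 ?opt_weight_ge0 ?opt_weight_le1.
  - move=> g y Gg; rewrite /u; congr (_ * _); apply: opt_weight_supp => i j.
    by rewrite !tnth_mktuple; case: ifP => // _; exact: supp_group.
by apply: eq_integral => y _; rewrite /= uE ?ltnSn//; right.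
Qed.

Lemma integral_opt_weight_kappa s :
  (\int[P]_w (opt_weight s (X ^~ w) *
     \prod_(i < n) fine (kappa (X (s i) w) (h i) (C i)))%:E =
   \prod_(i < n) haar (C i) * \int[P]_w (opt_weight s (X ^~ w))%:E)%E.
Proof.
have tE w : tnth [tuple X i w | i < n] = X ^~ w.
  by apply/funext => i; rewrite tnth_mktuple.
transitivity (\int[P]_w (hybrid 0 s [tuple X i w | i < n])%:E)%E.
  apply: eq_integral => w _; rewrite /hybrid tE; congr (_ * _)%:E.
have step k : (k <= n)%N -> (\int[P]_w (hybrid 0 s [tuple X i w | i < n])%:E =
    \int[P]_w (hybrid k s [tuple X i w | i < n])%:E)%E.
  elim: k => [//|k IHk] kn; rewrite IHk; last exact: ltnW.
  exact: (hybrid_step (Ordinal kn)).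
rewrite (step n)//.
transitivity (\int[P]_w ((\prod_(i < n) fine (haar (C i)))%:E *
    (opt_weight s (X ^~ w))%:E))%E.
  apply: eq_integral => w _; rewrite /hybrid tE -EFinM mulrC; congr (_ * _)%:E.
  by apply: eq_bigr => i _; rewrite ltn_ord.
have mo : measurable_fun setT (fun w => opt_weight s (X ^~ w)).
  rewrite (_ : (fun w => _) = (fun w => opt_weight s (tnth [tuple X i w | i < n]))).
    exact: measurableT_comp (measurable_opt_weight s) (measurable_mktuple mX).
  by apply/funext => w; rewrite tE.
rewrite ge0_integralZl_EFin//; last 3 first.
- by move=> w _; rewrite lee_fin opt_weight_ge0.
- exact/measurable_EFinP.
- by rewrite prodr_ge0// => i _; rewrite fine_ge0.
congr (_ * _)%E.
rewrite -prodEFin; apply: eq_bigr => i _; rewrite fineK//.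
exact: fin_num_measure.
Qed.

End rotation_law.

(** On each event [sig w = s] the rotations have the product Haar law, scaled by the probability of
    that event; summing over the finitely many permutations removes [sig]. *)
Lemma rotation_law {R : realType} {p : nat}
  (G : set 'M[R]_p) (haar : probability (Bor 'M[R]_p) R)
  (mu : probability (Bor 'cV[R]_p) R) (n : nat) (h : 'I_n -> 'cV[R]_p)
  d (Omega : measurableType d) (P : probability Omega R)
  (X : 'I_n -> Omega -> Bor 'cV[R]_p)
  (kappa : 'cV[R]_p -> 'cV[R]_p -> probability (Bor 'M[R]_p) R)
  (sig : Omega -> {perm 'I_n}) (Qh : Omega -> 'I_n -> Bor 'M[R]_p) :
  compact_subgroup_O G -> is_haar G haar -> has_lebesgue_density mu ->
  (forall j, measurable_fun setT (X j)) ->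
  (forall A : 'I_n -> set (Bor 'cV[R]_p), (forall j, measurable (A j)) ->
     P [set w | forall j : 'I_n, A j (X j w)] = (\prod_(j < n) mu (A j))%E) ->
  (forall x hh, unif_cond G haar (MinSet G x hh) (kappa x hh)) ->
  (forall hh (C : set (Bor 'M[R]_p)), measurable C ->
     measurable_fun setT (fun x : Bor 'cV[R]_p => kappa x hh C)) ->
  (forall s : {perm 'I_n}, measurable [set w | sig w = s]) ->
  (forall i : 'I_n, measurable_fun setT (fun w => Qh w i)) ->
  (forall (A : 'I_n -> set (Bor 'cV[R]_p)) (s : {perm 'I_n})
       (C : 'I_n -> set (Bor 'M[R]_p)),
     (forall j, measurable (A j)) -> (forall i, measurable (C i)) ->
     P [set w | [/\ forall j : 'I_n, A j (X j w), sig w = s &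
                    forall i : 'I_n, C i (Qh w i)]]
     = (\int[P]_w
         ((\1_[set w' | forall j : 'I_n, A j (X j w')] w)%:E
          * (if `[< opt_perm G (fun j : 'I_n => X j w) h s >]
             then (n_opt G (fun j : 'I_n => X j w) h)%:R^-1 else 0)%:E
          * \prod_(i < n) kappa (X (s i) w) (h i) (C i)))%E) ->
  (forall Q, G Q -> forall A : set (Bor 'cV[R]_p), measurable A ->
     mu ((fun x : Bor 'cV[R]_p => (Q *m x : Bor 'cV[R]_p)) @^-1` A) = mu A) ->
  forall C : 'I_n -> set (Bor 'M[R]_p), (forall i, measurable (C i)) ->
  P [set w | forall i, C i (Qh w i)] = (\prod_(i < n) haar (C i))%E.
Proof.
move=> GO Ghaar dens mX indX kappaP mkappa msig mQh joint mu_inv C mC.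
have law (D : 'I_n -> set (Bor 'M[R]_p)) s : (forall i, measurable (D i)) ->
    P [set w | sig w = s /\ forall i, D i (Qh w i)] =
    (\prod_(i < n) haar (D i) * \int[P]_w (opt_weight G h s (X ^~ w))%:E)%E.
  move=> mD; rewrite -(integral_opt_weight_kappa GO Ghaar dens mu_inv kappaP mkappa h mX indX mD).
  transitivity (P [set w | [/\ forall j : 'I_n, setT (X j w), sig w = s &
                    forall i : 'I_n, D i (Qh w i)]]).
    by congr (P _); apply/seteqP; split=> w /=; [move=> []|move=> []].
  rewrite (joint (fun=> setT))//; apply: eq_integral => w _.
  rewrite indicE mem_set//= mul1e EFinM; congr (_ * _)%E.
  rewrite -prodEFin; apply: eq_bigr => i _; rewrite fineK//.
  exact: fin_num_measure.
have lawS s : P [set w | sig w = s /\ forall i, C i (Qh w i)] =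
    (P [set w | sig w = s] * \prod_(i < n) haar (C i))%E.
  (* Taking all the sets [D i] full identifies the mean weight of [s] with the probability of
     [sig w = s]. *)
  rewrite law// muleC; congr (_ * _)%E.
  rewrite (_ : [set w | sig w = s] =
    [set w | sig w = s /\ forall i, [set: Bor 'M[R]_p] (Qh w i)]).
    rewrite (law (fun=> setT) s)// big1 ?mul1e// => i _; exact: probability_setT.
  by apply/seteqP; split=> w /=; [|move=> []].
have mCQ : measurable [set w | forall i, C i (Qh w i)].
  rewrite [X in measurable X](_ : _ = \bigcap_(i in [set: 'I_n])
      (fun w => Qh w i) @^-1` C i).
    apply: fin_bigcap_measurable => // i _; rewrite -[X in measurable X]setTI.
    exact: mQh.
  by apply/seteqP; split=> [w Cw i _|w Cw i]; exact: Cw.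
have decomp A : measurable A ->
    P A = (\sum_(s \in [set: {perm 'I_n}]) P ([set w | sig w = s] `&` A))%E.
  move=> mA; rewrite -measure_fin_bigcup.
  - by congr (P _); apply/seteqP; split=> [w Aw|w [s _ []]//]; exists (sig w).
  - exact: finite_finset.
  - by move=> s s' _ _ [w [[/= <- _] [/= <- _]]].
  - by move=> s _; exact: measurableI.
rewrite decomp//.
rewrite (eq_fsbigr (fun s => \prod_(i < n) haar (C i) *
  P ([set w | sig w = s] `&` setT))%E); last first.
  by move=> s _; rewrite [LHS]lawS setIT muleC.
rewrite -ge0_mule_fsumr//.
by rewrite -decomp// [X in (_ * X)%E]probability_setT mule1.
Qed.

(** * Moments of the reference points *)

Lemma squeeze_half {R : realType} (a y b z e : R) :
  a + y - e / 2 < b + z -> a - y - e / 2 < b - z -> `|a - b| <= e / 2 ->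
  `|y - z| <= e.
Proof. by rewrite !ler_norml => h1 h2 /andP[h3 h4]; apply/andP; split; lra. Qed.

Lemma cvgr_sum {R : realType} {T I : Type} (F : set_system T) {FF : Filter F}
    (r : seq I) (f : I -> T -> R) (l : I -> R) :
  (forall i, f i x @[x --> F] --> l i) ->
  (\sum_(i <- r) f i x) @[x --> F] --> \sum_(i <- r) l i.
Proof.
move=> fl; elim: r => [|i r IHr].
  by under eq_fun do rewrite big_nil; rewrite big_nil; exact: cvg_cst.
by under eq_fun do rewrite big_cons; rewrite big_cons; exact: cvgD.
Qed.

(** * Continuous minorants of relatively continuous functions *)

Section lipschitz_envelope.
Context {R : realType} {p : nat}.
Local Notation vec := 'cV[R]_p.
Variables (B : set vec) (g : vec -> R) (g0 : forall x, 0 <= g x).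
Hypothesis B0 : B !=set0.

(* Truncated inf-convolution with [k |x|]: it increases to [g] at the points
   of [B] where [g] is continuous relatively to [B]. *)
Definition envelope (k : nat) (x : vec) : R :=
  inf [set Num.min k%:R (g y + k%:R * `|x - y|) | y in B].

Let lb k x : lbound [set Num.min k%:R (g y + k%:R * `|x - y|) | y in B] 0.
Proof. by move=> _ [y _ <-]; rewrite le_min ler0n/= addr_ge0// mulr_ge0. Qed.

Lemma envelope_le k x y : B y -> envelope k x <= Num.min k%:R (g y + k%:R * `|x - y|).
Proof. by move=> By; apply: ge_inf; [exists 0; exact: lb|exists y]. Qed.

Lemma le_envelope k x c :
  (forall y, B y -> c <= Num.min k%:R (g y + k%:R * `|x - y|)) -> c <= envelope k x.
Proof.
move=> Bc; have [y By] := B0; apply: lb_le_inf.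
  by exists (Num.min k%:R (g y + k%:R * `|x - y|)), y.
by move=> _ [z Bz <-]; exact: Bc.
Qed.

Lemma envelope_ge0 k x : 0 <= envelope k x.
Proof. by apply: le_envelope => y _; rewrite le_min ler0n/= addr_ge0// mulr_ge0. Qed.

Lemma envelope_le_nat k x : envelope k x <= k%:R.
Proof.
have [y By] := B0; apply: le_trans (envelope_le k x By) _.
by rewrite ge_min lexx.
Qed.

Lemma envelope_le_fun k x : B x -> envelope k x <= g x.
Proof.
move=> Bx; apply: le_trans (envelope_le k x Bx) _.
by rewrite subrr normr0 mulr0 addr0 ge_min lexx orbT.
Qed.

(** Each competitor is [k]-Lipschitz in [x] on the whole space, although only points of [B] compete;
    hence so is the infimum. *)
Lemma envelope_continuous k : continuous (envelope k).
Proof.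
apply: (@lipschitz_continuous _ _ _ _ k%:R) => x y.
suff H u v : envelope k u <= envelope k v + k%:R * `|u - v|.
  have := H x y; have := H y x; rewrite (distrC y x) ler_norml.
  by move=> h1 h2; apply/andP; split; lra.
rewrite -lerBlDr; apply: le_envelope => z Bz; rewrite lerBlDr.
apply: le_trans (envelope_le k u Bz) _.
have k0 : 0 <= k%:R * `|u - v| by rewrite mulr_ge0.
have [kle|_] := leP k%:R (g z + k%:R * `|v - z|); rewrite ge_min.
  by rewrite lerDl k0.
apply/orP; right; rewrite -addrA lerD2l -mulrDr ler_wpM2l//.
by apply: le_trans (ler_normD _ _); rewrite [v - z + _]addrC addrA subrK.
Qed.

Lemma nondecreasing_envelope x :
  {homo (fun k => envelope k x) : k l / (k <= l)%N >-> k <= l}.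
Proof.
move=> k l kl; apply: le_envelope => y By; apply: le_trans (envelope_le k x By) _.
have kl' : k%:R <= l%:R :> R by rewrite ler_nat.
rewrite le_min !ge_min kl'/=; apply/orP; right.
by rewrite lerD2l ler_wpM2r.
Qed.

Lemma envelope_near x : B x -> g y @[y --> within B (nbhs x)] --> g x ->
  forall e, 0 < e -> \forall k \near \oo, g x - e <= envelope k x.
Proof.
move=> Bx gx e e0.
have /cvgrPdist_lt/(_ e e0) := gx; rewrite near_withinE => /nbhs_ballP[r /= r0 xr].
(* Past this index the cap [k] exceeds [g x], and a competitor at distance at least [r] pays
   [k * r >= g x]; nearer ones are handled by continuity. *)
exists (Num.truncn (Num.max (g x) (g x / r))).+1 => // k /= kP.
have := le_lt_trans (lexx _) (truncnS_gt (Num.max (g x) (g x / r))).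
rewrite gt_max => /andP[gk grk].
have {}kP : ((Num.truncn (Num.max (g x) (g x / r))).+1)%:R <= k%:R :> R by rewrite ler_nat.
have {gk} gk : g x <= k%:R by apply: ltW; exact: lt_le_trans gk kP.
have {grk} grk : g x <= k%:R * r by rewrite -ler_pdivrMr// ltW// (lt_le_trans grk kP).
apply: le_envelope => y By; rewrite le_min; apply/andP; split.
  by rewrite lerBlDr (le_trans gk)// lerDl ltW.
have [yr|yr] := ltP `|x - y| r.
  have /xr/(_ By) : ball x r y by rewrite -ball_normE.
  rewrite ltr_distl => /andP[_ gy].
  have : 0 <= k%:R * `|x - y| by rewrite mulr_ge0.
  lra.
have := ler_wpM2l (ler0n R k) yr; have := g0 y; lra.
Qed.

(** Monotone convergence along the envelopes: almost everywhere their limit is at least [g], so one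
    of them already has integral above [c]. *)
Lemma minorant_exists (nu : probability (Bor vec) R) (D : set (Bor vec)) (c : R) :
  measurable_fun setT (g : Bor vec -> R) ->
  measurable D -> D `<=` B -> nu D = 1%E ->
  nu.-negligible [set x | B x /\ ~ (g y @[y --> within B (nbhs x)] --> g x)] ->
  (c%:E < \int[nu]_x (g x)%:E)%E ->
  exists f : vec -> R, [/\ bounded_continuous f, (forall x, 0 <= f x),
    (forall x, B x -> f x <= g x) & (c%:E < \int[nu]_x (f x)%:E)%E].
Proof.
move=> mg mD DB nuD gae cg.
pose E k (x : Bor vec) : \bar R := (envelope k x)%:E.
have mE k : measurable_fun setT (E k).
  by apply/measurable_EFinP; apply: continuous_measurable_mx; exact: envelope_continuous.
have E0 k x : (0 <= E k x)%E by rewrite lee_fin envelope_ge0.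
have ndE x : nondecreasing_seq (E ^~ x).
  by move=> k l kl; rewrite lee_fin nondecreasing_envelope.
have cE x : cvgn (E ^~ x) by exact: ereal_nondecreasing_is_cvgn.
have mon := monotone_convergence nu measurableT mE (fun k x _ => E0 k x) (fun x _ => ndE x).
have [k ck] : exists k, (c%:E < \int[nu]_x E k x)%E.
  apply: contrapT => nk.
  have : (\int[nu]_x (g x)%:E <= c%:E)%E; last by rewrite leNgt cg.
  apply: (@le_trans _ _ (\int[nu]_x limn (E ^~ x))%E).
    apply: ae_ge0_le_integral => //.
    - by move=> x _; rewrite lee_fin.
    - exact/measurable_EFinP.
    - by move=> x _; apply: lime_ge => //; apply: nearW => k.
    - by apply: (emeasurable_fun_cvg E) => // x _; exact: cE.
    have [N [mN N0 Nsub]] := gae.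
    (* [B] may fail to be measurable, so the exceptional set uses the complement of its measurable
       part [D] of full mass. *)
    exists (N `|` ~` D); split.
    - by apply: measurableU => //; exact: measurableC.
    - have DC0 : nu (~` D) = 0%E by rewrite probability_setC// nuD subee.
      apply/eqP; rewrite eq_le measure_ge0 andbT.
      apply: le_trans (measureU2 _ _ _) _ => //; first exact: measurableC.
      by rewrite [X in (X + _)%E]N0 [X in (_ + X)%E]DC0 adde0.
    - move=> x /= nx; have [Dx|nDx] := pselect (D x); last by right.
      left; apply: Nsub; split; first exact: DB.
      move=> gx; apply: nx => _.
      apply/lee_addgt0Pr => e e0; rewrite -leeBlDr// -EFinB.
      apply: lime_ge => //.
      have := envelope_near (DB _ Dx) gx e0; apply: filterS => k.
      by rewrite lee_fin.
  rewrite mon; apply: lime_le.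
    apply: ereal_nondecreasing_is_cvgn => k l kl.
    apply: ge0_le_integral => //; try by move=> *; exact: mE.
    by move=> x _; exact: ndE.
  by apply: nearW => k; rewrite leNgt; apply/negP => ck; apply: nk; exists k.
exists (envelope k); split => //.
- split; first exact: envelope_continuous.
  by exists k%:R => x; rewrite ger0_norm ?envelope_ge0// envelope_le_nat.
- exact: envelope_ge0.
- exact: envelope_le_fun.
Qed.

End lipschitz_envelope.

Section reference_moments.
Context {R : realType} {p : nat}.
Local Notation vec := 'cV[R]_p.
Variables (B : set vec) (h : forall n : nat, 'I_n -> vec)
  (nu : probability (Bor vec) R) (J : vec -> vec) (D : set (Bor vec)).
Hypotheses (hB : forall n (i : 'I_n), B (h i)) (mD : measurable D)
  (DB : D `<=` B) (nuD : nu D = 1%E).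
Hypothesis mJ : measurable_fun setT (J : Bor vec -> Bor vec).
Hypothesis weak : forall f, bounded_continuous f ->
  (fun n => ((n%:R)^-1 * \sum_(i < n) f (h i))%:E) @ \oo --> (\int[nu]_x (f x)%:E)%E.
Hypothesis moments : forall a b : 'I_p,
  (fun n => ((n%:R)^-1 * \sum_(i < n) `|J (h i) a 0 * J (h i) b 0|)%:E) @ \oo
    --> (\int[nu]_x (`|J x a 0 * J x b 0|)%:E)%E
  /\ (\int[nu]_x (`|J x a 0 * J x b 0|)%:E < +oo)%E.
Hypothesis Jae : nu.-negligible [set x | B x /\ ~ cont_within B J x].

(** Expectation under the empirical measure [nu_n]; it is 0 for [n = 0], where the inverse is 0. *)
Definition avg n (f : vec -> R) : R := (n%:R)^-1 * \sum_(i < n) f (h i).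

Lemma avgD n f g : avg n (fun x => f x + g x) = avg n f + avg n g.
Proof. by rewrite /avg big_split mulrDr. Qed.

Lemma avgB n f g : avg n (fun x => f x - g x) = avg n f - avg n g.
Proof. by rewrite /avg sumrB mulrBr. Qed.

Lemma le_avg n f g : (forall x, B x -> f x <= g x) -> avg n f <= avg n g.
Proof. by move=> fg; rewrite ler_wpM2l// ler_sum// => i _; exact: fg. Qed.

Let B0 : B !=set0.
Proof.
have [D0|/set0P[x Dx]] := eqVneq D set0; last by exists x; exact: DB.
by move: nuD; rewrite D0 measure0 => /eqP; rewrite eq_sym onee_eq0.
Qed.

Lemma EFin_cvg (u : nat -> R) (l : R) : (fun n => (u n)%:E) @ \oo --> l%:E -> u @ \oo --> l.
Proof. by move/fine_cvgP => [_]. Qed.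

Lemma weak_cvg f : bounded_continuous f -> avg n f @[n --> \oo] --> \int[nu]_x f x.
Proof.
move=> bf; have := weak bf; have [cf [M fM]] := bf.
have mf := continuous_measurable_mx cf.
by rewrite -(EFin_bounded_integral nu mf fM); exact: EFin_cvg.
Qed.

(** Lower half of the portmanteau theorem: weak convergence is applied to a bounded continuous
    minorant whose integral still exceeds [c]. *)
Lemma fatou_avg (g : vec -> R) (c : R) : (forall x, 0 <= g x) ->
  measurable_fun setT (g : Bor vec -> R) ->
  nu.-negligible [set x | B x /\ ~ (g y @[y --> within B (nbhs x)] --> g x)] ->
  (c%:E < \int[nu]_x (g x)%:E)%E -> \forall n \near \oo, c < avg n g.
Proof.
move=> g0 mg gae cg.
have [f [bf f0 fg cf]] := minorant_exists g0 B0 mg mD DB nuD gae cg.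
have [conf [M fM]] := bf.
have cf' : c < \int[nu]_x f x.
  rewrite -lte_fin (@EFin_bounded_integral _ _ _ nu f M)//.
  exact: continuous_measurable_mx.
near=> n; apply: lt_le_trans (le_avg n fg).
by near: n; exact: (cvgr_gt _ (weak_cvg bf) _ cf').
Unshelve. all: by end_near. Qed.

Let mJa a : measurable_fun setT (fun x : Bor vec => J x a 0).
Proof. exact: measurable_fun_coord mJ. Qed.

Lemma integrable_JJ a b : nu.-integrable setT (fun x => (J x a 0 * J x b 0)%:E).
Proof.
apply/integrableP; split; last by have [_] := moments a b.
by apply/measurable_EFinP; exact: measurable_funM.
Qed.

Let ae_cont (phi : vec -> R) : continuous phi ->
  nu.-negligible [set x | B x /\ ~ (phi (J y) @[y --> within B (nbhs x)] --> phi (J x))].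
Proof.
move=> cphi; apply: negligibleS Jae => x [Bx nx]; split=> // Jx; apply: nx.
exact: (cvg_comp _ _ Jx (cphi (J x))).
Qed.

(** With [Y] the product, [|Y| + Y] and [|Y| - Y] are nonnegative, so [fatou_avg] bounds their
    averages from below. Subtracting the known limit for [|Y|] bounds the averages of [Y] from both
    sides. *)
Lemma moment_cvg a b :
  avg n (fun x => J x a 0 * J x b 0) @[n --> \oo] --> \int[nu]_x (J x a 0 * J x b 0).
Proof.
pose Y x := J x a 0 * J x b 0.
have iY := integrable_JJ a b.
have iaY : nu.-integrable setT (fun x => `|Y x|%:E) by exact: integrable_norm iY.
have mY : measurable_fun setT (Y : Bor vec -> R) by exact: measurable_funM.
have cY : avg n (fun x => `|Y x|) @[n --> \oo] --> \int[nu]_x `|Y x|.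
  apply: EFin_cvg; have [+ _] := moments a b.
  by rewrite -[X in _ --> X -> _]fineK//; exact: integrable_fin_num.
have cprod : continuous (fun v : vec => v a 0 * v b 0).
  by move=> v; apply: continuousM; apply: coord_continuous.
have cphi (s : R) : continuous (fun v : vec => `|v a 0 * v b 0| + s * (v a 0 * v b 0)).
  move=> v; apply: (@continuousD _ _ _ (fun v : vec => `|v a 0 * v b 0|)).
    by apply: (@continuous_comp _ _ _ (fun v : vec => v a 0 * v b 0) Num.norm);
      [exact: cprod|exact: norm_continuous].
  by apply: continuousM; [exact: cst_continuous|exact: cprod].
have lower (s : R) : `|s| <= 1 -> forall e, 0 < e -> \forall n \near \oo,
    \int[nu]_x `|Y x| + s * \int[nu]_x Y x - e < avg n (fun x => `|Y x| + s * Y x).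
  move=> s1 e e0.
  have isY : nu.-integrable setT (fun x => (s * Y x)%:E).
    by under eq_fun do rewrite EFinM; exact: integrableZl.
  have iE : (\int[nu]_x (`|Y x| + s * Y x)%:E)%E =
      (\int[nu]_x `|Y x| + s * \int[nu]_x Y x)%:E.
    rewrite -RintegralZl// -RintegralD//.
    rewrite /Rintegral fineK//; apply: integrable_fin_num => //.
    by under eq_fun do rewrite EFinD; exact: integrableD.
  apply: fatou_avg.
  - move=> x; have : `|s * Y x| <= `|Y x| by rewrite normrM ler_piMl.
    rewrite ler_norml => /andP[+ _]; lra.
  - by apply: measurable_funD => //; [exact: measurableT_comp|exact: measurable_funM].
  - exact: (ae_cont (cphi s)).
  - by rewrite iE lte_fin gtrBl.
apply/cvgrPdist_le => e e0; have e20 : 0 < e / 2 by rewrite divr_gt0.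
have l1 := lower 1 _ (e / 2) e20; have l2 := lower (-1) _ (e / 2) e20.
have /cvgrPdist_le/(_ (e / 2) e20) l3 := cY.
near=> n.
have h1 : \int[nu]_x `|Y x| + 1 * \int[nu]_x Y x - e / 2 < avg n (fun x => `|Y x| + 1 * Y x).
  by near: n; apply: l1; rewrite normr1.
have h2 : \int[nu]_x `|Y x| + (-1) * \int[nu]_x Y x - e / 2 < avg n (fun x => `|Y x| + (-1) * Y x).
  by near: n; apply: l2; rewrite normrN normr1.
have h3 : `|\int[nu]_x `|Y x| - avg n (fun x => `|Y x|)| <= e / 2 by near: n.
move: h1 h2 h3; rewrite !avgD.
have -> : avg n (fun x => 1 * Y x) = avg n Y by congr (_ * _); apply: eq_bigr => i _; rewrite mul1r.
have -> : avg n (fun x => -1 * Y x) = - avg n Y.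
  by rewrite /avg -mulrN -sumrN; congr (_ * _); apply: eq_bigr => i _; rewrite mulN1r.
rewrite -/Y mul1r mulN1r; exact: squeeze_half.
Unshelve. all: by end_near. Qed.

(** Let [f] be a minorant of [g] bounded by [M], with integral within [e / 4] of that of [g]. A
    single term of the average of [g - f] is at most the whole average, eventually at most [e / 2],
    and [M <= e / 4 * n] for large [n]. *)
Lemma max_vanish e : 0 < e ->
  \forall n \near \oo, forall i : 'I_n, \sum_a (J (h i) a 0) ^+ 2 <= e * n%:R.
Proof.
move=> e0; pose g x := \sum_a (J x a 0) ^+ 2.
have gE x : g x = \sum_a J x a 0 * J x a 0 by apply: eq_bigr => a _; rewrite expr2.
have g0 x : 0 <= g x by apply: sumr_ge0 => a _; exact: sqr_ge0.
have mg : measurable_fun setT (g : Bor vec -> R).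
  by apply: measurable_sum => a; exact: measurable_funX.
pose I := \sum_a \int[nu]_x (J x a 0 * J x a 0).
have Ig : (\int[nu]_x (g x)%:E)%E = I%:E.
  under eq_integral do rewrite gE -sumEFin.
  rewrite integral_sum//; last by move=> a; exact: integrable_JJ.
  rewrite /I -sumEFin; apply: eq_bigr => a _; rewrite fineK//.
  exact: integrable_fin_num (integrable_JJ a a).
have cg : avg n g @[n --> \oo] --> I.
  rewrite (_ : (fun n => avg n g) = fun n => \sum_a avg n (fun x => J x a 0 * J x a 0)).
    by apply: cvgr_sum => a; exact: moment_cvg.
  apply/funext => n; rewrite /avg -mulr_sumr exchange_big/=; congr (_ * _).
have e40 : 0 < e / 4 by rewrite divr_gt0.
have cphi : continuous (fun v : vec => \sum_a (v a 0) ^+ 2).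
  move=> v; apply: (@cvgr_sum _ _ _ (nbhs v) _ _ (fun a (v : vec) => v a 0 ^+ 2)) => a; under eq_fun do rewrite expr2.
  by rewrite expr2; apply: continuousM; apply: coord_continuous.
have [f [bf f0 fg cf]] := @minorant_exists _ _ _ _ g0 B0 nu D (I - e / 4) mg mD DB nuD
  (ae_cont cphi) ltac:(by rewrite Ig lte_fin gtrBl).
have [conf [M fM]] := bf.
have cf' : I - e / 4 < \int[nu]_x f x.
  rewrite -lte_fin (@EFin_bounded_integral _ _ _ nu f M)//.
  exact: continuous_measurable_mx.
have M0 : 0 <= M := le_trans (normr_ge0 (f 0)) (fM 0).
have l1 := cvgr_gt _ (weak_cvg bf) _ cf'.
have /cvgrPdist_le/(_ _ e40) l2 := cg.
near=> n.
have h1 : I - e / 4 < avg n f by near: n; exact: l1.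
have h2 : `|I - avg n g| <= e / 4 by near: n; exact: l2.
have h3 : M <= e / 4 * n%:R.
  rewrite mulrC -ler_pdivrMr//; near: n.
  exact: nbhs_infty_ger.
move=> i; have n0 : (0 < n)%N := leq_ltn_trans (leq0n i) (ltn_ord i).
have n0' : 0 < n%:R :> R by rewrite ltr0n.
have h4 : n%:R^-1 * (g (h i) - f (h i)) <= avg n g - avg n f.
  rewrite -avgB /avg ler_pM2l ?invr_gt0// (bigD1 i)//= lerDl.
  by apply: sumr_ge0 => j _; rewrite subr_ge0 fg.
have h5 : g (h i) - f (h i) <= n%:R * (avg n g - avg n f) by rewrite -ler_pdivrMl.
have h6 : avg n g - avg n f <= e / 2 by move: h1 h2; rewrite ler_norml => h1 /andP[h2 _]; lra.
have h7 := ler_wpM2l (ltW n0') h6.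
have := ler_norm (f (h i)); have := fM (h i); rewrite -/(g (h i)).
move=> h8 h9; nra.
Unshelve. all: by end_near. Qed.

End reference_moments.

(** * Characteristic functions of sums of small independent terms *)

Section trig_bounds.
Context {R : realType}.
Implicit Types x y : R.

Lemma sin_le_id x : 0 <= x -> `|sin x| <= x.
Proof.
move=> x0; have [c _] := @MVT_segment R sin cos 0 x x0 (fun z _ => is_derive_sin z)
  (continuous_subspaceT (@continuous_sin R)).
by rewrite sin0 !subr0 => ->; rewrite normrM (ger0_norm x0) ler_piMl// cos_max.
Qed.

Lemma ler_norm_sin x : `|sin x| <= `|x|.
Proof.
have [x0|x0] := leP 0 x; first by rewrite (ger0_norm x0) sin_le_id.
by rewrite -normrN -sinN -(normrN x) [leRHS]ger0_norm ?sin_le_id// oppr_ge0 ltW.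
Qed.

Lemma cosE_half x : cos x = 1 - 2 * sin (x / 2) ^+ 2.
Proof.
have {1}-> : x = (x / 2) *+ 2 by rewrite -mulr_natr divfK.
by rewrite cos_mulr2n cos2sin2 -mulr_natl; ring.
Qed.

Lemma norm_1Bcos x : `|1 - cos x| <= x ^+ 2 / 2.
Proof.
rewrite cosE_half opprB addrCA subrr addr0 ger0_norm; last by rewrite mulr_ge0 ?sqr_ge0.
have : `|sin (x / 2)| ^+ 2 <= `|x / 2| ^+ 2 by rewrite ler_pXn2r ?nnegrE ?ler_norm_sin.
by rewrite !real_normK ?num_real// exprMn => ?; lra.
Qed.

(** By the mean value theorem [sin x = x * cos c] with [0 <= c <= x], so the quadratic bound on
    [1 - cos c] gives the cubic one, with a non-optimal constant. *)
Lemma sinB_le x : 0 <= x -> `|x - sin x| <= x ^+ 3 / 2.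
Proof.
move=> x0; have [c] := @MVT_segment R sin cos 0 x x0 (fun z _ => is_derive_sin z)
  (continuous_subspaceT (@continuous_sin R)).
rewrite in_itv/= => /andP[c0 cx]; rewrite sin0 !subr0 => ->.
rewrite -{1}[x]mul1r -mulrBl normrM (ger0_norm x0) exprSr mulrAC.
rewrite ler_wpM2r// (le_trans (norm_1Bcos _))// ler_pM2r ?invr_gt0//.
by rewrite ler_pXn2r// nnegrE.
Qed.

Lemma norm_sinB x : `|x - sin x| <= `|x| ^+ 3 / 2.
Proof.
have [x0|x0] := leP 0 x; first by rewrite (ger0_norm x0) sinB_le.
have nx : 0 <= - x by rewrite oppr_ge0 ltW.
have -> : x - sin x = - (- x - sin (- x)) by rewrite sinN; ring.
by rewrite normrN -(normrN x) (ger0_norm nx) sinB_le.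
Qed.

Lemma norm_cos_taylor x : `|cos x - (1 - x ^+ 2 / 2)| <= x ^+ 4 / 8.
Proof.
(* The half-angle formula writes the remainder as twice a difference of squares: one factor is cubic
   in [x / 2], the other at most [|x|]. *)
have -> : cos x - (1 - x ^+ 2 / 2) =
    2 * ((x / 2 - sin (x / 2)) * (x / 2 + sin (x / 2))) by rewrite cosE_half; field.
have h1 := norm_sinB (x / 2).
have h2 : `|x / 2 + sin (x / 2)| <= `|x|.
  rewrite (le_trans (ler_normD _ _))//; have := ler_norm_sin (x / 2).
  rewrite !normrM (@ger0_norm _ 2^-1)// => ?; lra.
rewrite normrM (@ger0_norm _ 2)// normrM.
apply: (@le_trans _ _ (2 * ((`|x / 2| ^+ 3 / 2) * `|x|))).
  by rewrite ler_pM2l// ler_pM.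
rewrite normrM (@ger0_norm _ 2^-1)// exprMn.
have -> : x ^+ 4 = `|x| ^+ 4.
  by rewrite -[in RHS]normrX ger0_norm// (exprM x 2 2) sqr_ge0.
by rewrite le_eqVlt; apply/orP; left; apply/eqP; field.
Qed.

(** From [1 + y <= expR y], the exponential is at most [1 / (1 + y)], and
    [(1 - y + y ^+ 2) * (1 + y) = 1 + y ^+ 3]. *)
Lemma expRN_taylor y : 0 <= y -> `|expR (- y) - (1 - y)| <= y ^+ 2.
Proof.
move=> y0; have h1 := expR_ge1Dx (- y); have h2 := expR_ge1Dx y.
rewrite ger0_norm; last by lra.
have y1 : 0 < 1 + y by lra.
have : expR (- y) <= (1 + y)^-1 by rewrite expRN lef_pV2// posrE ?expR_gt0.
have : (1 + y)^-1 <= 1 - y + y ^+ 2.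
  rewrite -[leLHS]mul1r ler_pdivrMr//.
  have -> : (1 - y + y ^+ 2) * (1 + y) = 1 + y ^+ 3 by ring.
  by rewrite lerDl exprn_ge0.
lra.
Qed.

End trig_bounds.

Section sums_of_independent.
Context {R : realType} d d1 (Omega : measurableType d) (T : measurableType d1)
  (n : nat).
Variables (P : probability Omega R) (m : probability T R).
Variables (Y : 'I_n -> Omega -> T) (y0 : T).
Hypothesis mY : forall i, measurable_fun setT (Y i).
Hypothesis indY : forall A : 'I_n -> set T, (forall i, measurable (A i)) ->
  P [set w | forall i, A i (Y i w)] = (\prod_(i < n) m (A i))%E.
Variables (xi : 'I_n -> T -> R) (delta : R).
Hypothesis mxi : forall i, measurable_fun setT (xi i).
Hypothesis xi_le : forall i y, `|xi i y| <= delta.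
Hypothesis delta_le1 : delta <= 1.
Hypothesis xi0 : forall i, \int[m]_y xi i y = 0.

Local Notation v i := (\int[m]_y (xi i y ^+ 2)).

Definition psum (k : nat) (w : Omega) : R := \sum_(i < n | (i < k)%N) xi i (Y i w).

Let S (k : nat) (t : n.-tuple T) : R := \sum_(i < n | (i < k)%N) xi i (tnth t i).

Let mS k : measurable_fun setT (S k).
Proof.
rewrite /S; under eq_fun do rewrite big_mkcond/=.
apply: measurable_sum => i; case: (i < k)%N => //.
exact: measurableT_comp (mxi i) (measurable_tnth i).
Qed.

Lemma measurable_psum k : measurable_fun setT (psum k).
Proof.
rewrite /psum; under eq_fun do rewrite big_mkcond/=.
apply: measurable_sum => i; case: (i < k)%N => //.
exact: measurableT_comp (mxi i) (mY i).
Qed.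

Lemma psum_le k w : `|psum k w| <= n%:R * delta.
Proof.
have -> : n%:R * delta = \sum_(i < n) delta by rewrite sumr_const card_ord mulr_natl.
rewrite (le_trans (ler_norm_sum _ _ _))// big_mkcond/=.
apply: ler_sum => i _; case: ifP => _; first exact: xi_le.
exact: le_trans (normr_ge0 _) (xi_le i y0).
Qed.

(** The bound on [phi] is asked only on the range of the partial sums, so that squares are covered
    as well as sines and cosines. *)
Lemma Rintegral_psumS (k : 'I_n) (phi : R -> R) (M : R) :
  measurable_fun setT phi ->
  (forall x, `|x| <= n%:R * delta -> `|phi x| <= M) ->
  \int[P]_w phi (psum k.+1 w) = \int[P]_w \int[m]_y phi (psum k w + xi k y).
Proof.
move=> mphi phiM.
have SM j t : `|S j t| <= n%:R * delta.
  have -> : n%:R * delta = \sum_(i < n) delta by rewrite sumr_const card_ord mulr_natl.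
  rewrite (le_trans (ler_norm_sum _ _ _))// big_mkcond/=; apply: ler_sum => i _; case: ifP => _; first exact: xi_le.
  exact: le_trans (normr_ge0 _) (xi_le i y0).
have := @Rintegral_upd _ _ _ _ _ n P (fun=> m) Y y0 mY indY k (phi \o S k.+1) M
  (measurableT_comp mphi (mS k.+1)) (fun t => phiM _ (SM k.+1 t)).
have -> : \int[P]_w (phi \o S k.+1) [tuple Y i w | i < n] = \int[P]_w phi (psum k.+1 w).
  apply: eq_Rintegral => w _ /=; congr phi; apply: eq_bigr => i _.
  by rewrite tnth_mktuple.
move=> ->; apply: eq_Rintegral => w _; apply: eq_Rintegral => y _ /=; congr phi.
rewrite /S (bigD1 k)/= ?ltnSn// tnth_mktuple eqxx addrC; congr (_ + _).
rewrite /psum; apply: eq_big => [i|i /andP[_ /negbTE ik]].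
  by rewrite ltnS ltn_neqAle andbC.
by rewrite tnth_mktuple ik.
Qed.

Let mcos : measurable_fun setT (@cos R).
Proof. by apply: continuous_measurable_fun; exact: continuous_cos. Qed.

Let msin : measurable_fun setT (@sin R).
Proof. by apply: continuous_measurable_fun; exact: continuous_sin. Qed.

Local Notation c i := (\int[m]_y cos (xi i y)).
Local Notation s i := (\int[m]_y sin (xi i y)).

Let icos i : m.-integrable setT (fun y => (cos (xi i y))%:E).
Proof.
by apply: (@bounded_integrable _ _ _ m _ 1) => [|y]; [exact: measurableT_comp|exact: cos_max].
Qed.

Let isin i : m.-integrable setT (fun y => (sin (xi i y))%:E).
Proof.
by apply: (@bounded_integrable _ _ _ m _ 1) => [|y]; [exact: measurableT_comp|exact: sin_max].
Qed.

Let ixi i : m.-integrable setT (fun y => (xi i y)%:E).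
Proof. exact: (@bounded_integrable _ _ _ m _ delta). Qed.

Let ixi2 i : m.-integrable setT (fun y => (xi i y ^+ 2)%:E).
Proof.
apply: (@bounded_integrable _ _ _ m _ (delta ^+ 2)) => [|y]; first exact: measurable_funX.
rewrite normrX ler_pXn2r ?nnegrE//; exact: le_trans (normr_ge0 _) (xi_le i y).
Qed.

Let icosP k : P.-integrable setT (fun w => (cos (psum k w))%:E).
Proof.
apply: (@bounded_integrable _ _ _ P _ 1) => [|y]; last exact: cos_max.
exact: measurableT_comp mcos (measurable_psum k).
Qed.

Let isinP k : P.-integrable setT (fun w => (sin (psum k w))%:E).
Proof.
apply: (@bounded_integrable _ _ _ P _ 1) => [|y]; last exact: sin_max.
exact: measurableT_comp msin (measurable_psum k).
Qed.

Let iZr d' (T' : measurableType d') (mu : probability T' R) (f : T' -> R) (a : R) :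
  mu.-integrable setT (EFin \o f) -> mu.-integrable setT (EFin \o (fun y => f y * a)).
Proof. by move=> fi; rewrite /comp; under eq_fun do rewrite EFinM; exact: integrableZr. Qed.

Let iZl d' (T' : measurableType d') (mu : probability T' R) (f : T' -> R) (a : R) :
  mu.-integrable setT (EFin \o f) -> mu.-integrable setT (EFin \o (fun y => a * f y)).
Proof. by move=> fi; rewrite /comp; under eq_fun do rewrite EFinM; exact: integrableZl. Qed.

(** Real part of the multiplicativity of characteristic functions under independence; the sine lemma
    below is the imaginary part. *)
Lemma Rintegral_cos_psumS (k : 'I_n) : \int[P]_w cos (psum k.+1 w) =
  \int[P]_w cos (psum k w) * c k - \int[P]_w sin (psum k w) * s k.
Proof.
rewrite (@Rintegral_psumS k cos 1)//; last by move=> x _; exact: cos_max.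
transitivity (\int[P]_w (cos (psum k w) * c k - sin (psum k w) * s k)).
  apply: eq_Rintegral => w _; under eq_Rintegral do rewrite cosD.
  by rewrite RintegralB ?RintegralZl//; first [exact: icos|exact: isin|apply: iZl; exact: icos|apply: iZl; exact: isin].
by rewrite RintegralB ?RintegralZr//;
  first [exact: icosP|exact: isinP|apply: iZr; exact: icosP|apply: iZr; exact: isinP].
Qed.

Lemma Rintegral_sin_psumS (k : 'I_n) : \int[P]_w sin (psum k.+1 w) =
  \int[P]_w sin (psum k w) * c k + \int[P]_w cos (psum k w) * s k.
Proof.
rewrite (@Rintegral_psumS k sin 1)//; last by move=> x _; exact: sin_max.
transitivity (\int[P]_w (sin (psum k w) * c k + cos (psum k w) * s k)).
  apply: eq_Rintegral => w _; under eq_Rintegral do rewrite sinD.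
  by rewrite RintegralD ?RintegralZl//; first [exact: icos|exact: isin|apply: iZl; exact: icos|apply: iZl; exact: isin].
by rewrite RintegralD ?RintegralZr//;
  first [exact: icosP|exact: isinP|apply: iZr; exact: icosP|apply: iZr; exact: isinP].
Qed.

Let v_ge0 i : 0 <= v i.
Proof. by apply: Rintegral_ge0 => y _; exact: sqr_ge0. Qed.

Let delta_ge0 (i : 'I_n) : 0 <= delta.
Proof. exact: le_trans (normr_ge0 _) (xi_le i y0). Qed.

Let xi2_le i y : xi i y ^+ 2 <= delta.
Proof.
rewrite -real_normK ?num_real// expr2.
apply: (@le_trans _ _ (delta * 1)); last by rewrite mulr1.
by rewrite ler_pM// (le_trans (xi_le i y)).
Qed.

Let v_le i : v i <= delta.
Proof.
rewrite -[leRHS](Rintegral_probability_cst m); apply: le_Rintegral => //.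
- exact: ixi2.
- exact: (@bounded_integrable _ _ _ m (cst delta) `|delta|).
Qed.

Let norm_Rintegral_le i (f : T -> R) (a : R) : m.-integrable setT (fun y => (f y)%:E) ->
  (forall y, `|f y| <= a * xi i y ^+ 2) -> `|\int[m]_y f y| <= a * v i.
Proof.
move=> fi fa; rewrite -(RintegralZl _ measurableT (ixi2 i)).
apply: le_trans (le_normr_Rintegral measurableT fi) _.
by apply: le_Rintegral => //; [exact: integrable_norm|apply: iZl; exact: ixi2].
Qed.

(** Both sides are compared with [1 - v i / 2]. As [delta <= 1], fourth powers of [xi] are at most
    [delta * xi ^+ 2], which costs [delta / 8]; the exponential costs [delta / 4]. *)
Lemma char_cos_le i : `|c i - expR (- (v i / 2))| <= delta * v i.
Proof.
have i1 : m.-integrable setT (fun=> 1%:E) by exact: (@bounded_integrable _ _ _ m (cst 1) `|1|).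
have i2 : m.-integrable setT (fun y => (1 - xi i y ^+ 2 / 2)%:E).
  under eq_fun do rewrite EFinB.
  by apply: integrableB => //; exact: (iZr 2^-1 (ixi2 i)).
have h1 : `|c i - (1 - v i / 2)| <= delta / 8 * v i.
  have -> : c i - (1 - v i / 2) =
      \int[m]_y (cos (xi i y) - (1 - xi i y ^+ 2 / 2)).
    rewrite (RintegralB measurableT (icos i) i2).
    rewrite (RintegralB measurableT i1 (iZr 2^-1 (ixi2 i))).
    by rewrite Rintegral_probability_cst (RintegralZr _ measurableT (ixi2 i)).
  apply: norm_Rintegral_le => [|y].
    under eq_fun do rewrite EFinB.
    exact: (integrableB measurableT (icos i) i2).
  apply: le_trans (norm_cos_taylor _) _; rewrite (exprM _ 2 2) expr2.
  rewrite mulrAC ler_wpM2r ?sqr_ge0// ler_wpM2r//; exact: xi2_le.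
have v20 : 0 <= v i / 2 by rewrite divr_ge0.
have h2 := expRN_taylor v20.
have h3 : (v i / 2) ^+ 2 <= delta / 4 * v i.
  by rewrite exprMn expr2 -[2^-1 ^+ 2]/(2^-1 * 2^-1); have := ler_wpM2r (v_ge0 i) (v_le i); lra.
rewrite -[_ - _](subrKA (1 - v i / 2)) (le_trans (ler_normD _ _))//.
rewrite (distrC (1 - _)); have := mulr_ge0 (delta_ge0 i) (v_ge0 i); lra.
Qed.

(** Centering allows [xi] to be subtracted under the integral, which leaves a cubic remainder. *)
Lemma char_sin_le i : `|s i| <= delta * v i.
Proof.
have -> : s i = \int[m]_y (sin (xi i y) - xi i y).
  by rewrite (RintegralB measurableT (isin i) (ixi i)) xi0 subr0.
apply: norm_Rintegral_le => [|y].
  under eq_fun do rewrite EFinB.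
  exact: (integrableB measurableT (isin i) (ixi i)).
rewrite distrC (le_trans (norm_sinB _))// exprS real_normK ?num_real//.
have := ler_wpM2r (sqr_ge0 (xi i y)) (xi_le i y).
have := mulr_ge0 (normr_ge0 (xi i y)) (sqr_ge0 (xi i y)); lra.
Qed.

Lemma Rintegral_cos_le1 k : `|\int[P]_w cos (psum k w)| <= 1.
Proof.
apply: le_norm_bounded_Rintegral => [|w]; last exact: cos_max.
exact: measurableT_comp mcos (measurable_psum k).
Qed.

Lemma Rintegral_sin_le1 k : `|\int[P]_w sin (psum k w)| <= 1.
Proof.
apply: le_norm_bounded_Rintegral => [|w]; last exact: sin_max.
exact: measurableT_comp msin (measurable_psum k).
Qed.

Let sumS (k : 'I_n) (f : 'I_n -> R) :
  \sum_(i < n | (i < k.+1)%N) f i = \sum_(i < n | (i < k)%N) f i + f k.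
Proof.
rewrite (bigD1 k)/= ?ltnSn// addrC; congr (_ + _); apply: eq_bigl => i.
by rewrite ltnS ltn_neqAle andbC.
Qed.

Let sum0 (f : 'I_n -> R) : \sum_(i < n | (i < 0)%N) f i = 0.
Proof. by rewrite big1. Qed.

(** Replacing one factor by its Gaussian counterpart adds at most [2 * delta * v] to the cosine
    error and [delta * v] to the sine error, while multiplication by quantities of modulus at most 1
    does not amplify earlier errors. Hence the constant 3. *)
Lemma char_le k : (k <= n)%N ->
  `|\int[P]_w cos (psum k w) - expR (- ((\sum_(i < n | (i < k)%N) v i) / 2))| +
  `|\int[P]_w sin (psum k w)| <= 3 * delta * \sum_(i < n | (i < k)%N) v i.
Proof.
elim: k => [_|k IHk kn].
  rewrite sum0 mul0r oppr0 expR0 mulr0.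
  under eq_Rintegral do rewrite /psum sum0 cos0.
  under [X in _ + `|X|]eq_Rintegral do rewrite /psum sum0 sin0.
  by rewrite !Rintegral_probability_cst subrr normr0 addr0.
have {IHk} := IHk (ltnW kn); rewrite -[k]/(nat_of_ord (Ordinal kn)); set j := Ordinal kn.
rewrite Rintegral_cos_psumS Rintegral_sin_psumS !sumS.
set C := \int[P]_w cos _; set D := \int[P]_w sin _; set V := \sum_(i < n | _) _.
set E := expR (- (V / 2)); pose e := expR (- (v j / 2)).
have -> : expR (- ((V + v j) / 2)) = E * e by rewrite -expRD; congr expR; ring.
move=> IH; have c1 : `|c j| <= 1.
  by apply: le_norm_bounded_Rintegral => [|y]; [exact: measurableT_comp|exact: cos_max].
have V0 : 0 <= V by exact: sumr_ge0.
have E01 : 0 <= E <= 1.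
  rewrite expR_ge0/= -expR0 ler_expR; lra.
have D1 : `|D| <= 1 by exact: Rintegral_sin_le1.
have C1 : `|C| <= 1 by exact: Rintegral_cos_le1.
have hc := char_cos_le j; have hs := char_sin_le j; rewrite -/e in hc.
have s1 : 0 <= `|s j| by [].
have h1 : `|C * c j - D * s j - E * e| <= `|C - E| + delta * v j + delta * v j.
  have -> : C * c j - D * s j - E * e = (C - E) * c j + E * (c j - e) - D * s j by ring.
  rewrite (le_trans (ler_normB _ _))// (lerD (le_trans (ler_normD _ _) (lerD _ _)))//.
  - by rewrite normrM ler_piMr.
  - case/andP: E01 => E0 E1; rewrite normrM (ger0_norm E0) (le_trans _ hc)// ler_piMl//.
  - by rewrite normrM (le_trans _ hs)// ler_piMl.
have h2 : `|D * c j + C * s j| <= `|D| + delta * v j.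
  rewrite (le_trans (ler_normD _ _))// lerD//; first by rewrite normrM ler_piMr.
  by rewrite normrM (le_trans _ hs)// ler_piMl.
rewrite mulrDr; lra.
Qed.

Lemma Rintegral_sqr_psum k : (k <= n)%N ->
  \int[P]_w (psum k w ^+ 2) = \sum_(i < n | (i < k)%N) v i.
Proof.
elim: k => [_|k IHk kn].
  under eq_Rintegral do rewrite /psum sum0 expr0n/=.
  by rewrite Rintegral_probability_cst sum0.
have {IHk} := IHk (ltnW kn); rewrite -[k]/(nat_of_ord (Ordinal kn)); set j := Ordinal kn.
rewrite sumS => <-.
rewrite (@Rintegral_psumS j (fun x => x ^+ 2) ((n%:R * delta) ^+ 2)).
- transitivity (\int[P]_w (psum j w ^+ 2 + v j)).
    apply: eq_Rintegral => w _; set a := psum j w.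
    have i1 : m.-integrable setT (EFin \o (fun y => 2 * a * xi j y)).
      by apply: iZl; exact: ixi.
    have ia : m.-integrable setT (EFin \o cst (a ^+ 2)).
      exact: (@bounded_integrable _ _ _ m (cst (a ^+ 2)) `|a ^+ 2|).
    have i2 : m.-integrable setT (EFin \o (fun y => 2 * a * xi j y + xi j y ^+ 2)).
      rewrite /comp; under eq_fun do rewrite EFinD.
      exact: (integrableD measurableT i1 (ixi2 j)).
    transitivity (\int[m]_y (a ^+ 2 + (2 * a * xi j y + xi j y ^+ 2))).
      by apply: eq_Rintegral => y _; ring.
    rewrite (RintegralD measurableT ia i2) Rintegral_probability_cst.
    rewrite (RintegralD measurableT i1 (ixi2 j)) (RintegralZl _ measurableT (ixi j)).
    by rewrite xi0 mulr0 add0r.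
  have ip : P.-integrable setT (EFin \o (fun w => psum j w ^+ 2)).
    apply: (@bounded_integrable _ _ _ P _ ((n%:R * delta) ^+ 2)) => [|w].
      exact/measurable_funX/measurable_psum.
    by rewrite normrX ler_pXn2r ?nnegrE ?mulr_ge0 ?(delta_ge0 j)// psum_le.
  have iv : P.-integrable setT (EFin \o cst (v j)).
    exact: (@bounded_integrable _ _ _ P (cst (v j)) `|v j|).
  by rewrite (RintegralD measurableT ip iv) Rintegral_probability_cst.
- exact: exprn_measurable.
- by move=> x xB; rewrite normrX ler_pXn2r ?nnegrE ?mulr_ge0 ?(delta_ge0 j).
Qed.

End sums_of_independent.

(** * Convergence in law from characteristic functions *)

Section uniform_continuity.
Context {R : realType} {p : nat}.
Local Notation vec := 'cV[R]_p.

Lemma compact_cube (L : R) : compact [set x : vec | forall k, `|x k 0| <= L].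
Proof.
have -> : [set x : vec | forall k, `|x k 0| <= L] =
    (fun x : 'rV[R]_p => x^T) @` [set x : 'rV[R]_p | forall k, `[- L, L]%classic (x 0 k)].
  apply/seteqP; split=> [x xL|_ [x xL <-] k].
    exists x^T; last by rewrite trmxK.
    by move=> k /=; rewrite mxE in_itv/= -ler_norml.
  by rewrite mxE ler_norml; have := xL k; rewrite /= in_itv.
apply: continuous_compact; last first.
  by apply: (@rV_compact _ _ (fun=> `[- L, L]%classic)) => k; exact: segment_compact.
apply: continuous_subspaceT; apply: (@lipschitz_continuous _ _ _ _ 1) => x y.
rewrite mul1r -raddfB/= [leLHS]/Num.norm/= mx_normrE.
apply/bigmax_leP; split=> // -[i j] _ /=; rewrite mxE; exact: ler_coord_norm.
Qed.

Lemma compact_uniform_continuity (K : set vec) (f : vec -> R) (e : R) :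
  compact K -> continuous f -> 0 < e ->
  exists2 r : R, 0 < r & forall x z : vec, K x ->
    (forall k, `|x k 0 - z k 0| < r) -> `|f x - f z| <= e.
Proof.
move=> /compact_near_coveringP cK cf e0.
have nc : \forall r \near (0 : R)^'+,
    K `<=` (fun x => forall z, ball x r z -> `|f x - f z| <= e).
  apply: cK => x Kx.
  have e20 : 0 < e / 2 by rewrite divr_gt0.
  have /cvgrPdist_lt/(_ _ e20)/nbhs_ballP[r /= r0 xr] := cf x.
  have r20 : 0 < r / 2 by rewrite divr_gt0.
  exists (ball x (r / 2), [set s | s < r / 2]) => /=.
    by split; [exact: nbhsx_ballx|exact: nbhs_right_lt].
  move=> [y s] /= [xy sr] z yz.
  have fy : `|f x - f y| < e / 2 by apply: xr; apply: le_ball xy; lra.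
  have fz : `|f x - f z| < e / 2.
    apply: xr; rewrite (splitr r); apply: ball_triangle xy _.
    by apply: le_ball yz; exact: ltW.
  rewrite (le_trans (ler_distD (f x) _ _))// distrC (splitr e).
  by rewrite lerD ?ltW.
have [r [r0 rK]] : exists r : R, 0 < r /\
    K `<=` (fun x => forall z, ball x r z -> `|f x - f z| <= e).
  near (0 : R)^'+ => r; exists r; split; first by near: r; exact: nbhs_right_gt.
  by near: r; exact: nc.
exists r => // x z Kx xz; apply: (rK _ Kx); split=> // k j.
by rewrite ord1; exact: xz.
Unshelve. all: by end_near. Qed.

End uniform_continuity.

(** * Trigonometric polynomials and their density on cubes *)

Section trig_polynomials.
Context {R : realType} {p : nat}.
Local Notation vec := 'cV[R]_p.

Inductive trig : (vec -> R) -> Prop :=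
| trig_cos t : trig (fun x => cos (dotv t x))
| trig_sin t : trig (fun x => sin (dotv t x))
| trig_add f g : trig f -> trig g -> trig (fun x => f x + g x)
| trig_scale (a : R) f : trig f -> trig (fun x => a * f x).

Lemma trig_ext f g : f =1 g -> trig f -> trig g.
Proof. by move=> /funext ->. Qed.

Lemma trig_cst (a : R) : trig (fun=> a).
Proof.
apply: trig_ext (trig_scale a (trig_cos 0)) => x.
by rewrite /dotv trmx0 mul0mx mxE cos0 mulr1.
Qed.

(** Product-to-sum formulas treat pairs of generators, and bilinearity the rest. Closure under
    products lets Bernstein polynomials in sines be trigonometric. *)
Lemma trig_mul f g : trig f -> trig g -> trig (fun x => f x * g x).
Proof.
have cc (t u : vec) : trig (fun x => cos (dotv t x) * cos (dotv u x)).
  apply: trig_ext (trig_scale 2^-1 (trig_add (trig_cos (t - u)) (trig_cos (t + u)))) => x.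
  by rewrite dotvBl dotvDl cosB cosD; field.
have ss (t u : vec) : trig (fun x => sin (dotv t x) * sin (dotv u x)).
  apply: trig_ext (trig_scale 2^-1 (trig_add (trig_cos (t - u))
    (trig_scale (-1) (trig_cos (t + u))))) => x.
  by rewrite dotvBl dotvDl cosB cosD; field.
have sc (t u : vec) : trig (fun x => sin (dotv t x) * cos (dotv u x)).
  apply: trig_ext (trig_scale 2^-1 (trig_add (trig_sin (t - u)) (trig_sin (t + u)))) => x.
  by rewrite dotvBl dotvDl sinB sinD; field.
move=> tf; elim: tf g => {f} [t|t|f1 f2 _ IH1 _ IH2|a f _ IH] g tg.
- elim: tg => {g} [u|u|g1 g2 _ IH1 _ IH2|a g _ IH].
  + exact: cc.
  + by apply: trig_ext (sc u t) => x; rewrite mulrC.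
  + by apply: trig_ext (trig_add IH1 IH2) => x; rewrite mulrDr.
  + by apply: trig_ext (trig_scale a IH) => x; rewrite mulrCA.
- elim: tg => {g} [u|u|g1 g2 _ IH1 _ IH2|a g _ IH].
  + exact: sc.
  + exact: ss.
  + by apply: trig_ext (trig_add IH1 IH2) => x; rewrite mulrDr.
  + by apply: trig_ext (trig_scale a IH) => x; rewrite mulrCA.
- by apply: trig_ext (trig_add (IH1 _ tg) (IH2 _ tg)) => x; rewrite mulrDl.
- by apply: trig_ext (trig_scale a (IH _ tg)) => x; rewrite mulrA.
Qed.

Lemma trig_sum (I : Type) (r : seq I) (F : I -> vec -> R) :
  (forall i, trig (F i)) -> trig (fun x => \sum_(i <- r) F i x).
Proof.
move=> tF; elim: r => [|i r IHr].
  by apply: trig_ext (trig_cst 0) => x; rewrite big_nil.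
by apply: trig_ext (trig_add (tF i) IHr) => x; rewrite big_cons.
Qed.

Lemma trig_prod (I : Type) (r : seq I) (F : I -> vec -> R) :
  (forall i, trig (F i)) -> trig (fun x => \prod_(i <- r) F i x).
Proof.
move=> tF; elim: r => [|i r IHr].
  by apply: trig_ext (trig_cst 1) => x; rewrite big_nil.
by apply: trig_ext (trig_mul (tF i) IHr) => x; rewrite big_cons.
Qed.

Lemma trig_continuous f : trig f -> continuous f.
Proof.
have cd (t : vec) : continuous (dotv t).
  apply: (@lipschitz_continuous _ _ _ _ (\sum_k `|t k 0|)) => x y.
  rewrite -dotvBr dotvE (le_trans (ler_norm_sum _ _ _))// mulr_suml.
  by apply: ler_sum => k _; rewrite normrM ler_wpM2l// ler_coord_norm.
elim=> {f} [t|t|f g _ cf _ cg|a f _ cf] x.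
- by apply: continuous_comp; [exact: cd|exact: continuous_cos].
- by apply: continuous_comp; [exact: cd|exact: continuous_sin].
- by apply: continuousD; [exact: cf|exact: cg].
- by apply: continuousM; [exact: cst_continuous|exact: cf].
Qed.

Lemma trig_bounded f : trig f -> exists M, forall x, `|f x| <= M.
Proof.
elim=> {f} [t|t|f g _ [M fM] _ [N gN]|a f _ [M fM]].
- by exists 1 => x; exact: cos_max.
- by exists 1 => x; exact: sin_max.
- by exists (M + N) => x; rewrite (le_trans (ler_normD _ _))// lerD.
- by exists (`|a| * M) => x; rewrite normrM ler_wpM2l.
Qed.

End trig_polynomials.

Section bernstein.
Context {R : realType}.

(* The probability of [j] successes in [m] trials of probability [y]. *)
Fixpoint bern (m : nat) (y : R) (j : nat) : R :=
  if m is m'.+1 then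
    y * (if j is j'.+1 then bern m' y j' else 0) + (1 - y) * bern m' y j
  else (j == 0%N)%:R.

Lemma bern_ge0 m y j : 0 <= y <= 1 -> 0 <= bern m y j.
Proof.
move=> /andP[y0 y1]; elim: m j => [|m IHm] j /=; first by case: (j == 0%N).
rewrite addr_ge0// mulr_ge0// ?subr_ge0//; by case: j.
Qed.

Lemma bern_gt m y j : (m < j)%N -> bern m y j = 0.
Proof.
elim: m j => [|m IHm] [|j]//= mj.
by rewrite !IHm ?mulr0 ?addr0// ltnW.
Qed.

Lemma sum_bernS m y (f : nat -> R) : \sum_(j < m.+2) bern m.+1 y j * f j =
  y * (\sum_(j < m.+1) bern m y j * f j.+1) + (1 - y) * \sum_(j < m.+1) bern m y j * f j.
Proof.
under eq_bigr do rewrite /= mulrDl; rewrite big_split/=; congr (_ + _).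
  rewrite big_ord_recl/= mulr0 mul0r add0r mulr_sumr.
  by apply: eq_bigr => i _; rewrite mulrA.
rewrite big_ord_recr/= bern_gt// mulr0 mul0r addr0 mulr_sumr.
by apply: eq_bigr => i _; rewrite mulrA.
Qed.

Lemma sum_bern m y : \sum_(j < m.+1) bern m y j = 1.
Proof.
suff : \sum_(j < m.+1) bern m y j * 1 = 1.
  by move=> H; rewrite -[RHS]H; apply: eq_bigr => j _; rewrite mulr1.
elim: m => [|m IHm]; first by rewrite big_ord_recl big_ord0 /= mulr1 addr0.
by rewrite (sum_bernS m y (fun=> 1)) IHm; ring.
Qed.

(** The centre [c] is arbitrary because the recursion shifts [j] by one, which turns [c] into
    [c - 1]. *)
Lemma bern_variance m y c : \sum_(j < m.+1) bern m y j * (j%:R - c) ^+ 2 =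
  m%:R * (y * (1 - y)) + (m%:R * y - c) ^+ 2.
Proof.
elim: m c => [|m IHm] c.
  by rewrite big_ord_recl big_ord0 /= addr0 !mul0r !sub0r mul1r add0r.
rewrite (sum_bernS m y (fun j => (j%:R - c) ^+ 2)) IHm.
have -> : \sum_(j < m.+1) bern m y j * (j.+1%:R - c) ^+ 2 =
    \sum_(j < m.+1) bern m y j * (j%:R - (c - 1)) ^+ 2.
  by apply: eq_bigr => j _; rewrite -natr1; congr (_ * _ ^+ 2); ring.
by rewrite IHm -natr1; ring.
Qed.

End bernstein.

Section trigonometric_approximation.
Context {R : realType} {p : nat}.
Local Notation vec := 'cV[R]_p.

Section weights.
Variables (m : nat) (y : 'I_p -> R).
Hypothesis y01 : forall k, 0 <= y k <= 1.
Implicit Types j : {ffun 'I_p -> 'I_m.+1}.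

(** Law of [p] independent binomial counts with success probabilities [y k]. *)
Definition bern_weight j : R := \prod_k bern m (y k) (j k).

Lemma bern_weight_ge0 j : 0 <= bern_weight j.
Proof. by apply: prodr_ge0 => k _; exact: bern_ge0. Qed.

Lemma sum_bern_weight : \sum_j bern_weight j = 1.
Proof.
rewrite -(bigA_distr_bigA (fun k (i : 'I_m.+1) => bern m (y k) i)).
by rewrite big1// => k _; exact: sum_bern.
Qed.

Lemma bern_weight_variance l :
  \sum_j bern_weight j * ((j l)%:R - m%:R * y l) ^+ 2 = m%:R * (y l * (1 - y l)).
Proof.
pose g k (i : 'I_m.+1) := if k == l then (i%:R - m%:R * y l) ^+ 2 else 1 : R.
transitivity (\sum_(j : {ffun 'I_p -> 'I_m.+1}) \prod_k (bern m (y k) (j k) * g k (j k))).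
  apply: eq_bigr => j _; rewrite big_split/=; congr (_ * _).
  rewrite (bigD1 l)//= /g eqxx big1 ?mulr1// => k /negbTE ->; exact: erefl.
rewrite -(bigA_distr_bigA (fun k (i : 'I_m.+1) => bern m (y k) i * g k i)).
rewrite (bigD1 l)//= [X in _ * X]big1 ?mulr1 => [|k /negbTE kl].
  under eq_bigr do rewrite /g eqxx.
  by rewrite bern_variance subrr expr0n addr0.
by under eq_bigr do rewrite /g kl mulr1; exact: sum_bern.
Qed.

End weights.

Variables (f : vec -> R) (M : R).
Hypotheses (cf : continuous f) (fM : forall x, `|f x| <= M).

(* Bernstein polynomials in [halfsin] are trigonometric; for [L] large,
   [2 * halfsin - 1] is close to [x / L] on the cube of size [K]. *)
Let halfsin (L : R) (x : vec) (k : 'I_p) := (1 + sin (L^-1 * x k 0)) / 2.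

Let halfsin01 L x k : 0 <= halfsin L x k <= 1.
Proof.
have := sin_max (L^-1 * x k 0); rewrite ler_norml => /andP[h1 h2].
by rewrite /halfsin; apply/andP; split; lra.
Qed.

Let node (L : R) (m : nat) (j : {ffun 'I_p -> 'I_m.+1}) : vec :=
  \col_k (L * (2 * (j k)%:R / m%:R - 1)).

Let bern_op L m x : R := \sum_(j : {ffun 'I_p -> 'I_m.+1}) bern_weight (halfsin L x) j * f (node L j).

Let trig_bern_op L m : trig (bern_op L m).
Proof.
apply: trig_sum => j.
apply: (@trig_ext _ _ (fun x => f (node L j) * bern_weight (halfsin L x) j)).
  by move=> x; rewrite mulrC.
apply: trig_scale; apply: trig_prod => k.
have ty : trig (fun x => halfsin L x k).
  apply: trig_ext (trig_add (trig_cst 2^-1)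
    (trig_scale 2^-1 (trig_sin (L^-1 *: delta_mx k 0)))) => x.
  by rewrite dotvZl dotv_deltal /halfsin; ring.
have t1y : trig (fun x => 1 - halfsin L x k).
  by apply: trig_ext (trig_add (trig_cst 1) (trig_scale (-1) ty)) => x; ring.
move: (nat_of_ord (j k)) => {j} i; elim: m i => [|m IHm] i /=; first exact: trig_cst.
apply: trig_add; last by apply: trig_mul.
by apply: trig_mul => //; case: i => [|i]; [exact: trig_cst|exact: IHm].
Qed.

Let bern_op_le L m x : `|bern_op L m x| <= M.
Proof.
rewrite (le_trans (ler_norm_sum _ _ _))//.
rewrite -[M]mul1r -(sum_bern_weight m (halfsin L x)) mulr_suml; apply: ler_sum => j _.
rewrite normrM ger0_norm ?bern_weight_ge0// ler_wpM2l// bern_weight_ge0//.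
Qed.

Lemma trig_approximation (K e : R) : 0 < K -> 0 < e -> exists T : vec -> R, [/\ trig T,
  (forall x, `|T x| <= M) &
  forall x : vec, (forall k, `|x k 0| <= K) -> `|f x - T x| <= e].
Proof.
move=> K0 e0; have e30 : 0 < e / 3 by rewrite divr_gt0.
have M0 : 0 <= M := le_trans (normr_ge0 (f 0)) (fM 0).
have [r1 r10 fr1] := compact_uniform_continuity (@compact_cube R p K) cf e30.
(* On the cube, [x - L * sin (x / L)] is at most [K ^+ 3 / (2 * L ^+ 2)] in each coordinate, which
   is below [r1] for this [L]. *)
pose L := K ^+ 3 / r1 + 1.
have KL0 : 0 < K ^+ 3 / r1 by rewrite divr_gt0 ?exprn_gt0.
have L1 : 1 <= L by rewrite /L; lra.
have L0 : 0 < L by lra.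
have [r2 r20 fr2] := compact_uniform_continuity (@compact_cube R p L) cf e30.
(* Chebyshev constant: at nodes at least [r2] away in some coordinate, the trivial bound [2 * M] is
   at most [C] times the squared distance. *)
pose C := 2 * M / r2 ^+ 2.
have C0 : 0 <= C by apply: divr_ge0; [exact: mulr_ge0|exact: sqr_ge0].
(* A node coordinate is a binomial count scaled by [2 * L / m], of variance at most
   [4 * L ^+ 2 / m]; so [A / m] bounds the mean Chebyshev term. *)
pose A := C * (p%:R * (4 * L ^+ 2)).
have A0 : 0 <= A.
  by apply: mulr_ge0 => //; apply: mulr_ge0 => //; apply: mulr_ge0 => //; exact: sqr_ge0.
pose m := (Num.truncn (A / (e / 3))).+1.
have m0 : 0 < m%:R :> R by rewrite ltr0n.
have Am : A / m%:R <= e / 3.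
  by rewrite ler_pdivrMr// mulrC -ler_pdivrMr// ltW// truncnS_gt.
exists (bern_op L m); split=> [||x xK]; [exact: trig_bern_op|exact: bern_op_le|].
pose z : vec := \col_k (L * sin (L^-1 * x k 0)).
have h1 : `|f x - f z| <= e / 3.
  apply: fr1 => // k; rewrite mxE.
  have -> : x k 0 - L * sin (L^-1 * x k 0) =
      L * (L^-1 * x k 0 - sin (L^-1 * x k 0)) by field; rewrite gt_eqF.
  rewrite normrM (gtr0_norm L0) -ltr_pdivlMl// (le_lt_trans (norm_sinB _))//.
  have Li0 : 0 < L^-1 by rewrite invr_gt0.
  have Li1 : L^-1 <= 1 by rewrite invf_le1.
  have K3 : L^-1 * K ^+ 3 < r1 by rewrite ltr_pdivrMl// mulrDl divfK ?gt_eqF// mul1r ltrDl.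
  have xK3 : `|x k 0| ^+ 3 <= K ^+ 3 by rewrite ler_pXn2r ?nnegrE// ltW.
  have X0 : 0 <= `|x k 0| ^+ 3 by rewrite exprn_ge0.
  rewrite normrM (gtr0_norm Li0) exprMn.
  have -> : (L^-1) ^+ 3 * `|x k 0| ^+ 3 / 2 =
    L^-1 * (L^-1 * (L^-1 * `|x k 0| ^+ 3 / 2)) by ring.
  rewrite ltr_pM2l//; apply: le_lt_trans K3; rewrite ler_pM2l//.
  apply: le_trans xK3; have := ler_wpM2r X0 Li1; lra.
have zL k : `|z k 0| <= L.
  by rewrite mxE normrM (gtr0_norm L0) ler_piMr ?sin_max// ltW.
have pw (j : {ffun 'I_p -> 'I_m.+1}) : `|f z - f (node L j)| <= e / 3 + C * \sum_k (z k 0 - node L j k 0) ^+ 2.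
  have s0 : 0 <= \sum_k (z k 0 - node L j k 0) ^+ 2.
    by apply: sumr_ge0 => k _; exact: sqr_ge0.
  have [H|/existsNP[k /negP]] := pselect (forall k, `|z k 0 - node L j k 0| < r2).
    by apply: le_trans (fr2 _ _ zL H) _; rewrite lerDl mulr_ge0.
  rewrite -leNgt => r2k; apply: (@le_trans _ _ (2 * M)).
    rewrite (le_trans (ler_normB _ _))//; have := fM z; have := fM (node L j); lra.
  have -> : 2 * M = C * r2 ^+ 2 by rewrite /C divfK// expf_neq0// gt_eqF.
  rewrite ler_wpDl ?(ltW e30)// ler_wpM2l// (bigD1 k)//=.
  rewrite ler_wpDr ?sumr_ge0// => [i _|]; first exact: sqr_ge0.
  by rewrite -[leRHS]real_normK ?num_real// ler_pXn2r ?nnegrE// ltW.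
have h2 : `|f z - bern_op L m x| <= e / 3 + A / m%:R.
  have -> : f z - bern_op L m x = \sum_(j : {ffun 'I_p -> 'I_m.+1}) bern_weight (halfsin L x) j * (f z - f (node L j)).
    under [RHS]eq_bigr do rewrite mulrBr.
    by rewrite sumrB -mulr_suml sum_bern_weight mul1r.
  rewrite (le_trans (ler_norm_sum _ _ _))//.
  apply: (@le_trans _ _ (\sum_(j : {ffun 'I_p -> 'I_m.+1}) bern_weight (halfsin L x) j *
      (e / 3 + C * \sum_k (z k 0 - node L j k 0) ^+ 2))).
    apply: ler_sum => j _; rewrite normrM ger0_norm ?bern_weight_ge0//.
    by apply: ler_wpM2l; [exact: bern_weight_ge0|exact: pw].
  under eq_bigr do rewrite mulrDr.
  rewrite big_split/= -mulr_suml sum_bern_weight mul1r lerD2l.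
  under eq_bigr do rewrite mulrCA mulr_sumr.
  rewrite -mulr_sumr exchange_big/= /A -mulrA ler_wpM2l//.
  have -> : p%:R * (4 * L ^+ 2) / m%:R = \sum_(k < p) (4 * L ^+ 2 / m%:R).
    by rewrite sumr_const card_ord -[RHS]mulr_natl; ring.
  apply: ler_sum => k _.
  have -> : \sum_(j : {ffun 'I_p -> 'I_m.+1}) bern_weight (halfsin L x) j * (z k 0 - node L j k 0) ^+ 2 =
      4 * L ^+ 2 / m%:R ^+ 2 * (m%:R * (halfsin L x k * (1 - halfsin L x k))).
    rewrite -bern_weight_variance mulr_sumr; apply: eq_bigr => j _.
    by rewrite !mxE /halfsin; field; rewrite gt_eqF.
  have -> : 4 * L ^+ 2 / m%:R ^+ 2 * (m%:R * (halfsin L x k * (1 - halfsin L x k))) =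
      4 * L ^+ 2 / m%:R * (halfsin L x k * (1 - halfsin L x k)) by field; rewrite gt_eqF.
  rewrite ler_piMr//; first by rewrite divr_ge0 ?mulr_ge0 ?exprn_ge0 ?(ltW L0).
  by have /andP[h3 h4] := halfsin01 L x k; nra.
rewrite (le_trans (ler_distD (f z) _ _))//.
have -> : e = e / 3 + (e / 3 + e / 3) by field.
by rewrite lerD// (le_trans h2)// lerD2l.
Qed.

End trigonometric_approximation.

(** * Continuity theorem under bounded second moments *)

Section levy.
Context {R : realType} {p : nat} d (Omega : measurableType d)
  (P : probability Omega R).
Local Notation vec := 'cV[R]_p.
Variables (W : nat -> Omega -> Bor vec) (gamma : probability (Bor vec) R) (c : R).
Hypothesis mW : forall n, measurable_fun setT (W n).
Hypothesis W2 : \forall n \near \oo, forall k,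
  (\int[P]_w ((W n w : vec) k 0 ^+ 2)%:E <= c%:E)%E.
Hypothesis Wcos : forall t : vec,
  \int[P]_w cos (dotv t (W n w)) @[n --> \oo] --> \int[gamma]_x cos (dotv t x).
Hypothesis Wsin : forall t : vec,
  \int[P]_w sin (dotv t (W n w)) @[n --> \oo] --> \int[gamma]_x sin (dotv t x).

Let icomp n (f : vec -> R) (M : R) : continuous f -> (forall x, `|f x| <= M) ->
  P.-integrable setT (EFin \o (fun w => f (W n w))).
Proof.
move=> cf fM; apply: (@bounded_integrable _ _ _ P _ M) => // .
exact: (measurableT_comp (continuous_measurable_mx cf) (mW n)).
Qed.

Let igam (f : vec -> R) (M : R) : continuous f -> (forall x, `|f x| <= M) ->
  gamma.-integrable setT (EFin \o f).
Proof.
move=> cf fM; apply: (@bounded_integrable _ _ _ gamma _ M) => // .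
exact: continuous_measurable_mx.
Qed.

Lemma trig_cvg T : trig T ->
  \int[P]_w T (W n w) @[n --> \oo] --> \int[gamma]_x T x.
Proof.
elim=> {T} [t|t|f g tf cf tg cg|a f tf cf]; [exact: Wcos|exact: Wsin| |].
- have [M fM] := trig_bounded tf; have [N gN] := trig_bounded tg.
  have Cf := trig_continuous tf; have Cg := trig_continuous tg.
  rewrite (RintegralD measurableT (igam Cf fM) (igam Cg gN)).
  under eq_fun do rewrite (RintegralD measurableT (icomp _ Cf fM) (icomp _ Cg gN)).
  exact: cvgD.
- have [M fM] := trig_bounded tf; have Cf := trig_continuous tf.
  rewrite (RintegralZl _ measurableT (igam Cf fM)).
  under eq_fun do rewrite (RintegralZl _ measurableT (icomp _ Cf fM)).
  exact: cvgMr.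
Qed.

(** Continuous majorant of the indicator of the outside of a cube. The quadratic branch is
    controlled by second moments of [W n]; the cap at 1 makes it integrable under [gamma] without
    any moment. *)
Definition tail (K : R) (x : vec) : R := Num.min 1 (K^-1 * \sum_k x k 0 ^+ 2).

Lemma tail_ge0 K x : 0 <= K -> 0 <= tail K x.
Proof.
move=> K0; rewrite le_min ler01/= mulr_ge0 ?invr_ge0//.
by apply: sumr_ge0 => k _; exact: sqr_ge0.
Qed.

Lemma tail_norm K x : 0 <= K -> `|tail K x| <= 1.
Proof. by move=> K0; rewrite ger0_norm ?tail_ge0// ge_min lexx. Qed.

Lemma tail_ge1 (K : R) (x : vec) k : 0 < K -> K < `|x k 0| -> 1 <= tail (K ^+ 2) x.
Proof.
move=> K0 Kx; rewrite le_min lexx/= ler_pdivlMl ?exprn_gt0// mulr1 (bigD1 k)//=.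
rewrite ler_wpDr//; first by apply: sumr_ge0 => i _; exact: sqr_ge0.
by rewrite -[leRHS]real_normK ?num_real// ler_pXn2r ?nnegrE// ltW.
Qed.

Lemma measurable_tail K : measurable_fun setT (tail K : Bor vec -> R).
Proof.
apply: measurable_minr => //; apply: measurable_funM => //.
by apply: measurable_sum => k; apply: measurable_funX; exact: measurable_coord.
Qed.

Let itailP n K : 0 <= K -> P.-integrable setT (EFin \o (fun w => tail K (W n w))).
Proof.
move=> K0; apply: (@bounded_integrable _ _ _ P _ 1) => [|w]; last exact: tail_norm.
exact: measurableT_comp (measurable_tail K) (mW n).
Qed.

Let itailG K : 0 <= K -> gamma.-integrable setT (EFin \o tail K).
Proof.
move=> K0; apply: (@bounded_integrable _ _ _ gamma _ 1) => [|w]; last exact: tail_norm.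
exact: measurable_tail.
Qed.

Lemma tail_cvg0 : \int[gamma]_x tail (k.+1%:R ^+ 2) x @[k --> \oo] --> (0 : R).
Proof.
have [] := @dominated_convergence _ _ R gamma setT measurableT
  (fun k x => (tail (k.+1%:R ^+ 2) x)%:E) (cst 0%E) (cst 1%E).
- by move=> k; apply/measurable_EFinP; exact: measurable_tail.
- exact: measurable_cst.
- apply: aeW => x _; apply/cvg_EFin; first exact: nearW.
  pose s := \sum_k x k 0 ^+ 2.
  have s0 : 0 <= s by apply: sumr_ge0 => k _; exact: sqr_ge0.
  apply: (@squeeze_cvgr _ _ _ _ (cst 0) (fun k => harmonic k * s)).
  - apply: nearW => k /=; rewrite tail_ge0 ?exprn_ge0//= ge_min; apply/orP; right.
    rewrite ler_wpM2r// lef_pV2 ?posrE ?exprn_gt0// expr2 ler_peMr//.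
    by rewrite ler1n.
  - exact: cvg_cst.
  - by rewrite -(mul0r s); apply: cvgMl; exact: cvg_harmonic.
- exact: (@bounded_integrable _ _ _ gamma (cst 1) `|1|).
- by apply: aeW => x k _; rewrite lee_fin tail_norm ?exprn_ge0.
move=> _ _; rewrite integral0 => H.
by have /fine_cvgP[_] := H.
Qed.

Lemma tail_W (K : R) : 0 < K ->
  \forall n \near \oo, \int[P]_w tail K (W n w) <= K^-1 * (p%:R * c).
Proof.
move=> K0; near=> n.
have W2n : forall k, (\int[P]_w ((W n w : vec) k 0 ^+ 2)%:E <= c%:E)%E.
  by near: n; exact: W2.
have mk k : measurable_fun setT (fun w => (W n w : vec) k 0).
  exact: measurable_fun_coord.
have mS : measurable_fun setT (fun w => \sum_k ((W n w : vec) k 0 ^+ 2)%:E)%E.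
  by apply: emeasurable_sum => k; apply/measurable_EFinP; exact: measurable_funX.
rewrite -lee_fin fineK; last exact: integrable_fin_num (itailP n (ltW K0)).
apply: (@le_trans _ _ (\int[P]_w (K^-1%:E * \sum_k ((W n w : vec) k 0 ^+ 2)%:E))%E).
  apply: ge0_le_integral => //.
  - by move=> w _; rewrite lee_fin tail_ge0// ltW.
  - apply/measurable_EFinP.
    exact: measurableT_comp (measurable_tail K) (mW n).
  - exact: measurable_funeM.
  - by move=> w _; rewrite sumEFin -EFinM lee_fin ge_min lexx orbT.
rewrite ge0_integralZl_EFin//; last 2 first.
- by move=> w _; apply: sume_ge0 => k _; rewrite lee_fin sqr_ge0.
- by rewrite invr_ge0 ltW.
rewrite ge0_integral_sum//.
- rewrite EFinM lee_pmul2l ?lte_fin ?invr_gt0//.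
  apply: le_trans (lee_sum _ (fun k _ => W2n k)) _.
  by rewrite sumEFin sumr_const card_ord mulr_natl.
- by move=> k; apply/measurable_EFinP; exact: measurable_funX.
- by move=> k w _; rewrite lee_fin sqr_ge0.
Unshelve. all: by end_near. Qed.

(** A trigonometric [T] close to [f] on a large cube and bounded by [M] everywhere satisfies
    [|f - T| <= e1 + 2 * M * tail], and the tail is small under [gamma] and, uniformly for large
    [n], under [P]. *)
Lemma levy_cvg f : bounded_continuous f ->
  \int[P]_w f (W n w) @[n --> \oo] --> \int[gamma]_x f x.
Proof.
(* placeholder *)
move=> [cf [M fM]]; apply/cvgrPdist_le => e e0.
have M0 : 0 <= M := le_trans (normr_ge0 (f 0)) (fM 0).
pose e1 := e / 5; have e10 : 0 < e1 by rewrite divr_gt0.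
pose e2 := e1 / (2 * M + 1); have e20 : 0 < e2 by rewrite divr_gt0// ltr_wpDl// mulr_ge0.
have Me2 : 2 * M * e2 <= e1.
  by rewrite /e2 mulrCA ler_piMr ?(ltW e10)// ler_pdivrMr ?mul1r ?ltr_wpDl ?mulr_ge0//; lra.
have [K [K0 KG KW]] : exists K : R, [/\ 0 < K, \int[gamma]_x tail (K ^+ 2) x <= e2 &
    (K ^+ 2)^-1 * (p%:R * c) <= e2].
  have /cvgrPdist_le/(_ _ e20) t0 := tail_cvg0.
  near \oo => k; exists k.+1%:R; split=> //.
    have : `|0 - \int[gamma]_x tail (k.+1%:R ^+ 2) x| <= e2 by near: k; exact: t0.
    by rewrite sub0r normrN; exact: le_trans (ler_norm _).
  have kle : `|p%:R * c| / e2 <= k%:R by near: k; exact: nbhs_infty_ger.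
  rewrite (le_trans (ler_norm _))// normrM ger0_norm ?invr_ge0 ?exprn_ge0//.
  rewrite ler_pdivrMl ?exprn_gt0// -ler_pdivrMr// (le_trans kle)//.
  by rewrite expr2 (@le_trans _ _ k.+1%:R) ?ler_nat// ler_peMr// ler1n.
have [T [tT TM Tf]] := trig_approximation cf fM K0 e10.
have K20 : 0 <= K ^+ 2 by rewrite exprn_ge0// ltW.
have pw x : `|f x - T x| <= e1 + 2 * M * tail (K ^+ 2) x.
  have t0 := @tail_ge0 (K ^+ 2) x K20.
  have [H|/existsNP[k /negP]] := pselect (forall k, `|x k 0| <= K).
    by apply: le_trans (Tf _ H) _; rewrite lerDl !mulr_ge0.
  rewrite -ltNge => Kx; apply: (@le_trans _ _ (2 * M)).
    by rewrite (le_trans (ler_normB _ _))//; have := fM x; have := TM x; lra.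
  have := tail_ge1 K0 Kx => t1; have := ler_wpM2l (mulr_ge0 (ler0n R 2) M0) t1.
  rewrite mulr1; lra.
have cT := trig_continuous tT.
have diff d' (T' : measurableType d') (Q : probability T' R) (g : T' -> vec) :
    Q.-integrable setT (EFin \o (fun w => f (g w))) ->
    Q.-integrable setT (EFin \o (fun w => T (g w))) ->
    Q.-integrable setT (EFin \o (fun w => tail (K ^+ 2) (g w))) ->
    \int[Q]_w tail (K ^+ 2) (g w) <= e2 ->
    `|\int[Q]_w f (g w) - \int[Q]_w T (g w)| <= e1 + e1.
  move=> i1 i2 i3 le2; rewrite -(RintegralB measurableT i1 i2).
  have i4 : Q.-integrable setT (EFin \o (fun w => f (g w) - T (g w))).
    rewrite /comp; under eq_fun do rewrite EFinB; exact: integrableB.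
  have i5 : Q.-integrable setT (EFin \o (fun w => 2 * M * tail (K ^+ 2) (g w))).
    rewrite /comp; under eq_fun do rewrite EFinM; exact: integrableZl.
  have i6 : Q.-integrable setT (EFin \o cst e1).
    exact: (@bounded_integrable _ _ _ Q (cst e1) `|e1|).
  have i7 : Q.-integrable setT (EFin \o (fun w => e1 + 2 * M * tail (K ^+ 2) (g w))).
    rewrite /comp; under eq_fun do rewrite EFinD; exact: (integrableD measurableT i6 i5).
  apply: le_trans (le_normr_Rintegral measurableT i4) _.
  apply: le_trans (le_Rintegral measurableT (integrable_norm i4) i7 (fun w _ => pw (g w))) _.
  rewrite (RintegralD measurableT i6 i5) Rintegral_probability_cst lerD2l.
  rewrite (RintegralZl _ measurableT i3) (le_trans _ Me2)// ler_wpM2l// mulr_ge0//.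
have dG := diff _ _ gamma id (igam cf fM) (igam cT TM) (itailG K20) KG.
have K2gt0 : 0 < K ^+ 2 by rewrite exprn_gt0.
have /cvgrPdist_le/(_ _ e10) cTn := trig_cvg tT.
near=> n.
have tn : \int[P]_w tail (K ^+ 2) (W n w) <= e2.
  by apply: le_trans KW; near: n; exact: tail_W.
have dP := diff _ _ P (W n) (icomp n cf fM) (icomp n cT TM) (itailP n K20) tn.
have dT : `|\int[gamma]_x T x - \int[P]_w T (W n w)| <= e1 by near: n; exact: cTn.
rewrite (le_trans (ler_distD (\int[gamma]_x T x) _ _))//.
have -> : e = (e1 + e1) + (e1 + (e1 + e1)) by rewrite /e1; field.
rewrite lerD// (le_trans (ler_distD (\int[P]_w T (W n w)) _ _))// lerD//.
by rewrite distrC.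
Unshelve. all: by end_near. Qed.

End levy.

(** * The central limit theorem for random rotations *)

Section Rintegral_sums.
Context {R : realType} d (T : measurableType d) (mu : {measure set T -> \bar R}).

Lemma integrable_EFin_sum (I : Type) (r : seq I) (f : I -> T -> R) :
  (forall i, mu.-integrable setT (EFin \o f i)) ->
  mu.-integrable setT (EFin \o (fun x => \sum_(i <- r) f i x)).
Proof.
move=> fi; elim: r => [|i r IHr].
  rewrite (_ : _ \o _ = cst 0%E); first exact: integrable0.
  by apply/funext => x /=; rewrite big_nil.
rewrite (_ : _ \o _ = (fun x => (f i x)%:E + (\sum_(j <- r) f j x)%:E)%E).
  exact: (integrableD measurableT (fi i) IHr).
by apply/funext => x /=; rewrite big_cons EFinD.
Qed.

Lemma integrable_EFinZl (a : R) (f : T -> R) : mu.-integrable setT (EFin \o f) ->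
  mu.-integrable setT (EFin \o (fun x => a * f x)).
Proof. by move=> fi; rewrite /comp; under eq_fun do rewrite EFinM; exact: integrableZl. Qed.

Lemma Rintegral_sum (I : Type) (r : seq I) (f : I -> T -> R) :
  (forall i, mu.-integrable setT (EFin \o f i)) ->
  \int[mu]_x (\sum_(i <- r) f i x) = \sum_(i <- r) \int[mu]_x f i x.
Proof.
move=> fi; elim: r => [|i r IHr].
  under eq_Rintegral do rewrite big_nil.
  by rewrite /Rintegral integral0 big_nil.
under eq_Rintegral do rewrite big_cons.
by rewrite (RintegralD measurableT (fi i) (integrable_EFin_sum r fi)) IHr big_cons.
Qed.

End Rintegral_sums.

Section clip.
Context {R : realType} {p : nat}.
Local Notation vec := 'cV[R]_p.
Local Notation mat := 'M[R]_p.
Variables (G : set mat) (haar : probability (Bor mat) R).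
Hypotheses (GO : compact_subgroup_O G) (Ghaar : is_haar G haar).

(* Almost surely the identity; it makes every function of a rotation bounded. *)
Definition clip (Q : Bor mat) : Bor mat := if `[< G Q >] then Q else 1%:M.

Lemma clip_id Q : G Q -> clip Q = Q.
Proof. by move=> GQ; rewrite /clip asboolT. Qed.

Lemma clip_group Q : G (clip Q).
Proof. by rewrite /clip; case: asboolP => // _; have [] := GO. Qed.

Lemma measurable_clip : measurable_fun setT clip.
Proof.
have mG := measurable_group GO.
move=> _ C mC; rewrite setTI.
rewrite [X in measurable X](_ : _ = ((G : set (Bor mat)) `&` C) `|`
    (~` (G : set (Bor mat)) `&` (if `[< C 1%:M >] then setT else set0))).
  apply: measurableU; apply: measurableI => //; first exact: measurableC.
  by case: asboolP.
apply/seteqP; split=> Q; rewrite /preimage /= /clip;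
  have [GQ|GQ] := pselect (G Q); rewrite ?(asboolT GQ) ?(asboolF GQ).
- by left.
- by move=> C1; right; split=> //; rewrite asboolT.
- by move=> [[_ CQ]|[nG]].
- by move=> [[]//|[_]]; case: asboolP.
Qed.

Lemma integral_clip (f : Bor mat -> \bar R) : measurable_fun setT f ->
  (\int[haar]_Q f Q = \int[haar]_Q f (clip Q))%E.
Proof.
move=> mf; apply: ae_eq_integral => //.
  exact: measurableT_comp mf measurable_clip.
exists (~` G); split.
- by apply: measurableC; exact: measurable_group.
- exact: haar_setC.
- by move=> Q /= nQ GQ; apply: nQ => _; rewrite clip_id.
Qed.

Lemma clip_coord_le Q a c : `|(clip Q : mat) a c| <= 1.
Proof. exact: le_trans (ler_coord_norm _ _ _) (group_norm GO (clip_group Q)). Qed.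

Lemma measurable_clip_coord a c : measurable_fun setT (fun Q => (clip Q : mat) a c).
Proof. exact: measurable_fun_coord measurable_clip. Qed.

Let iclip a c : haar.-integrable setT (EFin \o (fun Q => (clip Q : mat) a c)).
Proof.
by apply: (@bounded_integrable _ _ _ haar _ 1) => [|Q];
  [exact: measurable_clip_coord|exact: clip_coord_le].
Qed.

Let iclip2 a c b e : haar.-integrable setT
  (EFin \o (fun Q => (clip Q : mat) a c * (clip Q : mat) b e)).
Proof.
apply: (@bounded_integrable _ _ _ haar _ 1) => [|Q].
  by apply: measurable_funM; exact: measurable_clip_coord.
by rewrite normrM mulr_ile1 ?clip_coord_le.
Qed.

Definition second_moment (v : vec) a b : R :=
  \int[haar]_Q (((clip Q : mat) *m v) a 0 * ((clip Q : mat) *m v) b 0).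

Let prodE (Q : mat) (v : vec) a b : (Q *m v) a 0 * (Q *m v) b 0 =
  \sum_c \sum_e (v c 0 * v e 0) * (Q a c * Q b e).
Proof.
rewrite !mxE mulr_suml; apply: eq_bigr => c _; rewrite mulr_sumr.
by apply: eq_bigr => e _; ring.
Qed.

Lemma integrable_clip_prod (v : vec) a b : haar.-integrable setT
  (EFin \o (fun Q => ((clip Q : mat) *m v) a 0 * ((clip Q : mat) *m v) b 0)).
Proof.
rewrite (_ : (fun Q => _) = (fun Q => \sum_c \sum_e (v c 0 * v e 0) *
  ((clip Q : mat) a c * (clip Q : mat) b e))); last by apply/funext => Q; rewrite prodE.
by apply: integrable_EFin_sum => c; apply: integrable_EFin_sum => e; exact: integrable_EFinZl.
Qed.

Lemma second_momentE (v : vec) a b : second_moment v a b =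
  \sum_c \sum_e (v c 0 * v e 0) *
    \int[haar]_Q ((clip Q : mat) a c * (clip Q : mat) b e).
Proof.
rewrite /second_moment; under eq_Rintegral do rewrite prodE.
rewrite Rintegral_sum => [|c]; last first.
  by apply: integrable_EFin_sum => e; exact: integrable_EFinZl.
apply: eq_bigr => c _; rewrite Rintegral_sum => [|e]; last exact: integrable_EFinZl.
by apply: eq_bigr => e _; rewrite RintegralZl.
Qed.

Lemma Rintegral_sqr_dotv (t v : vec) :
  \int[haar]_Q (dotv t ((clip Q : mat) *m v) ^+ 2) =
  \sum_a \sum_b (t a 0 * t b 0) * second_moment v a b.
Proof.
have E (u : vec) : dotv t u ^+ 2 = \sum_a \sum_b (t a 0 * t b 0) * (u a 0 * u b 0).
  rewrite expr2 dotvE mulr_suml; apply: eq_bigr => a _; rewrite mulr_sumr.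
  by apply: eq_bigr => b _; ring.
under eq_Rintegral do rewrite E.
rewrite Rintegral_sum => [|a]; last first.
  by apply: integrable_EFin_sum => b; apply: integrable_EFinZl; exact: integrable_clip_prod.
apply: eq_bigr => a _; rewrite Rintegral_sum => [|b]; last first.
  by apply: integrable_EFinZl; exact: integrable_clip_prod.
by apply: eq_bigr => b _; rewrite RintegralZl//; exact: integrable_clip_prod.
Qed.

Hypothesis centered : forall a b : 'I_p, (\int[haar]_Q (Q a b)%:E)%E = 0%E.

Lemma Rintegral_clip_coord a c : \int[haar]_Q (clip Q : mat) a c = 0.
Proof.
rewrite /Rintegral -(@integral_clip (fun Q => ((Q : mat) a c)%:E)) ?centered//.
by apply/measurable_EFinP; exact: measurable_coord.
Qed.

Lemma integrable_clip_mul (v : vec) a :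
  haar.-integrable setT (EFin \o (fun Q => ((clip Q : mat) *m v) a 0)).
Proof.
rewrite (_ : (fun Q => _) = (fun Q => \sum_c v c 0 * (clip Q : mat) a c)).
  by apply: integrable_EFin_sum => c; exact: integrable_EFinZl.
by apply/funext => Q; rewrite mxE; apply: eq_bigr => c _; rewrite mulrC.
Qed.

Lemma Rintegral_clip_mul (v : vec) a : \int[haar]_Q ((clip Q : mat) *m v) a 0 = 0.
Proof.
under eq_Rintegral do rewrite mxE.
rewrite Rintegral_sum => [|c]; last first.
  by under eq_fun do rewrite mulrC; exact: integrable_EFinZl.
rewrite big1// => c _; under eq_Rintegral do rewrite mulrC.
by rewrite RintegralZl// Rintegral_clip_coord mulr0.
Qed.

Lemma Rintegral_dotv_clip (t v : vec) : \int[haar]_Q dotv t ((clip Q : mat) *m v) = 0.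
Proof.
under eq_Rintegral do rewrite dotvE.
rewrite Rintegral_sum => [|a]; last by apply: integrable_EFinZl; exact: integrable_clip_mul.
rewrite big1// => a _; rewrite (RintegralZl _ measurableT (integrable_clip_mul v a)).
by rewrite Rintegral_clip_mul mulr0.
Qed.

Variables (nu : probability (Bor vec) R) (J : vec -> vec).
Hypothesis iJJ : forall a b, nu.-integrable setT (fun x => (J x a 0 * J x b 0)%:E).

Lemma Sigma_ERDE a b : Sigma_ERD haar nu J a b = \int[nu]_x second_moment (J x) a b.
Proof.
have mprod (v : vec) a' : measurable_fun setT (fun Q : Bor mat => ((Q : mat) *m v) a' 0).
  under eq_fun do rewrite mxE; apply: measurable_sum => c.
  by apply: measurable_funM => //; exact: measurable_coord.
have z a' : E_ERD haar nu (fun Q h => (Q *m J h) a' 0) = 0%E.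
  rewrite /E_ERD -[RHS](integral0 nu setT); apply: eq_integral => h _.
  rewrite (@integral_clip (fun Q => (((Q : mat) *m J h) a' 0)%:E)); last exact/measurable_EFinP.
  by rewrite -[LHS]fineK ?(integrable_fin_num _ (integrable_clip_mul _ _))//;
    congr EFin; exact: Rintegral_clip_mul.
rewrite mxE !z/= mulr0 subr0 /Rintegral /E_ERD; congr fine.
apply: eq_integral => h _.
rewrite (@integral_clip (fun Q => (((Q : mat) *m J h) a 0 * ((Q : mat) *m J h) b 0)%:E)).
  by rewrite /second_moment fineK//; exact: integrable_fin_num (integrable_clip_prod _ _ _).
by apply/measurable_EFinP; exact: measurable_funM.
Qed.

End clip.

Section rotation_clt.
Context {R : realType} {p : nat}.
Local Notation vec := 'cV[R]_p.
Local Notation mat := 'M[R]_p.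
Variables (G : set mat) (haar : probability (Bor mat) R).
Hypotheses (GO : compact_subgroup_O G) (Ghaar : is_haar G haar).
Hypothesis centered : forall a b : 'I_p, (\int[haar]_Q (Q a b)%:E)%E = 0%E.
Variables (h : forall n : nat, 'I_n -> vec) (nu : probability (Bor vec) R)
  (J : vec -> vec).
Hypothesis iJJ : forall a b, nu.-integrable setT (fun x => (J x a 0 * J x b 0)%:E).
Hypothesis JJ_cvg : forall a b,
  avg h n (fun x => J x a 0 * J x b 0) @[n --> \oo] --> \int[nu]_x (J x a 0 * J x b 0).
Hypothesis J_max : forall e : R, 0 < e ->
  \forall n \near \oo, forall i : 'I_n, \sum_a (J (h i) a 0) ^+ 2 <= e * n%:R.
Context d (Omega : measurableType d) (P : probability Omega R).
Variable Y : forall n : nat, 'I_n -> Omega -> Bor mat.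
Hypothesis mY : forall n (i : 'I_n), measurable_fun setT (Y i).
Hypothesis indY : forall n (A : 'I_n -> set (Bor mat)), (forall i, measurable (A i)) ->
  P [set w | forall i, A i (Y i w)] = (\prod_(i < n) haar (A i))%E.

Local Notation clip := (clip G).
Local Notation second_moment := (second_moment G haar).
Local Notation S a b := (\int[nu]_x second_moment (J x) a b).

Definition clipped_stat n w : Bor vec := (Num.sqrt n%:R)^-1 *:
  \sum_(i < n) ((clip (Y i w) : mat) *m J (h i)).

Let xi (t : vec) n (i : 'I_n) (q : Bor mat) : R :=
  dotv t ((clip q : mat) *m ((Num.sqrt n%:R)^-1 *: J (h i))).

Let mxi t n (i : 'I_n) : measurable_fun setT (xi t i).
Proof.
rewrite /xi; under eq_fun do rewrite dotvE.
apply: measurable_sum => k; apply: measurable_funM => //.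
under eq_fun do rewrite mxE; apply: measurable_sum => l.
by apply: measurable_funM => //; exact: measurable_clip_coord.
Qed.

Lemma measurable_clipped_stat n : measurable_fun setT (clipped_stat n).
Proof.
apply: measurable_fun_mx => k j; rewrite ord1.
under eq_fun do rewrite mxE summxE.
apply: measurable_funM => //; apply: measurable_sum => i.
under eq_fun do rewrite mxE; apply: measurable_sum => l; apply: measurable_funM => //.
exact: measurableT_comp (measurable_clip_coord GO k l) (mY i).
Qed.

Let psumE t n w : psum (@Y n) (@xi t n) n w = dotv t (clipped_stat n w).
Proof.
rewrite /psum /clipped_stat dotvZr dotv_sumr mulr_sumr.
rewrite (eq_bigl xpredT) => [|i]; last by rewrite ltn_ord.
by apply: eq_bigr => i _; rewrite /xi -scalemxAr dotvZr.
Qed.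

Let xi_mean t n (i : 'I_n) : \int[haar]_q xi t i q = 0.
Proof. exact: Rintegral_dotv_clip. Qed.

Let sqrtVK n : (Num.sqrt n%:R)^-1 ^+ 2 = n%:R^-1 :> R.
Proof. by rewrite exprVn sqr_sqrtr. Qed.

Let second_momentZ (c : R) (v : vec) a b :
  second_moment (c *: v) a b = c ^+ 2 * second_moment v a b.
Proof.
rewrite !second_momentE// mulr_sumr; apply: eq_bigr => k _; rewrite mulr_sumr.
by apply: eq_bigr => l _; rewrite !mxE; ring.
Qed.

Let varE t n : \sum_(i < n | (i < n)%N) \int[haar]_q (xi t i q ^+ 2) =
  \sum_a \sum_b (t a 0 * t b 0) * avg h n (fun x => second_moment (J x) a b).
Proof.
rewrite (eq_bigl xpredT) => [|i]; last by rewrite ltn_ord.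
transitivity (\sum_(i < n) \sum_a \sum_b (t a 0 * t b 0) *
    (n%:R^-1 * second_moment (J (h i)) a b)).
  apply: eq_bigr => i _; rewrite /xi Rintegral_sqr_dotv//.
  by apply: eq_bigr => a _; apply: eq_bigr => b _; rewrite second_momentZ sqrtVK.
rewrite exchange_big/=; apply: eq_bigr => a _.
rewrite exchange_big/=; apply: eq_bigr => b _.
by rewrite /avg !mulr_sumr.
Qed.

Lemma second_moment_cvg a b :
  avg h n (fun x => second_moment (J x) a b) @[n --> \oo] --> S a b.
Proof.
have -> : S a b = \sum_c \sum_e
    \int[haar]_Q ((clip Q : mat) a c * (clip Q : mat) b e) *
    \int[nu]_x (J x c 0 * J x e 0).
  transitivity (\int[nu]_x \sum_c \sum_e
    (\int[haar]_Q ((clip Q : mat) a c * (clip Q : mat) b e) * (J x c 0 * J x e 0))).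
    apply: eq_Rintegral => x _; rewrite second_momentE//; apply: eq_bigr => c _.
    by apply: eq_bigr => e _; rewrite mulrC.
  rewrite Rintegral_sum => [|c]; last first.
    by apply: integrable_EFin_sum => e; apply: integrable_EFinZl; exact: iJJ.
  apply: eq_bigr => c _; rewrite Rintegral_sum => [|e]; last first.
    by apply: integrable_EFinZl; exact: iJJ.
  by apply: eq_bigr => e _; rewrite (RintegralZl _ measurableT (iJJ c e)).
rewrite (_ : (fun n => _) = (fun n => \sum_c \sum_e
    \int[haar]_Q ((clip Q : mat) a c * (clip Q : mat) b e) *
    avg h n (fun x => J x c 0 * J x e 0))).
  by apply: cvgr_sum => c; apply: cvgr_sum => e; apply: cvgMr; exact: JJ_cvg.
apply/funext => n; rewrite /avg; under eq_bigr do rewrite second_momentE//.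
rewrite exchange_big/= mulr_sumr; apply: eq_bigr => c _.
rewrite exchange_big/= mulr_sumr; apply: eq_bigr => e _.
by rewrite mulrCA -mulr_suml [X in _ * X]mulrC.
Qed.

Let V t n : R := \sum_(i < n | (i < n)%N) \int[haar]_q (xi t i q ^+ 2).
Let Vlim (t : vec) : R := \sum_a \sum_b (t a 0 * t b 0) * S a b.

Let V_cvg t : V t n @[n --> \oo] --> Vlim t.
Proof.
rewrite /V; under eq_fun do rewrite varE.
by apply: cvgr_sum => a; apply: cvgr_sum => b; apply: cvgMr; exact: second_moment_cvg.
Qed.

Lemma Vlim_Sigma t : Vlim t = (t^T *m Sigma_ERD haar nu J *m t) 0 0.
Proof.
rewrite mxE /Vlim exchange_big/=; apply: eq_bigr => b _; rewrite mxE mulr_suml.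
by apply: eq_bigr => a _; rewrite mxE (@Sigma_ERDE _ _ G)//; ring.
Qed.

Let xi_small t (delta : R) : 0 < delta ->
  \forall n \near \oo, forall (i : 'I_n) q, `|xi t i q| <= delta.
Proof.
move=> delta0; pose B : R := p%:R * p%:R * `|t|.
have B0 : 0 <= B by rewrite !mulr_ge0.
pose eta : R := delta / (B + 1).
have eta0 : 0 < eta by rewrite divr_gt0// ltr_wpDl.
have eta20 : 0 < eta ^+ 2 by rewrite exprn_gt0.
have := J_max eta20; apply: filterS => n Jn i q.
have n0 : (0 < n)%N := leq_ltn_trans (leq0n i) (ltn_ord i).
have sn0 : 0 < Num.sqrt n%:R :> R by rewrite sqrtr_gt0 ltr0n.
have le1 l : `|((Num.sqrt n%:R)^-1 *: J (h i)) l 0| <= eta.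
  rewrite mxE normrM gtr0_norm ?invr_gt0// ler_pdivrMl//.
  rewrite -(@ler_pXn2r _ 2) ?nnegrE//; last exact/ltW/mulr_gt0.
  rewrite real_normK ?num_real// exprMn sqr_sqrtr// mulrC (le_trans _ (Jn i))//.
  rewrite (bigD1 l)//= lerDl; apply: sumr_ge0 => k _; exact: sqr_ge0.
have := group_dotv_le GO ((Num.sqrt n%:R)^-1 *: J (h i)) t (clip_group GO q).
rewrite /= => le_xi; apply: (le_trans le_xi).
apply: (@le_trans _ _ (p%:R * (p%:R * eta) * `|t| : R)).
  rewrite ler_wpM2r//.
  have -> : p%:R * (p%:R * eta) = \sum_(k < p) \sum_(l < p) eta.
    by rewrite !sumr_const !card_ord -[RHS]mulr_natl -[X in _ = _ * X]mulr_natl.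
  by apply: ler_sum => k _; apply: ler_sum => l _.
have -> : p%:R * (p%:R * eta) * `|t| = eta * B by rewrite /B; ring.
by rewrite /eta mulrAC ler_pdivrMr ?ltr_wpDl// ler_wpM2l ?(ltW delta0)// lerDl.
Qed.

Lemma char_dist t (e : R) : 0 < e -> \forall n \near \oo,
  `|\int[P]_w cos (dotv t (clipped_stat n w)) - expR (- (V t n / 2))| +
  `|\int[P]_w sin (dotv t (clipped_stat n w))| <= e.
Proof.
move=> e0; pose c : R := `|Vlim t| + 1; pose delta : R := Num.min 1 (e / (3 * c)).
have c0 : 0 < c by rewrite ltr_wpDl.
have delta0 : 0 < delta by rewrite lt_min ltr01 divr_gt0// mulr_gt0.
have Vc : Vlim t < c by rewrite (le_lt_trans (ler_norm _))// ltrDl.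
near=> n.
have xin : forall (i : 'I_n) q, `|xi t i q| <= delta by near: n; exact: xi_small.
have Vn : V t n <= c by near: n; exact: (@cvgr_le _ _ _ _ _ _ (@V_cvg _) _ Vc).
have delta1 : delta <= 1 by rewrite ge_min lexx.
have := char_le (0 : Bor mat) (@mY n) (@indY n) (@mxi t n) xin delta1 (@xi_mean t n) (leqnn n).
under [X in `|X - _|]eq_Rintegral do rewrite psumE.
under [X in _ + `|X|]eq_Rintegral do rewrite psumE.
move/le_trans; apply; apply: (@le_trans _ _ (3 * delta * c)).
  by rewrite ler_wpM2l// mulr_ge0// ltW.
by rewrite mulrAC -ler_pdivlMl ?mulr_gt0// mulrC ge_min lexx orbT.
Unshelve. all: by end_near. Qed.

Lemma cos_cvg t :
  \int[P]_w cos (dotv t (clipped_stat n w)) @[n --> \oo] --> expR (- (Vlim t / 2)).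
Proof.
have eV : expR (- (V t n / 2)) @[n --> \oo] --> expR (- (Vlim t / 2)).
  apply: (@continuous_cvg _ _ _ _ _ _ (fun x => expR x)).
    exact: continuous_expR.
  by apply: cvgN; apply: cvgMl; exact: V_cvg.
move/cvgrPdist_le : eV => eV.
apply/cvgrPdist_le => e e0; have e20 : 0 < e / 2 by rewrite divr_gt0.
near=> n.
have h1 : `|expR (- (Vlim t / 2)) - expR (- (V t n / 2))| <= e / 2.
  by near: n; exact: eV.
have h2 : `|\int[P]_w cos (dotv t (clipped_stat n w)) - expR (- (V t n / 2))| +
    `|\int[P]_w sin (dotv t (clipped_stat n w))| <= e / 2.
  by near: n; exact: char_dist.
rewrite (le_trans (ler_distD (expR (- (V t n / 2))) _ _))// [leRHS]splitr lerD//.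
by rewrite distrC (le_trans _ h2)// lerDl.
Unshelve. all: by end_near. Qed.

Lemma sin_cvg t :
  \int[P]_w sin (dotv t (clipped_stat n w)) @[n --> \oo] --> (0 : R).
Proof.
apply/cvgrPdist_le => e e0; near=> n.
have : `|\int[P]_w cos (dotv t (clipped_stat n w)) - expR (- (V t n / 2))| +
    `|\int[P]_w sin (dotv t (clipped_stat n w))| <= e.
  by near: n; exact: char_dist.
by apply: le_trans; rewrite distrC subr0 lerDr.
Unshelve. all: by end_near. Qed.

Lemma clipped_stat_sqr : exists c : R, \forall n \near \oo, forall k,
  (\int[P]_w ((clipped_stat n w : vec) k 0 ^+ 2)%:E <= c%:E)%E.
Proof.
pose c k : R := `|Vlim (delta_mx k 0)| + 1.
have c0 k : 0 <= c k by rewrite addr_ge0.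
exists (\sum_k c k); apply: filter_forall => k.
have Vc : Vlim (delta_mx k 0) < c k by rewrite (le_lt_trans (ler_norm _))// ltrDl.
near=> n.
have xin : forall (i : 'I_n) q, `|xi (delta_mx k 0) i q| <= 1.
  by near: n; exact: xi_small.
have Vn : V (delta_mx k 0) n <= c k by near: n; exact: (@cvgr_le _ _ _ _ _ _ (@V_cvg _) _ Vc).
have E w : (clipped_stat n w : vec) k 0 = psum (@Y n) (@xi (delta_mx k 0) n) n w.
  by rewrite psumE dotv_deltal.
under eq_integral do rewrite E.
rewrite -(@EFin_bounded_integral _ _ _ P (fun w => psum (@Y n) (@xi (delta_mx k 0) n) n w ^+ 2)
  ((n%:R * 1) ^+ 2)); first last.
- by move=> w; rewrite normrX ler_pXn2r ?nnegrE ?mulr_ge0// (psum_le _ (0 : Bor mat)).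
- apply: measurable_funX.
  rewrite (_ : psum _ _ _ = fun w => (clipped_stat n w : vec) k 0); last exact/esym/funext.
  exact: measurable_fun_coord (measurable_clipped_stat n).
rewrite (Rintegral_sqr_psum (0 : Bor mat) (@mY n) (@indY n) (@mxi _ n) xin (@xi_mean _ n))//.
by rewrite lee_fin (le_trans Vn)// (bigD1 k)//= lerDl sumr_ge0.
Unshelve. all: by end_near. Qed.

Lemma rotation_clt (gamma : probability (Bor vec) R) (f : vec -> R) :
  is_normal0 (Sigma_ERD haar nu J) gamma -> bounded_continuous f ->
  \int[P]_w f (clipped_stat n w) @[n --> \oo] --> \int[gamma]_x f x.
Proof.
move=> gammaN fb; have [c W2] := clipped_stat_sqr.
apply: (levy_cvg measurable_clipped_stat W2) => // t; have [gcos gsin] := gammaN t.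
- rewrite /Rintegral gcos /= -Vlim_Sigma mulNr; exact: cos_cvg.
- rewrite /Rintegral gsin /=; exact: sin_cvg.
Qed.

Lemma integral_clipped_stat n (f : vec -> R) : bounded_continuous f ->
  (\int[P]_w (f ((Num.sqrt n%:R)^-1 *: \sum_(i < n) ((Y i w : mat) *m J (h i))))%:E)%E =
  (\int[P]_w f (clipped_stat n w))%:E.
Proof.
move=> [cf [M fM]]; have mf := continuous_measurable_mx cf.
rewrite (EFin_bounded_integral P (measurableT_comp mf (measurable_clipped_stat n))
  (fun w => fM _)).
have mG := measurable_group GO.
have mE : measurable [set w | forall i : 'I_n, G (Y i w)].
  rewrite (_ : mkset _ = \bigcap_(i in [set: 'I_n]) (Y i @^-1` G)); last first.
    by apply/seteqP; split=> [w Gw i _|w Gw i]; [exact: Gw|exact: (Gw i)].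
  apply: fin_bigcap_measurable => // i _; rewrite -[X in measurable X]setTI.
  exact: mY.
have mW : measurable_fun setT (fun w => (Num.sqrt n%:R)^-1 *:
    \sum_(i < n) ((Y i w : mat) *m J (h i)) : Bor vec).
  apply: measurable_fun_mx => k j; rewrite ord1.
  under eq_fun do rewrite mxE summxE.
  apply: measurable_funM => //; apply: measurable_sum => i.
  under eq_fun do rewrite mxE; apply: measurable_sum => l; apply: measurable_funM => //.
  by apply: measurable_fun_coord; exact: mY.
apply: ae_eq_integral => //.
- by apply/measurable_EFinP; exact: measurableT_comp mf mW.
- by apply/measurable_EFinP; exact: measurableT_comp mf (measurable_clipped_stat n).
- exists (~` [set w | forall i : 'I_n, G (Y i w)]); split; first exact: measurableC.
    apply: etrans (probability_setC P mE) _; rewrite (indY (A := fun=> G))//.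
    by rewrite big1 ?subee// => i _; have [] := Ghaar.
  apply: subsetC => w Gw _; congr (f _)%:E; rewrite /clipped_stat; congr (_ *: _).
  by apply: eq_bigr => i _; rewrite clip_id.
Qed.

End rotation_clt.

Theorem mainTheorem6
  (R : realType) (p : nat)
  (* the group G and its normalized Haar measure Uniform(G) *)
  (G : set 'M[R]_p) (haar : probability (Bor 'M[R]_p) R)
  (* the data distribution mu *)
  (mu : probability (Bor 'cV[R]_p) R)
  (* the reference set B, reference points h_1..h_n (for each n), limit nu *)
  (B : set 'cV[R]_p) (h : forall n : nat, 'I_n -> 'cV[R]_p)
  (nu : probability (Bor 'cV[R]_p) R)
  (* the score function *)
  (J : 'cV[R]_p -> 'cV[R]_p)
  (* the underlying probability space, data, and tie-breaking kernel *)
  (d : measure_display) (Omega : measurableType d) (P : probability Omega R)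
  (X : nat -> Omega -> Bor 'cV[R]_p)
  (kappa : 'cV[R]_p -> 'cV[R]_p -> probability (Bor 'M[R]_p) R)
  (* the selected optimal solution: sigma-hat and (Q-hat_i) for each n *)
  (sig : forall n : nat, Omega -> {perm 'I_n})
  (Qh : forall n : nat, Omega -> 'I_n -> Bor 'M[R]_p) :
  (* setting *)
  compact_subgroup_O G ->
  is_haar G haar ->
  has_lebesgue_density mu ->
  (forall n (i : 'I_n), B (h n i)) ->
  (exists D : set (Bor 'cV[R]_p), [/\ measurable D, D `<=` B & nu D = 1%E]) ->
  measurable_fun setT (J : Bor 'cV[R]_p -> Bor 'cV[R]_p) ->
  (* X_1, X_2, ... i.i.d. with law mu *)
  (forall j, measurable_fun setT (X j)) ->
  (forall j (A : set (Bor 'cV[R]_p)), measurable A -> P (X j @^-1` A) = mu A) ->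
  (forall n (A : 'I_n -> set (Bor 'cV[R]_p)), (forall j, measurable (A j)) ->
     P [set w | forall j : 'I_n, A j (X j w)] = (\prod_(j < n) P (X j @^-1` A j))%E) ->
  (* tie-breaking: the conditional law of Q-hat_i is Uniform(G) conditioned on
     the minimizing set *)
  (forall x hh, unif_cond G haar (MinSet G x hh) (kappa x hh)) ->
  (forall hh (C : set (Bor 'M[R]_p)), measurable C ->
     measurable_fun setT (fun x : Bor 'cV[R]_p => kappa x hh C)) ->
  (forall n (s : {perm 'I_n}), measurable [set w | sig n w = s]) ->
  (forall n (i : 'I_n), measurable_fun setT (fun w => Qh n w i)) ->
  (forall n (A : 'I_n -> set (Bor 'cV[R]_p)) (s : {perm 'I_n})
       (C : 'I_n -> set (Bor 'M[R]_p)),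
     (forall j, measurable (A j)) -> (forall i, measurable (C i)) ->
     P [set w | [/\ forall j : 'I_n, A j (X j w), sig n w = s &
                    forall i : 'I_n, C i (Qh n w i)]]
     = (\int[P]_w
         ((\1_[set w' | forall j : 'I_n, A j (X j w')] w)%:E
          * (if `[< opt_perm G (fun j : 'I_n => X j w) (h n) s >]
             then (n_opt G (fun j : 'I_n => X j w) (h n))%:R^-1 else 0)%:E
          * \prod_(i < n) kappa (X (s i) w) (h n i) (C i)))%E) ->
  (* H0 : X_1 =d Q X_1 for all Q in G *)
  (forall Q, G Q -> forall A : set (Bor 'cV[R]_p), measurable A ->
     mu ((fun x : Bor 'cV[R]_p => (Q *m x : Bor 'cV[R]_p)) @^-1` A) = mu A) ->
  (* A2 : nu_n -> nu weakly *)
  (forall f, bounded_continuous f ->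
     (fun n => ((n%:R)^-1 * \sum_(i < n) f (h n i))%:E) @ \oo
       --> (\int[nu]_x (f x)%:E)%E) ->
  (* A4(iii) *)
  (forall a b : 'I_p,
     (fun n => ((n%:R)^-1 * \sum_(i < n) `|J (h n i) a 0 * J (h n i) b 0|)%:E) @ \oo
       --> (\int[nu]_x (`|J x a 0 * J x b 0|)%:E)%E
     /\ (\int[nu]_x (`|J x a 0 * J x b 0|)%:E < +oo)%E) ->
  (* A5(i) : E[S] = 0 *)
  (forall a b : 'I_p, (\int[haar]_Q (Q a b)%:E)%E = 0%E) ->
  (* J is nu-a.e. continuous (as a map on B) *)
  nu.-negligible [set x | B x /\ ~ cont_within B J x] ->
  (* conclusion: W_n converges in distribution to N(0, Sigma_ERD) *)
  forall gamma : probability (Bor 'cV[R]_p) R,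
    is_normal0 (Sigma_ERD haar nu J) gamma ->
  forall f, bounded_continuous f ->
    (fun n => (\int[P]_w
       (f ((Num.sqrt (n%:R))^-1 *:
            \sum_(i < n) (Qh n w (((sig n w)^-1)%g i) *m J (h n (((sig n w)^-1)%g i)))))%:E)%E)
    @ \oo --> (\int[gamma]_x (f x)%:E)%E.
Proof.
move=> GO Ghaar dens hB [D [mD DB nuD]] mJ mX lawX indX kappaP mkappa msig mQh joint.
move=> mu_inv weak moments centered Jae gamma gammaN f fb.
have mY n (i : 'I_n) : measurable_fun setT (fun w => Qh n w i) by exact: mQh.
have indY n (A : 'I_n -> set (Bor 'M[R]_p)) : (forall i, measurable (A i)) ->
    P [set w | forall i, A i (Qh n w i)] = (\prod_(i < n) haar (A i))%E.
  apply: (rotation_law GO Ghaar dens (fun j : 'I_n => mX j) _ kappaP mkappa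
    (msig n) (mQh n) (joint n) mu_inv) => C mC.
  by rewrite indX//; apply: eq_bigr => j _; exact: lawX.
have JJ_cvg := moment_cvg hB mD DB nuD mJ weak moments Jae.
have J_max := max_vanish hB mD DB nuD mJ weak moments Jae.
have clt := rotation_clt GO Ghaar centered (integrable_JJ mJ moments) JJ_cvg J_max mY indY
  gammaN fb.
have [cf [M fM]] := fb.
rewrite -(EFin_bounded_integral gamma (continuous_measurable_mx cf) fM).
rewrite (_ : (fun n => _) = (fun n => (\int[P]_w f (clipped_stat G h J
    (fun n (i : 'I_n) w => Qh n w i) n w))%:E)).
  by apply: cvg_EFin => //; exact: nearW.
apply/funext => n; rewrite -(integral_clipped_stat GO Ghaar h J mY indY)//.
apply: eq_integral => w _; congr (f (_ *: _))%:E.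
rewrite (reindex_inj (@perm_inj _ (sig n w)))/=.
by apply: eq_bigr => i _; rewrite permK.
Qed.
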